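(* Let $K$ be any field, let $a\in K\setminus\{0\}$, let $n\in\{3,4,5\}$, and let the symmetric group $S_n$ act on the rational function field $K(x_1,\ldots,x_n)$ in $n$ variables by $K$-automorphisms via $$\sigma(x_i)=\begin{cases} x_{\sigma(i)}, & \text{if } \sigma\in A_n,\\ a/x_{\sigma(i)}, & \text{if } \sigma\in S_n\setminus A_n,\end{cases}\qquad 1\le i\le n,$$ where $A_n$ is the alternating group of degree $n$. Then the fixed field $K(x_1,\ldots,x_n)^{S_n}$ is rational over $K$.
   Context: A field extension $L/K$ is called rational over $K$ if it is purely transcendental over $K$, i.e. $L$ is generated over $K$ by finitely many elements algebraically independent over $K$. The fixed field is $K(x_1,\ldots,x_n)^{S_n}=\{\beta\in K(x_1,\ldots,x_n) : \sigma(\beta)=\beta \text{ for all } \sigma\in S_n\}$. *)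

(* Defs.v *)
From HB Require Import structures.
From mathcomp Require Import all_boot all_algebra fingroup perm alt.
From mathcomp Require Import generic_quotient fraction mpoly.

Set Implicit Arguments.
Unset Strict Implicit.
Unset Printing Implicit Defensive.

Import GRing.Theory.
Local Open Scope ring_scope.
Local Open Scope quotient_scope.

Notation "x %:F" := (@FracField.tofrac _ x) : ring_scope.

Section Rational.
Variables (K E : fieldType) (iota : {rmorphism K -> E}).

Definition algebraically_independent (m : nat) (y : 'I_m -> E) : Prop :=
  forall p : {mpoly K[m]}, mmap iota y p = 0 -> p = 0.

(* The subfield of [E] generated by the image of [K] and the [y i]; note that
   [x / 0 = 0] in a [fieldType], so [adjoined_div] needs no side condition. *)
Inductive adjoined (m : nat) (y : 'I_m -> E) : E -> Prop :=
| adjoined_base c : adjoined y (iota c)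
| adjoined_gen i : adjoined y (y i)
| adjoined_sub u v : adjoined y u -> adjoined y v -> adjoined y (u - v)
| adjoined_div u v : adjoined y u -> adjoined y v -> adjoined y (u / v).

(* [L] is a subset of the ambient field [E]; the last clause makes it the
   intermediate field K(y_0, ..., y_(m-1)). *)
Definition rational_over (L : {pred E}) : Prop :=
  exists (m : nat) (y : 'I_m -> E),
    algebraically_independent y /\ (forall f : E, f \in L <-> adjoined y f).

End Rational.

Section TwistedAction.
Variables (K : fieldType) (n : nat).

Definition ratfun : fieldType := {fraction {mpoly K[n]}}.

Definition ratfunC : {rmorphism K -> ratfun} :=
  (@FracField.tofrac {mpoly K[n]} : {rmorphism {mpoly K[n]} -> ratfun}) \o
  (@mpolyC n K : {rmorphism K -> {mpoly K[n]}}).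

Definition ratfunX (i : 'I_n) : ratfun := ('X_i : {mpoly K[n]})%:F.

(* [ratfun_subst v f] is f(v_0, ..., v_(n-1)), computed on the representative
   fraction of [f]. *)
Definition ratfun_subst (v : 'I_n -> ratfun) (f : ratfun) : ratfun :=
  mmap ratfunC v \n_(repr f) / mmap ratfunC v \d_(repr f).

Variable a : K.

Definition twisted_var (s : 'S_n) (i : 'I_n) : ratfun :=
  if s \in ('Alt_('I_n))%g then ratfunX (s i) else ratfunC a / ratfunX (s i).

Definition twisted_act (s : 'S_n) : ratfun -> ratfun :=
  ratfun_subst (twisted_var s).

Definition twisted_fixed_field : {pred ratfun} :=
  [pred f | [forall s : 'S_n, twisted_act s f == f]].

End TwistedAction.

(* [ratfun_subst v] depends on the chosen representative unless [v] is
   algebraically independent over [K]; for [twisted_var a s] this holds as soon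
   as [a != 0], and then [twisted_act a] acts by [K]-automorphisms. *)

Section Substitution.
Variables (K : fieldType) (n : nat).
Local Notation F := (ratfun K n).
Local Notation C := (ratfunC K n).
Local Notation X := (@ratfunX K n).

Lemma ratfun_repr (f : F) : f = (\n_(repr f))%:F / (\d_(repr f))%:F.
Proof.
apply: (canRL (mulfK _)); first by rewrite tofrac_eq0 denom_ratioP.
rewrite -{1}[f]reprK; case: (repr f) => -[p q] /= q0.
unlock FracField.tofrac.
rewrite -[LHS]FracField.pi_mul; apply/eqmodP.
rewrite /= FracField.equivfE /FracField.mulf.
by rewrite !numden_Ratio ?mulf_neq0 ?oner_eq0 // !mulr1 mulrC.
Qed.

Variable v : 'I_n -> F.
Hypothesis v_indep : algebraically_independent C v.
Local Notation h := (mmap C v).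

Lemma mmap_indep_neq0 p : p != 0 -> h p != 0.
Proof. by apply: contra_neq => /v_indep. Qed.

Lemma ratfun_substE p q : q != 0 ->
  ratfun_subst v (p%:F / q%:F) = h p / h q.
Proof.
move=> q0; rewrite /ratfun_subst; set f : F := p%:F / q%:F.
have d0 : \d_(repr f) != 0 by [].
apply/eqP; rewrite eqr_div ?mmap_indep_neq0 // -!rmorphM /=.
suff -> : \n_(repr f) * q = p * \d_(repr f) by [].
apply/eqP; rewrite -tofrac_eq !rmorphM /= -eqr_div ?tofrac_eq0 //.
by rewrite -ratfun_repr.
Qed.

Lemma ratfun_subst_frac p : ratfun_subst v p%:F = h p.
Proof.
by have := @ratfun_substE p 1 (oner_neq0 _); rewrite !rmorph1 !divr1.
Qed.

Lemma ratfun_substC c : ratfun_subst v (C c) = C c.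
Proof. by rewrite ratfun_subst_frac mmapC. Qed.

Lemma ratfun_substX i : ratfun_subst v (X i) = v i.
Proof. by rewrite ratfun_subst_frac mmapX mmap1U. Qed.

Lemma ratfun_subst_is_zmod_morphism : zmod_morphism (ratfun_subst v).
Proof.
move=> f g; rewrite (ratfun_repr f) (ratfun_repr g).
move: (repr f) (repr g) => [[p q] /= q0] [[r s] /= s0].
rewrite !ratfun_substE // -mulNr addf_div ?tofrac_eq0 //.
rewrite -rmorphN -!rmorphM -rmorphD ratfun_substE ?mulf_neq0 //=.
rewrite rmorphD !rmorphM rmorphN /= -mulNr addf_div ?mmap_indep_neq0 //.
Qed.

Lemma ratfun_subst_is_monoid_morphism : monoid_morphism (ratfun_subst v).
Proof.
split=> [|f g]; first by rewrite -[1](rmorph1 C) ratfun_substC.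
rewrite (ratfun_repr f) (ratfun_repr g).
move: (repr f) (repr g) => [[p q] /= q0] [[r s] /= s0].
rewrite !ratfun_substE // !mulf_div -!rmorphM ratfun_substE ?mulf_neq0 //.
Qed.

End Substitution.

Section TwistedActionTheory.
Variables (K : fieldType) (n : nat) (a : K).
Hypothesis a_neq0 : a != 0.
Local Notation F := (ratfun K n).
Local Notation C := (ratfunC K n).
Local Notation X := (@ratfunX K n).

Lemma ratfunX_neq0 i : X i != 0.
Proof. by rewrite tofrac_eq0 -msupp_eq0 msuppX. Qed.

Lemma prod_ratfunX (e : 'X_{1..n}) :
  \prod_i X i ^+ e i = ('X_[e] : {mpoly K[n]})%:F.
Proof.
by rewrite mpolyXE_id rmorph_prod /=; apply: eq_bigr => i _; rewrite rmorphXn.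
Qed.

Lemma ratfun_morph_ext (f g : {rmorphism F -> F}) :
  (forall c, f (C c) = g (C c)) -> (forall i, f (X i) = g (X i)) -> f =1 g.
Proof.
move=> fgC fgX; have fgP p : f p%:F = g p%:F.
  rewrite [p]mpolyE !rmorph_sum; apply: eq_bigr => m _ /=.
  rewrite -mul_mpolyC !rmorphM /= fgC -prod_ratfunX !rmorph_prod.
  by congr (_ * _); apply: eq_bigr => i _; rewrite !rmorphXn fgX.
by move=> u; rewrite (ratfun_repr u) !fmorph_div /= !fgP.
Qed.

Lemma indep_monomials (v : 'I_n -> F) :
    (forall d : nat, exists (M : F) (k : 'X_{1..n} -> K)
       (g : 'X_{1..n} -> 'X_{1..n}),
      [/\ forall m, k m != 0,
          {in [pred m : 'X_{1..n} | mdeg m < d]%N &, injective g}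
        & forall m, (mdeg m < d)%N ->
            M * mmap1 v m = (k m *: 'X_[g m] : {mpoly K[n]})%:F]) ->
  algebraically_independent C v.
Proof.
move=> Hv p p0; have [M [k [g [k0 g_inj Mv]]]] := Hv (msize p).
have: (\sum_(m <- msupp p) p@_m *: (k m *: 'X_[g m]) : {mpoly K[n]})%:F
        = 0 :> F.
  rewrite rmorph_sum /= -[RHS](mulr0 M) -[in RHS]p0 /mmap mulr_sumr.
  apply: eq_big_seq => m mp.
  rewrite mulrCA Mv ?msize_mdeg_lt // -mul_mpolyC rmorphM //.
move/eqP; rewrite tofrac_eq0 => /eqP q0.
apply/eqP; rewrite -msupp_eq0; apply/eqP.
case E: (msupp p) => [//|m0 r]; have m0p : m0 \in msupp p by rewrite E mem_head.
move/(congr1 (mcoeff (g m0))): q0.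
rewrite raddf_sum mcoeff0 (bigD1_seq m0) //= big_seq_cond big1 => [|m].
  rewrite addr0 !mcoeffZ mcoeffX eqxx mulr1 => /eqP.
  by rewrite mulf_eq0 (negPf (k0 _)) orbF mcoeff_eq0 m0p.
case/andP=> mp mm0; rewrite !mcoeffZ mcoeffX.
have [/g_inj eqm|] := eqVneq (g m) (g m0); last by rewrite !mulr0.
by rewrite eqm ?eqxx ?inE ?msize_mdeg_lt in mm0.
Qed.

Lemma twisted_var_indep s :
  algebraically_independent C (twisted_var a s : 'I_n -> F).
Proof.
apply: indep_monomials => d.
case sA: (s \in ('Alt_('I_n))%g).
  exists 1, (fun=> 1), (fun m => [multinom m (s^-1%g i) | i < n]); split.
  - by move=> m; rewrite oner_neq0.
  - move=> m1 m2 _ _ /mnmP eqm; apply/mnmP => i.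
    by have := eqm (s i); rewrite !mnmE permK.
  - move=> m _; rewrite mul1r scale1r -prod_ratfunX [RHS](reindex_perm s).
    by apply: eq_bigr => i _; rewrite mnmE permK /twisted_var sA.
exists (\prod_i X i ^+ d), (fun m => a ^+ mdeg m),
  (fun m => [multinom (d - m (s^-1%g i))%N | i < n]); split.
- by move=> m; rewrite expf_neq0.
- move=> m1 m2; rewrite !inE => d1 d2 /mnmP eqm; apply/mnmP => i.
  have lem m : (mdeg m < d)%N -> (m i <= d)%N.
    by move=> /ltnW; apply: leq_trans; rewrite mdegE (bigD1 i) //= leq_addr.
  have := eqm (s i); rewrite !mnmE permK => eqd.
  by rewrite -(subKn (lem _ d1)) eqd subKn // lem.
- move=> m md; rewrite -mul_mpolyC rmorphM /= -prod_ratfunX.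
  rewrite [X in X * _](reindex_perm s) [X in _ = _ * X](reindex_perm s) /=.
  rewrite mdegE !rmorphXn /= -prodrXr /mmap1 -!big_split.
  apply: eq_bigr => i _ /=.
  have mi : (m i <= d)%N.
    by move/ltnW: md; apply: leq_trans; rewrite mdegE (bigD1 i) //= leq_addr.
  rewrite mnmE permK /twisted_var sA exprMn exprVn.
  rewrite mulrCA; congr (_ * _).
  by rewrite -{1}(subnK mi) exprD mulfK // expf_neq0 // ratfunX_neq0.
Qed.

Lemma twisted_act_is_zmod_morphism s :
  zmod_morphism (twisted_act a s : F -> F).
Proof. exact/ratfun_subst_is_zmod_morphism/twisted_var_indep. Qed.

Lemma twisted_act_is_monoid_morphism s :
  monoid_morphism (twisted_act a s : F -> F).
Proof. exact/ratfun_subst_is_monoid_morphism/twisted_var_indep. Qed.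

Lemma twisted_actC s c : twisted_act a s (C c) = C c.
Proof. exact/ratfun_substC/twisted_var_indep. Qed.

Lemma twisted_actX s i : twisted_act a s (X i) =
  if s \in ('Alt_('I_n))%g then X (s i) else C a / X (s i).
Proof. exact/ratfun_substX/twisted_var_indep. Qed.

Definition twisted_rmorphism s : {rmorphism F -> F} :=
  HB.pack (twisted_act a s : F -> F)
    (GRing.isZmodMorphism.Build F F (twisted_act a s)
       (twisted_act_is_zmod_morphism s))
    (GRing.isMonoidMorphism.Build F F (twisted_act a s)
       (twisted_act_is_monoid_morphism s)).

Lemma twisted_act1 f : twisted_act a 1%g f = f :> F.
Proof.
apply: (ratfun_morph_ext (f := twisted_rmorphism 1) (g := idfun)) => [c|i] /=.
  exact: twisted_actC.
by rewrite twisted_actX group1 perm1.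
Qed.

(* Products in ['S_n] compose from left to right: [(t * s) i = s (t i)]. *)
Lemma twisted_actM s t f :
  twisted_act a s (twisted_act a t f) = twisted_act a (t * s)%g f :> F.
Proof.
apply: (ratfun_morph_ext
  (f := twisted_rmorphism s \o twisted_rmorphism t)
  (g := twisted_rmorphism (t * s))) => [c|i] /=.
  by rewrite !twisted_actC.
rewrite !twisted_actX [(_ * _)%g \in _]Alt_even odd_permM permM.
case tA: (t \in ('Alt_('I_n))%g).
  by move: tA; rewrite Alt_even twisted_actX Alt_even => /negPf -> /=.
move: tA; rewrite Alt_even => /negbFE ->.
rewrite -[LHS]/(twisted_rmorphism s _) fmorph_div /=.
rewrite twisted_actC twisted_actX Alt_even.
case: (odd_perm s) => //=.
have a0 : C a != 0 by rewrite tofrac_eq0 mpolyC_eq0.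
by rewrite invf_div mulrC divfK.
Qed.

Lemma twisted_fixed_field_divring_closed :
  GRing.divring_closed (@twisted_fixed_field K n a).
Proof.
split=> [|f g|f g]; rewrite !inE.
- by apply/forallP => s; apply/eqP; exact: rmorph1 (twisted_rmorphism s).
- move=> /forallP Ff /forallP Fg; apply/forallP => s; apply/eqP.
  apply: etrans (rmorphB (twisted_rmorphism s) f g) _.
  by rewrite /= (eqP (Ff s)) (eqP (Fg s)).
- move=> /forallP Ff /forallP Fg; apply/forallP => s; apply/eqP.
  apply: etrans (fmorph_div (twisted_rmorphism s) f g) _.
  by rewrite /= (eqP (Ff s)) (eqP (Fg s)).
Qed.

End TwistedActionTheory.

(* Main.v *)
(* Adjacent transpositions are odd, so a rational function is fixed as soon as the substitutions
   [x_i -> a / x_(s i)], for [s] an adjacent transposition, fix it. For each [n] we exhibit [n] fixed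
   elements [y] together with a chain of adjunctions of total degree at most [n`!] that leads from
   [K(y)] to a field containing all the [x_i]. By Steinitz exchange [y] is algebraically independent,
   and by Artin's theorem [K(x_1, .., x_n)] has degree [n`!] over the fixed field, which is
   therefore [K(y)].
   For [n = 3] and [n = 4] the elements [y] come from relations between a symmetric function and its
   image under an odd substitution. For [n = 5] the five variables are regarded as points of the
   projective line: two equivariantly attached points [B1], [B2] satisfy [B -> a / B] under odd
   substitutions, a joint invariant [theta] satisfies [theta -> 1 - theta], and writing
   [B1 = X + theta * Y] makes [theta * (1 - theta)] a rational function of the invariants [X], [Y]. *)
From HB Require Import structures.
Require Import Defs.
From mathcomp Require Import all_boot all_algebra all_fingroup alt mpoly ring zify.
From Stdlib Require Import Classical.
Set Implicit Arguments.
Unset Strict Implicit.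
Unset Printing Implicit Defensive.
Import GRing.Theory.
Local Open Scope ring_scope.

(** * Subfields as predicates, and division with remainder over them *)

Section Subfields.
Variable E : fieldType.
Implicit Types (L M S T : E -> Prop) (x y z : E) (p q r : {poly E}).

(** Degrees are only bounded from above: adjoining a root needs some polynomial of the right size,
    never an irreducible one. The main obstacle is that all denominators must be nonzero over every
    field, in every characteristic. Any [n] elements over which the variables are algebraic can be
    given arbitrary values, so each expression is tested in the coordinates where it is simple, at a
    point chosen to give a visibly nonzero value. Origin of the formulas. For [n = 3], the quotients
    [A / P] and [B / P] are Masuda's generators for the cyclic invariants. For [n = 4], the
    resolvents are coefficients of the three Möbius involutions that exchange the four points in
    pairs, and inversion acts on these coefficients. For [n = 5], the two points are the roots of
    the linear covariants of degree 5 and 7 of the binary quintic; [theta] is half of one plus the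
    square root of the discriminant over the invariant of degree 4, written with integral
    coefficients so that it keeps its meaning in characteristic 2. *)

Record subfield L : Prop := Subfield {
  subfield1 : L 1;
  subfieldB : forall x y, L x -> L y -> L (x - y);
  subfield_div : forall x y, L x -> L y -> L (x / y) }.

Section Closure.
Variables (L : E -> Prop) (fL : subfield L).

Lemma subfield0 : L 0.
Proof. by rewrite -(subrr 1); apply: subfieldB fL _ _ _ _; apply: subfield1. Qed.

Lemma subfieldN x : L x -> L (- x).
Proof. by move=> Lx; rewrite -sub0r; apply: (subfieldB fL) => //; apply: subfield0. Qed.

Lemma subfieldD x y : L x -> L y -> L (x + y).
Proof.
by move=> Lx Ly; rewrite -[y]opprK; apply: (subfieldB fL) => //; apply: subfieldN.
Qed.

Lemma subfieldV x : L x -> L x^-1.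
Proof. by move=> Lx; rewrite -div1r; apply: (subfield_div fL) => //; apply: subfield1. Qed.

Lemma subfieldM x y : L x -> L y -> L (x * y).
Proof.
by move=> Lx Ly; rewrite -[y]invrK; apply: (subfield_div fL) => //; apply: subfieldV.
Qed.

Lemma subfieldX x n : L x -> L (x ^+ n).
Proof.
move=> Lx; elim: n => [|n IH]; first by rewrite expr0; apply: subfield1.
by rewrite exprS; apply: subfieldM.
Qed.

Lemma subfield_nat n : L n%:R.
Proof.
elim: n => [|n IH]; first exact: subfield0.
by rewrite -addn1 natrD; apply: subfieldD => //; apply: subfield1.
Qed.

Lemma subfield_sum (I : Type) (s : seq I) (P : pred I) (f : I -> E) :
  (forall i, P i -> L (f i)) -> L (\sum_(i <- s | P i) f i).
Proof.
by move=> Lf; apply: big_ind => //; [exact: subfield0 | exact: subfieldD].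
Qed.

Lemma subfield_prod (I : Type) (s : seq I) (P : pred I) (f : I -> E) :
  (forall i, P i -> L (f i)) -> L (\prod_(i <- s | P i) f i).
Proof.
by move=> Lf; apply: big_ind => //; [exact: (subfield1 fL) | exact: subfieldM].
Qed.

(** Membership in a generated field is a mere proposition, so a polynomial over [L] stays a
    polynomial over [E] whose coefficients carry the condition. *)
Definition poly_in p := forall i, L p`_i.

Lemma poly_inC c : L c -> poly_in c%:P.
Proof. by move=> Lc i; rewrite coefC; case: ifP => // _; apply: subfield0. Qed.

Lemma poly_inX : poly_in 'X.
Proof. by move=> i; rewrite coefX; apply: subfield_nat. Qed.

Lemma poly_inD p q : poly_in p -> poly_in q -> poly_in (p + q).
Proof. by move=> Lp Lq i; rewrite coefD; apply: subfieldD. Qed.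

Lemma poly_inN p : poly_in p -> poly_in (- p).
Proof. by move=> Lp i; rewrite coefN; apply: subfieldN. Qed.

Lemma poly_inM p q : poly_in p -> poly_in q -> poly_in (p * q).
Proof. by move=> Lp Lq i; rewrite coefM; apply: subfield_sum => j _; apply: subfieldM. Qed.

Lemma poly_in_horner p x : poly_in p -> L x -> L p.[x].
Proof.
move=> Lp Lx; rewrite horner_coef; apply: subfield_sum => i _.
by apply: subfieldM => //; apply: subfieldX.
Qed.

(** Long division: each term of the quotient is a quotient of leading coefficients, so nothing
    leaves [L]. *)
Lemma poly_in_div p q : poly_in p -> poly_in q -> q != 0 ->
  exists d r, [/\ poly_in d, poly_in r, p = d * q + r & (size r < size q)%N].
Proof.
move=> Lp Lq q0; have [n] := ubnP (size p); elim: n p Lp => // n IH p Lp sp.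
have [lt_pq|le_qp] := ltnP (size p) (size q).
  exists 0, p; split=> //; first by move=> i; rewrite coef0; apply: subfield0.
  by rewrite mul0r add0r.
pose t := (lead_coef p / lead_coef q)%:P * 'X^(size p - size q).
have Lt : poly_in t.
  apply: poly_inM; last by move=> i; rewrite coefXn; apply: subfield_nat.
  by apply: poly_inC; apply: subfield_div => //; rewrite lead_coefE.
have p0 : p != 0 by rewrite -size_poly_gt0; apply: leq_trans le_qp; rewrite size_poly_gt0.
have sp0 : (0 < size p)%N by rewrite size_poly_gt0.
have sq0 : (0 < size q)%N by rewrite size_poly_gt0.
have st : (size (p - t * q)%R < size p)%N.
  rewrite -(ltn_predK sp0) ltnS; apply/leq_sizeP => j lej.
  rewrite coefB -mulrA coefCM (mulrC 'X^_) coefMXn.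
  have [a [b [Ea Eb]]] : exists a b, size p = a /\ size q = b by exists (size p), (size q).
  rewrite !lead_coefE Ea Eb in sp0 sq0 le_qp lej *.
  case: ltnP => [ltj|_]; first by exfalso; lia.
  case: (ltngtP j a.-1) => [|gtj|->]; first by rewrite ltnNge lej.
    have -> : p`_j = 0 by rewrite nth_default // Ea; lia.
    have -> : q`_(j - (a - b)) = 0 by rewrite nth_default // Eb; lia.
    by rewrite mulr0 subrr.
  have -> : (a.-1 - (a - b))%N = b.-1 by lia.
  by rewrite divfK ?subrr // -Eb -lead_coefE lead_coef_eq0.
have [||d [r [Ld Lr def_p sr]]] := IH (p - t * q); first exact: poly_inD Lp (poly_inN (poly_inM Lt Lq)).
  exact: leq_trans st _.
exists (d + t), r; split=> //; first exact: poly_inD.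
by rewrite mulrDl addrAC -def_p subrK.
Qed.

End Closure.
End Subfields.

(** * Extensions of bounded degree *)

Section PolyIn.
Variables (E : fieldType) (L : E -> Prop) (fL : subfield L).
Implicit Types (x y z : E) (p q r : {poly E}).
Local Notation poly_in := (poly_in L).

Lemma poly_in0 : poly_in 0.
Proof. by move=> i; rewrite coef0; apply: subfield0. Qed.

Lemma poly_in1 : poly_in 1.
Proof. by apply: poly_inC => //; apply: subfield1. Qed.

Lemma poly_in_minimal z p : p != 0 -> poly_in p -> root p z ->
  exists q, [/\ q != 0, poly_in q, root q z &
    forall r, poly_in r -> root r z -> (size r < size q)%N -> r = 0].
Proof.
have [n] := ubnP (size p); elim: n p => // n IH p sp p0 Lp pz.
have [[r [r0 Lr rz sr]]|nex] :=
  classic (exists r, [/\ r != 0, poly_in r, root r z & (size r < size p)%N]).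
  by apply: (IH r) => //; apply: leq_trans sr _.
exists p; split=> // r Lr rz sr; apply/eqP/negP => /negP r0.
by apply: nex; exists r.
Qed.

(** Euclid's algorithm against a minimal annihilator [p]: if [p = d * r + t], then [t] and [- d * r]
    agree at [z], so an inverse for [t] gives one for [r]. A remainder that vanishes at [z] is zero
    by minimality, and then [p = d * r] forces [r] to be constant. *)
Lemma poly_in_inverse z p r : p != 0 -> poly_in p -> root p z ->
  poly_in r -> r.[z] != 0 -> exists2 s, poly_in s & s.[z] * r.[z] = 1.
Proof.
move=> p0 Lp pz; have {p p0 Lp pz} [p [p0 Lp /rootP pz pmin]] := poly_in_minimal p0 Lp pz.
wlog sr : r / (size r < size p)%N.
  move=> main Lr rz; have [d [t [_ Lt def_r st]]] := poly_in_div fL Lr Lp p0.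
  have rt : r.[z] = t.[z] by rewrite def_r hornerD hornerM pz mulr0 add0r.
  by rewrite rt; apply: main; rewrite -?rt.
have [n] := ubnP (size r); elim: n r sr => // n IH r sr sn Lr rz.
have r0 : r != 0 by apply: contraNneq rz => ->; rewrite horner0.
have [d [t [Ld Lt def_p st]]] := poly_in_div fL Lp Lr r0.
have [tz|tz] := eqVneq t.[z] 0; last first.
  have [||s Ls st1] := IH t _ _ Lt tz.
  - exact: ltn_trans sr.
  - exact: leq_trans st _.
  exists (- (s * d)); first by apply: (poly_inN fL); apply: (poly_inM fL).
  have: p.[z] = 0 by []; rewrite def_p hornerD hornerM => /eqP.
  rewrite addr_eq0 => /eqP dr; rewrite hornerN hornerM mulNr -mulrA dr mulrN opprK.
  exact: st1.
have {tz}t0 : t = 0 by apply: pmin => //; [apply/rootP | apply: ltn_trans sr].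
rewrite t0 addr0 in def_p; have d0 : d != 0 by apply: contraNneq p0 => d0; rewrite def_p d0 mul0r.
have dz : root d z.
  by move/eqP: pz; rewrite def_p hornerM mulf_eq0 (negPf rz) orbF.
have [/size1_polyC def_r|s_gt1] := leqP (size r) 1.
  exists (r`_0)^-1%:P; first by apply: (poly_inC fL); apply: (subfieldV fL).
  have rz1 : r.[z] = r`_0 by rewrite {1}def_r hornerC.
  by rewrite hornerC rz1 mulVf // -rz1.
case/eqP: (d0); apply: pmin => //; rewrite def_p size_mul //.
have sd : (0 < size d)%N by rewrite size_poly_gt0.

by move: (size d) (size r) sd s_gt1 => k l; lia.
Qed.

End PolyIn.

Section Generation.
Variable E : fieldType.
Implicit Types (S T L M : E -> Prop) (x y z : E) (p q r : {poly E}).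

Inductive gen S : E -> Prop :=
| gen1 : gen S 1
| gen_in x : S x -> gen S x
| genB x y : gen S x -> gen S y -> gen S (x - y)
| gen_div x y : gen S x -> gen S y -> gen S (x / y).

Lemma gen_subfield S : subfield (gen S).
Proof. by split; [exact: gen1 | exact: genB | exact: gen_div]. Qed.

Lemma gen_min S L : subfield L -> (forall x, S x -> L x) -> forall x, gen S x -> L x.
Proof.
move=> fL SL x; elim=> {x}; first exact: subfield1.
- exact: SL.
- by move=> x y _ Lx _ Ly; apply: subfieldB.
- by move=> x y _ Lx _ Ly; apply: subfield_div.
Qed.

Definition add1 S z := fun x => S x \/ x = z.

Lemma gen_add1_frac L z x : subfield L -> gen (add1 L z) x ->
  exists p q, [/\ poly_in L p, poly_in L q, q.[z] != 0 & x = p.[z] / q.[z]].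
Proof.
move=> fL; have o0 := oner_neq0 E; elim=> {x}.
- exists 1, 1; split; rewrite ?hornerC ?divr1 //; exact: poly_in1.
- move=> x [Lx|->].
    by exists x%:P, 1; split; rewrite ?hornerC ?divr1 //; [exact: poly_inC|exact: poly_in1].
  by exists 'X, 1; split; rewrite ?hornerC ?hornerX ?divr1 //; [exact: poly_inX|exact: poly_in1].
- move=> x y _ [p [q [Lp Lq q0 ->]]] _ [r [s [Lr Ls s0 ->]]].
  exists (p * s - r * q), (q * s); split; last first.
  + by rewrite hornerD hornerN !hornerM -mulNr addf_div // mulNr.
  + by rewrite hornerM mulf_neq0.
  + exact: poly_inM.
  + by apply: (poly_inD fL); [|apply: (poly_inN fL)]; apply: (poly_inM fL).
- move=> x y _ [p [q [Lp Lq q0 ->]]] _ [r [s [Lr Ls s0 ->]]].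
  (* Division by zero yields zero, which [0 / 1] represents. *)
  have [r0|r0] := eqVneq r.[z] 0.
    exists 0, 1; rewrite horner0 hornerC r0 !mul0r invr0 mulr0.
    by split=> //; [apply: (poly_in0 fL)|apply: (poly_in1 fL)].
  exists (p * s), (q * r); split; rewrite ?hornerM ?mulf_neq0 //; [exact: poly_inM|exact: poly_inM|].
  by rewrite invf_div mulf_div.
Qed.

Definition algebraic L z := exists p, [/\ p != 0, poly_in L p & root p z].

(** A spanning family rather than a basis: [N] bounds the degree from above, so a root of a
    reducible polynomial may be adjoined as well. *)
Definition spanned L M N := exists (I : finType) (e : I -> E),
  [/\ #|I| = N, forall i, M (e i) & forall x, M x ->
      exists2 c : I -> E, (forall i, L (c i)) & x = \sum_i c i * e i].

(** [poly_in_inverse] turns fractions in [z] into polynomials, and remainders modulo [p] leave only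
    the powers below [m]. *)
Lemma adjoin_spanned L z p m : subfield L -> poly_in L p -> root p z ->
  size p = m.+1 -> spanned L (gen (add1 L z)) m.
Proof.
move=> fL Lp pz sp; have p0 : p != 0 by rewrite -size_poly_gt0 sp.
exists 'I_m, (fun i : 'I_m => z ^+ i); split; first exact: card_ord.
  move=> i; apply: subfieldX; first exact: gen_subfield.
  by apply: gen_in; right.
move=> x /(gen_add1_frac fL) [r [q [Lr Lq q0 ->]]].
have [s Ls sq] := poly_in_inverse fL p0 Lp pz Lq q0.
have -> : r.[z] / q.[z] = (r * s).[z].
  by rewrite hornerM; apply: (canLR (mulfK q0)); rewrite -mulrA sq mulr1.
have [d [t [_ Lt def_rs st]]] := poly_in_div fL (poly_inM fL Lr Ls) Lp p0.
exists (fun i : 'I_m => t`_i) => [i|]; first exact: Lt.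
rewrite def_rs hornerD hornerM (rootP pz) mulr0 add0r.
by apply: horner_coef_wide; rewrite -ltnS -sp.
Qed.

Lemma spanned_trans L M M' N N' : subfield L -> subfield M' ->
  (forall x, M x -> M' x) ->
  spanned L M N -> spanned M M' N' -> spanned L M' (N * N').
Proof.
move=> fL fM' MM' [I [e [cI Me He]]] [J [f [cJ M'f Hf]]].
exists (I * J)%type, (fun ij => e ij.1 * f ij.2); split.
- by rewrite card_prod cI cJ.
- by move=> ij; apply: subfieldM => //; apply: MM'.
move=> x /Hf [c Mc ->].
have /fin_all_exists2 [d Ld Hd] : forall j, exists2 d : {ffun I -> E},
    (forall i, L (d i)) & c j = \sum_i d i * e i.
  move=> j; have [d Ld ->] := He _ (Mc j).
  exists [ffun i => d i] => [i|]; first by rewrite ffunE.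
  by apply: eq_bigr => i _; rewrite ffunE.
exists (fun ij => d ij.2 ij.1) => [ij|]; first exact: Ld.
rewrite -(pair_bigA _ (fun i j => d j i * (e i * f j))) exchange_big /=.
apply: eq_bigr => j _; rewrite Hd mulr_suml; apply: eq_bigr => i _.
by rewrite mulrA.
Qed.

(** Multiplication by [z] acts on the spanning family through a matrix over [L], and the family
    itself is an eigenvector for [z]; so [z] is a root of the characteristic polynomial. *)
Lemma spanned_algebraic L M N z : subfield L -> subfield M ->
  spanned L M N -> M z -> algebraic L z.
Proof.
move=> fL fM [I [e [_ Me He]]] Mz.
have /fin_all_exists2 [c Lc Hc] : forall j, exists2 d : {ffun I -> E},
    (forall i, L (d i)) & z * e j = \sum_i d i * e i.
  move=> j; have [d Ld Hd] := He _ (subfieldM fM Mz (Me j)).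
  exists [ffun i => d i] => [i|]; first by rewrite ffunE.
  by rewrite Hd; apply: eq_bigr => i _; rewrite ffunE.
pose A := \matrix_(i < #|I|, j < #|I|) c (enum_val j) (enum_val i).
exists (char_poly A); split.
- by rewrite -size_poly_gt0 size_char_poly.
- rewrite /char_poly /determinant => k.
  have sumP (J : Type) (s : seq J) (F : J -> {poly E}) :
      (forall j, poly_in L (F j)) -> poly_in L (\sum_(j <- s) F j).
    by move=> H; apply: big_ind => //; [exact: poly_in0 | move=> *; exact: poly_inD].
  have prodP (J : Type) (s : seq J) (F : J -> {poly E}) :
      (forall j, poly_in L (F j)) -> poly_in L (\prod_(j <- s) F j).
    by move=> H; apply: big_ind => //; [exact: poly_in1 | move=> *; exact: poly_inM].
  apply: sumP => s; apply: (poly_inM fL).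
    by case: (perm.odd_perm s); [apply: (poly_inN fL)|]; apply: poly_in1.
  apply: prodP => i; rewrite !mxE; apply: (poly_inD fL).
    by case: eqP => _; rewrite ?mulr1n ?mulr0n; [apply: poly_inX|apply: poly_in0].
  by apply: (poly_inN fL); apply: (poly_inC fL).
- rewrite -eigenvalue_root_char; apply/eigenvalueP.
  exists (\row_j e (enum_val j)).
    apply/rowP => j; rewrite !mxE Hc [RHS](reindex (@enum_val I I)) /=; last exact: onW_bij (enum_val_bij _).
    by apply: eq_bigr => i _; rewrite !mxE mulrC.
  (* The eigenvector is nonzero because the family spans [1]. *)
  apply/eqP => /rowP e0; have [d _] := He 1 (subfield1 fM).
  rewrite big1 => [/eqP|i _]; first by rewrite oner_eq0.
  by have := e0 (enum_rank i); rewrite !mxE enum_rankK => ->; rewrite mulr0.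
Qed.

Record extension L N M : Prop := Extension {
  extension_subfield : subfield M;
  extension_sub : forall x, L x -> M x;
  extension_spanned : spanned L M N }.

Lemma extension_refl L : subfield L -> extension L 1 L.
Proof.
move=> fL; split=> //; exists unit, (fun=> 1); split; first exact: card_unit.
  by move=> _; apply: subfield1.
by move=> x Lx; exists (fun=> x) => //; rewrite (big_pred1 tt) ?mulr1 // => -[].
Qed.

Lemma extension_root L N M z p m : subfield L -> extension L N M ->
  poly_in M p -> root p z -> size p = m.+1 ->
  extension L (N * m) (gen (add1 M z)).
Proof.
move=> fL [fM LM sM] Mp pz sp; split; first exact: gen_subfield.
  by move=> x /LM Mx; apply: gen_in; left.
apply: spanned_trans fL (gen_subfield _) _ sM (adjoin_spanned fM Mp pz sp).
by move=> x Mx; apply: gen_in; left.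
Qed.

Definition alg S z := algebraic (gen S) z.

Lemma algebraic_mono L M z : (forall x, L x -> M x) -> algebraic L z -> algebraic M z.
Proof. by move=> LM [p [p0 Lp pz]]; exists p; split=> // i; apply: LM. Qed.

Lemma mem_algebraic L z : subfield L -> L z -> algebraic L z.
Proof.
move=> fL Lz; exists ('X - z%:P); rewrite polyXsubC_eq0 root_XsubC; split=> //.
by apply: (poly_inD fL); [apply: (poly_inX fL)|apply: (poly_inN fL); apply: (poly_inC fL)].
Qed.

Lemma extension_algebraic L z : subfield L -> algebraic L z ->
  exists N, extension L N (gen (add1 L z)).
Proof.
move=> fL [p [p0 Lp pz]]; exists (1 * (size p).-1)%N.
apply: extension_root pz _ => //; first exact: extension_refl.
by rewrite prednK // size_poly_gt0.
Qed.

Lemma extension_trans L M M' N N' : subfield L ->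
  extension L N M -> extension M N' M' -> extension L (N * N') M'.
Proof.
move=> fL [fM LM sM] [fM' MM' sM']; split=> //; first by move=> x /LM/MM'.
exact: spanned_trans sM sM'.
Qed.

Lemma alg_finite S (s : seq E) : (forall x, x \in s -> alg S x) ->
  exists N M, extension (gen S) N M /\ forall x, x \in s -> M x.
Proof.
have fS := gen_subfield S; elim: s => [|z s IH] Hs.
  by exists 1%N, (gen S); split=> //; apply: extension_refl.
have [x xs|N [M [eM Ms]]] := IH; first by apply: Hs; rewrite inE xs orbT.
have Mz : algebraic M z.
  by apply: algebraic_mono (Hs z (mem_head _ _)); apply: extension_sub eM.
have [N' eM'] := extension_algebraic (extension_subfield eM) Mz.
exists (N * N')%N, (gen (add1 M z)); split; first exact: extension_trans eM eM'.
move=> x; rewrite inE => /predU1P[->|/Ms Mx]; first by apply: gen_in; right.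
exact: extension_sub eM' _ Mx.
Qed.

Lemma extension_mem_algebraic L N M z :
  subfield L -> extension L N M -> M z -> algebraic L z.
Proof. by move=> fL [fM _ sM]; apply: spanned_algebraic sM. Qed.

Lemma alg_subfield S : subfield (alg S).
Proof.
have fS := gen_subfield S.
have H x y : alg S x -> alg S y ->
    exists N M, [/\ extension (gen S) N M, M x & M y].
  move=> Sx Sy; have [z|N [M [eM HM]]] := @alg_finite S [:: x; y].
    by rewrite !inE => /orP[] /eqP ->.
  by exists N, M; split=> //; apply: HM; rewrite !inE eqxx ?orbT.
split; first by apply: mem_algebraic => //; apply: gen1.
- move=> x y Sx Sy; have [N [M [eM Mx My]]] := H _ _ Sx Sy.
  by apply: (extension_mem_algebraic fS eM); apply: subfieldB Mx My; case: eM.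
- move=> x y Sx Sy; have [N [M [eM Mx My]]] := H _ _ Sx Sy.
  by apply: (extension_mem_algebraic fS eM); apply: subfield_div Mx My; case: eM.
Qed.

Lemma alg_in S x : S x -> alg S x.
Proof. by move=> Sx; apply: mem_algebraic; [exact: gen_subfield | exact: gen_in]. Qed.

(** The finitely many coefficients of the equation of [z] are adjoined before [z] itself. *)
Lemma alg_trans S T z : (forall x, T x -> alg S x) -> alg T z -> alg S z.
Proof.
move=> TS [p [p0 Tp pz]]; have fS := gen_subfield S.
have [x|N [M [eM Mp]]] := @alg_finite S p.
  by move=> /(nthP 0) [i _ <-]; apply: gen_min (Tp i) => //; exact: alg_subfield.
have Mz : algebraic M z.
  exists p; split=> // i; have [lt_i|ge_i] := ltnP i (size p).
    by apply: Mp; apply: mem_nth.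
  by rewrite nth_default //; apply: subfield0; case: eM.
have [N' eM'] := extension_algebraic (extension_subfield eM) Mz.
apply: extension_mem_algebraic (extension_trans fS eM eM') _ => //.
by apply: gen_in; right.
Qed.

Lemma alg_exchange S z w : alg (add1 S w) z -> ~ alg S z -> alg (add1 S z) w.
Proof.
have fS := gen_subfield S; have fSz := gen_subfield (add1 S z).
move=> [p [p0 Sp pz]] nz.
have Sw x : gen (add1 S w) x -> gen (add1 (gen S) w) x.
  apply: gen_min; first exact: gen_subfield.
  by move=> y [Sy|->]; apply: gen_in; [left; apply: gen_in | right].
(* Clearing denominators turns [p] into a polynomial in [z] and [w] over [gen S]. *)
have [b [t [Sb St t0 Hb]]] : exists (b : nat -> {poly E}) (t : {poly E}),
    [/\ forall i, poly_in (gen S) (b i), poly_in (gen S) t, t.[w] != 0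
      & forall i, (b i).[w] = t.[w] * p`_i].
  elim/poly_ind: p {p0 pz} Sp => [|p c IH] Sp.
    exists (fun=> 0), 1; split=> [i|||i]; rewrite ?hornerC ?oner_neq0 //; try exact: poly_in0.
      exact: poly_in1.
    by rewrite coef0 mulr0.
  have [|b [t [Sb St t0 Hb]]] := IH.
    by move=> i; have := Sp i.+1; rewrite coefD coefMX coefC addr0.
  have Sc : gen (add1 S w) c by have := Sp 0%N; rewrite coefD coefMX coefC add0r.
  have [r [q [Sr Sq q0 def_c]]] := gen_add1_frac fS (Sw _ Sc).
  exists (fun i => if i is j.+1 then b j * q else r * t), (t * q); split.
  - by case=> [|i]; apply: poly_inM.
  - exact: poly_inM.
  - by rewrite hornerM mulf_neq0.
  - case=> [|i]; rewrite coefD coefMX coefC /= !hornerM ?add0r ?addr0.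
      by rewrite def_c mulrC -!mulrA [_ / _]mulrC mulVKf.
    by rewrite Hb mulrAC.
(* [B k], taken at [z], is the coefficient of the [k]-th power of [w]. As [z] is transcendental over
   [S], a nonzero [B k] does not vanish there, so the equation obtained for [w] is not trivial. *)
pose B k := \poly_(i < size p) (b i)`_k.
pose n := \max_(i < size p) size (b i).
have sb i : (i < size p)%N -> (size (b i) <= n)%N.
  by move=> lti; rewrite -[i]/(val (Ordinal lti)); apply: leq_bigmax.
have SB k : poly_in (gen S) (B k).
  by move=> i; rewrite coef_poly; case: ifP => // _; [apply: Sb|apply: subfield0].
have Bk i k : (i < size p)%N -> (B k)`_i = (b i)`_k by rewrite coef_poly => ->.
exists (\poly_(k < n) (B k).[z]); split.
- have [i pi] : exists i : 'I_(size p), p`_i != 0.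
    have lp : ((size p).-1 < size p)%N by rewrite prednK ?size_poly_gt0.
    by exists (Ordinal lp); rewrite /= -lead_coefE lead_coef_eq0.
  have bi : b i != 0.
    apply: contraNneq pi => bi; move: (Hb i); rewrite bi horner0 => /esym/eqP.
    by rewrite mulf_eq0 (negPf t0).
  have lk : ((size (b i)).-1 < size (b i))%N by rewrite prednK ?size_poly_gt0.
  apply/negP => /eqP /polyP /(_ (size (b i)).-1).
  rewrite coef_poly coef0 (leq_trans lk) ?sb // => Bz.
  apply: nz; exists (B (size (b i)).-1); split=> //; last by apply/rootP.
  apply/negP => /eqP /polyP /(_ i); rewrite Bk // coef0 -lead_coefE => /eqP.
  by rewrite lead_coef_eq0 (negPf bi).
- move=> k; rewrite coef_poly; case: ifP => [_|_]; last exact: subfield0.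
  apply: poly_in_horner => //; last by apply: gen_in; right.
  by move=> i; apply: gen_min (SB k i) => // x Sx; apply: gen_in; left.
- apply/rootP; rewrite horner_poly.
  transitivity (t.[w] * p.[z]); last by rewrite (rootP pz) mulr0.
  rewrite [p.[z]]horner_coef mulr_sumr.
  under eq_bigr => k _ do rewrite horner_poly mulr_suml.
  rewrite exchange_big /=; apply: eq_bigr => i _.
  rewrite mulrA -Hb (@horner_coef_wide _ n) ?sb // mulr_suml.
  by apply: eq_bigr => k _; rewrite mulrAC.
Qed.

(** * Steinitz exchange *)

Definition addl S (s : seq E) := fun x => S x \/ x \in s.

Fixpoint indep S (s : seq E) :=
  if s is x :: s' then ~ alg S x /\ indep (add1 S x) s' else True.

Lemma alg_mono S T z : (forall x, S x -> T x) -> alg S z -> alg T z.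
Proof. by move=> ST; apply: alg_trans => x /ST; apply: alg_in. Qed.

(** [y] is the first entry of [s] with which [x] becomes algebraic, hence the one that [x] can
    replace. *)
Lemma steinitz_split S x s : ~ alg S x -> alg (addl S s) x ->
  exists s1 y s2, [/\ s = s1 ++ y :: s2, ~ alg (addl S s1) x
    & alg (add1 (addl S s1) y) x].
Proof.
move=> nx; elim/last_ind: s => [|s y IH] xs.
  by case: nx; apply: alg_mono xs => z [|].
have [/IH [s1 [z [s2 [-> n1 a1]]]]|nxs] := classic (alg (addl S s) x).
  by exists s1, z, (rcons s2 y); rewrite rcons_cat.
exists s, y, [::]; split=> //; first by rewrite cats1.
apply: alg_mono xs => z [Sz|]; first by left; left.
by rewrite mem_rcons inE => /predU1P[->|zs]; [right|left; right].
Qed.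

(** Each [x] of [s] replaces an entry of [t] and moves to the base; the rest of [s] stays algebraic
    over what is left of [t]. *)
Lemma steinitz S s t : indep S s -> (forall x, x \in s -> alg (addl S t) x) ->
  (size s <= size t)%N.
Proof.
elim: s S t => [|x s IH] S t //= [nx ind] Ht.
have [t1 [y [t2 [def_t n1 a1]]]] := steinitz_split nx (Ht x (mem_head _ _)).
have y_alg := alg_exchange a1 n1.
rewrite def_t size_cat /= addnS ltnS -size_cat; apply: IH ind _ => w ws.
apply: alg_trans (Ht w _); last by rewrite inE ws orbT.
move=> z [Sz|]; first by apply: alg_in; left; left.
rewrite def_t mem_cat inE orbCA => /predU1P[->|zt].
  apply: alg_mono y_alg => u [[Su|u1]|->]; first by left; left.
    by right; rewrite mem_cat u1.
  by left; right.
by apply: alg_in; right; rewrite mem_cat.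
Qed.

(** An entry of [t] algebraic over its predecessors could be dropped, and [t] would become too short
    for [steinitz]. *)
Lemma indep_size_basis S s t : indep S s -> size s = size t ->
  (forall x, x \in s -> alg (addl S t) x) ->
  forall t1 y t2, t = t1 ++ y :: t2 -> ~ alg (addl S t1) y.
Proof.
move=> ind st Ht t1 y t2 def_t y_alg.
have: (size s <= size (t1 ++ t2))%N; last first.
  by rewrite st def_t !size_cat /= addnS ltnn.
apply: steinitz ind _ => x /Ht; apply: alg_trans => z.
rewrite def_t => -[Sz|]; first by apply: alg_in; left.
rewrite mem_cat inE orbCA => /predU1P[->|zt]; last by apply: alg_in; right; rewrite mem_cat.
by apply: alg_mono y_alg => u [Su|u1]; [left|right; rewrite mem_cat u1].
Qed.

End Generation.

(** * Independence of morphisms and Artin's theorem *)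

Lemma fixed_points_subfield (E : fieldType) (f : {rmorphism E -> E}) :
  subfield (fun x => f x = x).
Proof.
split=> [|x y fx fy|x y fx fy]; first exact: rmorph1.
  by rewrite rmorphB fx fy.
by rewrite fmorph_div fx fy.
Qed.

Section Artin.
Variables (E : fieldType) (I : finType) (f : I -> {rmorphism E -> E}).
Hypothesis f_distinct : forall i j, i != j -> exists x, f i x != f j x.

(** The relation at [x0 * x] minus [f i0 x0] times the relation at [x] no longer involves [i0]: the
    induction is on the size of the support. *)
Lemma dedekind (c : I -> E) : (forall x, \sum_i c i * f i x = 0) ->
  forall i, c i = 0.
Proof.
have [n] := ubnP #|[set i | c i != 0]|; elim: n c => // n IH c sc Hc i0.
apply/eqP/negP => /negP ci0.
have c1 i1 : i1 != i0 -> c i1 = 0.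
  move=> ne; have [x0 nx] := f_distinct ne.
  have: c i1 * (f i1 x0 - f i0 x0) = 0.
    apply: (IH (fun i => c i * (f i x0 - f i0 x0))) => [|x].
      apply: (@leq_ltn_trans #|[set i | c i != 0] :\ i0|).
        apply/subset_leq_card/subsetP => i; rewrite !inE.
        by move=> h; apply/andP; split; apply: contraNneq h => ->; rewrite ?subrr ?mulr0 ?mul0r.
      by move: sc; rewrite (cardsD1 i0) inE ci0.
    have := Hc (x0 * x); rewrite -[RHS](mulr0 (f i0 x0)) -[in RHS](Hc x) mulr_sumr.
    move/eqP; rewrite -subr_eq0 -sumrB => /eqP; apply: etrans.
    apply: eq_bigr => i _; rewrite rmorphM; ring.
  by move/eqP; rewrite mulf_eq0 subr_eq0 (negPf nx) orbF => /eqP.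
have := Hc 1; rewrite (bigD1 i0) //= big1 => [|i /c1 ->]; last by rewrite mul0r.
by rewrite rmorph1 mulr1 addr0 => /eqP; rewrite (negPf ci0).
Qed.

(** The matrix [A] of the values [f i (e j)] is square and, by [dedekind], invertible. If [l] and
    [m] are coordinates of [x] and of [1], then [l *m A] is [x] times [m *m A], because all [f i]
    fix [x]. Hence [l] is [x] times [m], and [x] is a quotient of two coordinates. *)
Lemma artin (L : E -> Prop) (x : E) : subfield L ->
    (forall i y, L y -> f i y = y) -> spanned L (fun=> True) #|I| ->
  (forall i, f i x = x) -> L x.
Proof.
move=> fL Lf [J [e [cJ _ He]]] xf.
pose A := \matrix_(j < #|J|, i < #|I|) f (enum_val i) (e (enum_val j)).
have rowA (d : J -> E) : (forall j, L (d j)) ->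
    (\row_j d (enum_val j)) *m A = \row_i f (enum_val i) (\sum_j d j * e j).
  move=> Ld; apply/rowP => i; rewrite !mxE rmorph_sum.
  rewrite [RHS](reindex (@enum_val J J)) /=; last exact: onW_bij (enum_val_bij _).
  by apply: eq_bigr => j _; rewrite !mxE rmorphM /= [in RHS]Lf.
have freeA : row_free A.
  rewrite /row_free eqn_leq rank_leq_row /= -mxrank_tr.
  suff : row_free A^T by rewrite /row_free => /eqP ->; rewrite cJ.
  apply: inj_row_free => v vA; apply/rowP => i; rewrite mxE -(enum_valK i).
  apply: (dedekind (c := fun i => v 0 (enum_rank i))) => y.
  have [d Ld ->] := He y Logic.I; rewrite -[RHS](mulr0 0).
  under eq_bigr => k _ do rewrite rmorph_sum mulr_sumr.
  rewrite exchange_big /= big1 ?mulr0 // => j _.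
  have /rowP/(_ (enum_rank j)) := vA; rewrite !mxE => vAj.
  rewrite -[RHS](mulr0 (d j)) -[in RHS]vAj mulr_sumr.
  rewrite (reindex (@enum_val I I)) /=; last exact: onW_bij (enum_val_bij _).
  apply: eq_bigr => k _; rewrite !mxE enum_rankK enum_valK rmorphM /= Lf //; ring.
have [l Ll def_x] := He x Logic.I; have [m Lm def_1] := He 1 Logic.I.
have: \row_(j < #|J|) l (enum_val j) = x *: \row_j m (enum_val j).
  apply: (row_free_inj freeA); rewrite /= -scalemxAl !rowA // -def_x -def_1.
  by apply/rowP => i; rewrite !mxE xf rmorph1 mulr1.
move=> /rowP lm.
have [j mj] : exists j, m j != 0.
  apply/existsP; rewrite -negb_forall; apply/negP => /forallP m0.
  by move/eqP: def_1; rewrite big1 ?oner_eq0 // => j _; rewrite (eqP (m0 j)) mul0r.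
have := lm (enum_rank j); rewrite !mxE enum_rankK => lj.
by rewrite -(mulfK mj x) -lj; apply: subfield_div.
Qed.

End Artin.

Lemma divr_distinct (E : fieldType) (c x y : E) :
    c != 0 -> x != 0 -> y != 0 -> x * y != c -> x != y ->
  [/\ x != c / y, c / x != y & c / x != c / y].
Proof.
move=> c0 x0 y0 xyc xy; split.
- by rewrite -(inj_eq (mulIf y0)) divfK.
- by rewrite eq_sym -(inj_eq (mulIf x0)) divfK // mulrC.
- by rewrite (inj_eq (mulfI c0)) (inj_eq invr_inj).
Qed.

(** * The fixed field and adjacent transpositions *)

Section FixedField.
Variables (K : fieldType) (n : nat) (a : K).
Hypothesis a_neq0 : a != 0.
Local Notation F := (ratfun K n).
Local Notation C := (ratfunC K n).
Local Notation X := (@ratfunX K n).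

Lemma ratfunX_inj i j : X i = X j -> i = j.
Proof.
move/eqP; rewrite tofrac_eq => /eqP /(congr1 (mcoeff U_(i))).
by rewrite !mcoeffX eqxx; case: eqP => [/mnmP/(_ i)|_ /eqP]; rewrite ?oner_eq0 // !mnmE eqxx; case: eqP.
Qed.

(** Tells substitutions of opposite parity apart: [X i] is never [C a / X j]. *)
Lemma ratfunX_mul_neqC i j : X i * X j != C a.
Proof.
rewrite /= -rmorphM tofrac_eq; apply/negP => /eqP /(congr1 (mcoeff 0%MM)).
rewrite mcoeffC eqxx mulr1 -mpolyXD mcoeffX => a0.
case/eqP: a_neq0; rewrite -a0; case: eqP => // /mnmP /(_ i).
by rewrite !mnmE eqxx.
Qed.

Lemma twisted_act_distinct (s t : 'S_n) : s != t ->
  exists x, twisted_act a s x != twisted_act a t x :> F.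
Proof.
move=> ne; have [i nei] : exists i, s i != t i.
  apply/existsP; rewrite -negb_forall; apply: contraNN ne => /forallP st.
  by apply/eqP/permP => i; apply/eqP.
have Xst : X (s i) != X (t i) by apply: contra_neq nei; exact: ratfunX_inj.
have Ca0 : C a != 0 by rewrite fmorph_eq0.
have [H1 H2 H3] := divr_distinct Ca0 (ratfunX_neq0 K (s i)) (ratfunX_neq0 K (t i))
  (ratfunX_mul_neqC (s i) (t i)) Xst.
exists (X i); rewrite !twisted_actX //.
by case: (s \in _); case: (t \in _).
Qed.

Lemma twisted_fixedE (f : F) :
  reflect (forall s : 'S_n, twisted_act a s f = f) (f \in @twisted_fixed_field K n a).
Proof. by apply: (iffP forallP) => H s; apply/eqP. Qed.

Lemma twisted_fixed_adjacent (f : F) :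
    (forall i j : 'I_n, nat_of_ord j = i.+1 -> twisted_act a (tperm i j) f = f) ->
  f \in @twisted_fixed_field K n a.
Proof.
move=> Hf; apply/twisted_fixedE => s.
pose stab := [set s : 'S_n | twisted_act a s f == f].
have stabP t : reflect (twisted_act a t f = f) (t \in stab) by rewrite inE; exact: eqP.
have stab1 : 1%g \in stab by apply/stabP/twisted_act1.
have stabM t u : t \in stab -> u \in stab -> (t * u)%g \in stab.
  move=> /stabP tf /stabP uf; apply/stabP.
  exact: etrans (esym (twisted_actM a_neq0 u t f)) (etrans (congr1 _ tf) uf).
have stab_group : group_set stab by apply/group_setP.
case: n f s @stab stabP stab1 stabM stab_group Hf => [|m] f s stab stabP stab1 stabM stab_group Hf.
  by have -> : s = 1%g; [apply/permP => -[] | exact: twisted_act1].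
apply/stabP; suff /subsetP/(_ s) : [set: 'S_m.+1] \subset Group stab_group by apply; rewrite inE.
rewrite -(gen_tperm ord0) gen_subG; apply/subsetP => _ /imsetP [y _ ->] /=.
(* If [z] is the predecessor of [y], then [tperm ord0 y] is the conjugate of [tperm ord0 z] by the
   adjacent transposition [tperm z y]. *)
have [k] := ubnP (nat_of_ord y); elim: k y => // k IH y.
case: (nat_of_ord y =P 0%N) => [y0 _|/eqP y0 yk].
  by rewrite (_ : y = ord0) ?tperm1 //; apply: val_inj.
have ltz : (y.-1 < m.+1)%N by apply: leq_ltn_trans (ltn_ord y); exact: leq_pred.
pose z := Ordinal ltz; have yz : nat_of_ord y = z.+1 by rewrite prednK // lt0n.
have st_zy : tperm z y \in stab by apply/stabP/Hf.
have [z0|z0] := eqVneq z ord0; first by rewrite -z0.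
have st_z : tperm ord0 z \in stab by apply: IH; rewrite -ltnS -yz.
have -> : tperm ord0 y = (tperm ord0 z ^ tperm z y)%g.
  by rewrite tpermJ tpermL tpermD.
by rewrite conjgE tpermV; apply: (stabM) => //; apply: (stabM).
Qed.

(* An adjacent transposition is odd, so it acts through [x -> a / x]. *)
Lemma twisted_fixed_morph (f : F) :
    (forall (phi : {rmorphism F -> F}) (i j : 'I_n), nat_of_ord j = i.+1 ->
      (forall c, phi (C c) = C c) -> phi (X i) = C a / X j ->
      phi (X j) = C a / X i ->
      (forall k, k != i -> k != j -> phi (X k) = C a / X k) -> phi f = f) ->
  f \in @twisted_fixed_field K n a.
Proof.
move=> Hf; apply: twisted_fixed_adjacent => i j ij.
have nij : i != j by rewrite -val_eqE /= ij neq_ltn ltnSn.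
have oddij : (tperm i j \in ('Alt_('I_n))%g) = false by rewrite Alt_even odd_tperm nij.
apply: (Hf (twisted_rmorphism a_neq0 (tperm i j)) i j ij) => [c|||k ki kj] /=.
- exact: twisted_actC.
- by rewrite twisted_actX // oddij tpermL.
- by rewrite twisted_actX // oddij tpermR.
- by rewrite twisted_actX // oddij tpermD // eq_sym.
Qed.

End FixedField.

(** * Algebraic independence from successive transcendence *)

Section Independence.
Variables (K E : fieldType) (iota : {rmorphism K -> E}) (m : nat) (y : 'I_m -> E).

Definition constants : E -> Prop := fun x => exists c, x = iota c.

Lemma gen_adjoinedP x :
  adjoined iota y x <-> gen (fun z => constants z \/ exists i, z = y i) x.
Proof.
split; elim=> {x}.
- by move=> c; apply: gen_in; left; exists c.
- by move=> i; apply: gen_in; right; exists i.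
- by move=> *; apply: genB.
- by move=> *; apply: gen_div.
- by rewrite -(rmorph1 iota); apply: adjoined_base.
- by move=> x [[c ->]|[i ->]]; [apply: adjoined_base|apply: adjoined_gen].
- by move=> *; apply: adjoined_sub.
- by move=> *; apply: adjoined_div.
Qed.

Lemma adjoined_subfield : subfield (adjoined iota y).
Proof.
by split; [rewrite -(rmorph1 iota); apply: adjoined_base|exact: adjoined_sub|exact: adjoined_div].
Qed.

(** Induction on the number of variables that occur. Sorted by powers of the last one, a relation
    becomes a polynomial in [y k] over the field of the earlier [y i]; its coefficients vanish by
    transcendence, and each of them is a relation in fewer variables. *)
Lemma transcendental_independent :
    (forall k : 'I_m, ~ alg (fun x => constants x \/ exists2 i : 'I_m, (i < k)%N & x = y i) (y k)) ->
  algebraically_independent iota y.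
Proof.
move=> trans_y p; pose low k (q : {mpoly K[m]}) := forall (mm : 'X_{1..m}) (i : 'I_m),
  mm \in msupp q -> (k <= i)%N -> mm i = 0%N.
suff main k : (k <= m)%N -> forall q, low k q -> mmap iota y q = 0 -> q = 0.
  by apply: (main m (leqnn m)) => mm i _; rewrite leqNgt ltn_ord.
elim: k => [_ q lq|k IH km q lq] qy.
  have def_q : q = (q@_0%MM)%:MP.
    apply/mpolyP => mm; rewrite mcoeffC; case: eqP => [->|nz]; rewrite ?mulr1 ?mulr0 //.
    apply/eqP; rewrite mcoeff_eq0; apply/negP => mmq; apply: nz.
    by apply/mnmP => i; rewrite mnmE; apply: lq.
  move: qy; rewrite def_q mmapC => /eqP; rewrite fmorph_eq0 => /eqP ->.
  exact: mpolyC0.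
pose kk := Ordinal km; pose D := (\max_(mm <- msupp q) mm kk).+1.
have ltD mm : mm \in msupp q -> (mm kk < D)%N.
  by move=> mmq; rewrite ltnS; apply: (@leq_bigmax_seq _ (msupp q) xpredT (fun mm => mm kk)).
(* [r] erases the exponent at [kk], so that [Q e] is the coefficient of the [e]-th power of that
   variable. *)
pose r (mm : 'X_{1..m}) : 'X_{1..m} := [multinom if i == kk then 0%N else mm i | i < m].
pose Q e := \sum_(mm <- msupp q | mm kk == e) q@_mm *: 'X_[r mm].
have mmap_r mm : mmap1 y mm = y kk ^+ mm kk * mmap1 y (r mm).
  rewrite /mmap1 (bigD1 kk) //= [in RHS](bigD1 kk) //= mnmE eqxx expr0 mul1r.
  by congr (_ * _); apply: eq_bigr => i /negPf ik; rewrite mnmE ik.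
have QyE e : mmap iota y (Q e) =
    \sum_(mm <- msupp q | mm kk == e) iota q@_mm * mmap1 y (r mm).
  by rewrite /Q raddf_sum /=; apply: eq_bigr => mm _; rewrite mmapZ mmapX.
have Qlow e : low k (Q e).
  move=> mm i mmQ ki; have [ik|ik] := eqVneq i kk.
    have /eqP : (Q e)@_mm != 0 by rewrite mcoeff_eq0 mmQ.
    rewrite /Q raddf_sum /=; case: (mm i =P 0%N) => // nz; case.
    rewrite big1 // => m0 _; rewrite mcoeffZ mcoeffX.
    case: eqP => [def_mm|]; last by rewrite mulr0.
    by case: nz; rewrite -def_mm mnmE ik eqxx.
  have /eqP : (Q e)@_mm != 0 by rewrite mcoeff_eq0 mmQ.
  rewrite /Q raddf_sum /=; case: (mm i =P 0%N) => // nz; case.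
  rewrite big_seq_cond big1 // => m0 /andP [m0q _]; rewrite mcoeffZ mcoeffX.
  case: eqP => [def_mm|]; last by rewrite mulr0.
  case: nz; rewrite -def_mm mnmE (negPf ik); apply: lq => //.
  by rewrite ltn_neqAle ki andbT; apply: contraNneq ik => eik; apply/eqP/val_inj.
have Q0 e : (e < D)%N -> Q e = 0.
  move=> eD; apply: IH; [exact: ltnW | exact: Qlow |].
  apply/eqP/negP => /negP Qe; apply: (trans_y kk).
  exists (\poly_(e < D) mmap iota y (Q e)); split.
  - apply/negP => /eqP /polyP /(_ e); rewrite coef_poly eD coef0 => /eqP.
    by rewrite (negPf Qe).
  - move=> i; rewrite coef_poly; case: ifP => _; last exact: subfield0 (gen_subfield _).
    set S := fun x => _; have gS := gen_subfield S.
    rewrite QyE big_seq_cond; apply: (subfield_sum gS) => mm /andP [mmq _].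
    apply: (subfieldM gS); first by apply: gen_in; left; eexists.
    apply: (subfield_prod gS) => j _; rewrite mnmE.
    have [_|jk] := eqVneq j kk; first exact: gen1.
    have [ltj|gej] := ltnP j k.
      by apply: (subfieldX gS); apply: gen_in; right; exists j.
    rewrite lq // ?expr0; first exact: gen1.
    by rewrite ltn_neqAle gej andbT; apply: contraNneq jk => eik; apply/eqP/val_inj.
  - apply/rootP; rewrite horner_poly -[RHS]qy.
    transitivity (\sum_(e < D) \sum_(mm <- msupp q)
        if mm kk == e then iota q@_mm * mmap1 y mm else 0).
      apply: eq_bigr => e' _; rewrite QyE mulr_suml -big_mkcond /=.
      by apply: eq_bigr => mm /eqP def_e; rewrite [in RHS]mmap_r def_e -mulrA [_ * y kk ^+ _]mulrC.
    rewrite exchange_big /=; apply: eq_big_seq => mm mmq.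
    by rewrite -big_mkcond (big_pred1 (Ordinal (ltD _ mmq))).
(* A monomial is determined by its exponent at [kk] and its image under [r], so no cancellation
   occurs inside [Q e] and a coefficient of [q] survives in it. *)
apply/eqP; rewrite -msupp_eq0; case Es: (msupp q) => [//|m0 t].
have m0q : m0 \in msupp q by rewrite Es mem_head.
have /(congr1 (mcoeff (r m0))) := Q0 _ (ltD _ m0q).
rewrite raddf_sum mcoeff0 /= -big_filter (bigD1_seq m0) /=; last 2 first.
- by rewrite mem_filter eqxx.
- by rewrite filter_uniq.
rewrite mcoeffZ mcoeffX eqxx mulr1 big1_seq => [|mm /andP [ne]].
  by rewrite addr0 => /eqP; rewrite mcoeff_eq0 m0q.
rewrite mem_filter => /andP [/eqP ek _]; rewrite mcoeffZ mcoeffX.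
case: eqP => [er|]; last by rewrite mulr0.
case/eqP: ne; apply/mnmP => i; have [->//|ik] := eqVneq i kk.
by have /mnmP/(_ i) := er; rewrite !mnmE (negPf ik).
Qed.

End Independence.

Lemma indep_of_prefixes (E : fieldType) (S : E -> Prop) (s : seq E) :
  (forall s1 x s2, s = s1 ++ x :: s2 -> ~ alg (addl S s1) x) -> indep S s.
Proof.
elim: s S => //= x s IH S H; split.
  by move=> Sx; apply: (H [::] x s) => //; apply: alg_mono Sx => z; left.
apply: IH => s1 z s2 Es Sz; apply: (H (x :: s1) z s2); first by rewrite Es.
apply: alg_mono Sz => u [[Su|->]|u1]; [by left|right; exact: mem_head|].
by right; rewrite inE u1 orbT.
Qed.

(** * The criterion for rationality *)

Section Criterion.
Variables (K : fieldType) (n : nat).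
Local Notation F := (ratfun K n).
Local Notation C := (ratfunC K n).
Local Notation X := (@ratfunX K n).

Lemma ratfun_subfield_full (M : F -> Prop) : subfield M ->
  (forall c, M (C c)) -> (forall i, M (X i)) -> forall f, M f.
Proof.
move=> fM MC MX f; have MP (p : {mpoly K[n]}) : M p%:F.
  rewrite [p]mpolyE rmorph_sum; apply: (subfield_sum fM) => m _ /=.
  rewrite -mul_mpolyC rmorphM /= -prod_ratfunX; apply: (subfieldM fM); first exact: MC.
  by apply: (subfield_prod fM) => i _; apply: (subfieldX fM).
by rewrite (ratfun_repr f); apply: (subfield_div fM).
Qed.

(* The substitutions [X k -> X k ^+ m.+1] fix all the other variables, so a polynomial relation for
   [X k] over them would have infinitely many roots. *)
Lemma ratfunX_transcendental k :
  ~ alg (fun x => constants C x \/ exists2 i, i != k & x = X i) (X k).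
Proof.
pose v d i : F := if i == k then X k ^+ d.+1 else X i.
have v_indep d : algebraically_independent C (v d).
  apply: indep_monomials => D; exists 1, (fun=> 1),
    (fun m => [multinom if i == k then (m i * d.+1)%N else m i | i < n]); split.
  - by move=> _; exact: oner_neq0.
  - move=> m1 m2 _ _ /mnmP em; apply/mnmP => i; have := em i; rewrite !mnmE.
    by case: (i == k) => // /eqP; rewrite eqn_pmul2r // => /eqP.
  - move=> m _; rewrite mul1r scale1r -prod_ratfunX; apply: eq_bigr => i _.
    by rewrite mnmE /v; case: eqP => [->|//]; rewrite -exprM mulnC.
pose phi d : {rmorphism F -> F} := HB.pack (ratfun_subst (v d) : F -> F)
  (GRing.isZmodMorphism.Build F F _ (ratfun_subst_is_zmod_morphism (v_indep d)))
  (GRing.isMonoidMorphism.Build F F _ (ratfun_subst_is_monoid_morphism (v_indep d))).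
have phiX d i : phi d (X i) = v d i by apply: ratfun_substX; exact: v_indep.
have phiC d c : phi d (C c) = C c by apply: ratfun_substC; exact: v_indep.
move=> [p [p0 Lp pX]].
have phi_p d i : phi d p`_i = p`_i.
  apply: (gen_min (fixed_points_subfield (phi d))) (Lp i).
  by move=> x [[c ->]|[j jk ->]]; rewrite ?phiC ?phiX /v ?(negPf jk).
have root_d d : root p (X k ^+ d.+1).
  have -> : X k ^+ d.+1 = phi d (X k) by rewrite phiX /v eqxx.
  have def_p : p = map_poly (phi d) p by apply/polyP => i; rewrite coef_map; exact: esym (phi_p d i).
  by apply/rootP; rewrite def_p horner_map (rootP pX) rmorph0.
have := @max_poly_roots _ p [seq X k ^+ d.+1 | d <- iota 0 (size p)] p0.
rewrite size_map size_iota ltnn => H; suff: false by []; apply: H.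
  by apply/allP => _ /mapP [d _ ->]; exact: root_d.
rewrite map_inj_uniq ?iota_uniq // => d e /eqP.
rewrite -!(rmorphXn (@FracField.tofrac {mpoly K[n]})) tofrac_eq => /eqP.
rewrite !mpolyXn => /(congr1 (mcoeff (U_(k) *+ d.+1)%MM)).
rewrite !mcoeffX eqxx; case: eqP => [/mnmP/(_ k)|_ /eqP]; last by rewrite oner_eq0.
by rewrite !mulmnE !mnmE eqxx !mul1n => -[].
Qed.

Variables (a : K) (a_neq0 : a != 0).

(** The [n] variables are independent and algebraic over the field of the [n] elements [y i], so by
    exchange no [y k] is algebraic over the earlier ones. *)
Lemma algebraically_independent_of_algebraic (y : 'I_n -> F) :
  (forall i, @algebraic F (adjoined C y) (X i)) -> algebraically_independent C y.
Proof.
move=> Xalg; apply: transcendental_independent => k.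
have indX : @indep F (constants C) (map X (enum 'I_n)).
  apply: indep_of_prefixes => s1 x s2 Es.
  have uniqX : uniq (map X (enum 'I_n)).
    by rewrite map_inj_uniq ?enum_uniq // => i j; exact: ratfunX_inj.
  have /mapP [j _ def_x] : x \in map X (enum 'I_n).
    by rewrite Es mem_cat mem_head orbT.
  rewrite def_x => xs1; apply: (@ratfunX_transcendental j).
  apply: alg_mono xs1 => z [Cz|zs1]; [by left | right].
  have /mapP [i _ def_z] : z \in map X (enum 'I_n) by rewrite Es mem_cat zs1.
  exists i => //; apply/negP => /eqP ij; move: uniqX.
  by rewrite Es cat_uniq /= def_x -ij -def_z zs1 /= andbF.
have genP x : adjoined C y x -> @gen F (addl (constants C) (map y (enum 'I_n))) x.
  move=> /gen_adjoinedP; apply: gen_min (gen_subfield _) _ _ => z [Cz|[i ->]].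
    by apply: gen_in; left.
  by apply: gen_in; right; rewrite map_f ?mem_enum.
have lk : (k < size (enum 'I_n))%N by rewrite size_enum_ord.
have enumE : enum 'I_n = take k (enum 'I_n) ++ k :: drop k.+1 (enum 'I_n).
  by rewrite -{1}(cat_take_drop k (enum 'I_n)) (drop_nth k) // nth_ord_enum.
move=> yk; apply: (@indep_size_basis _ (constants C) _ (map y (enum 'I_n)) indX _ _
  (map y (take k (enum 'I_n))) (y k) (map y (drop k.+1 (enum 'I_n)))).
- by rewrite !size_map.
- move=> _ /mapP [i _ ->]; exact: algebraic_mono genP (Xalg i).
- by rewrite {1}enumE map_cat.
apply: alg_mono yk => x [Cx|[i ik ->]]; [by left|right; apply: map_f].
by rewrite -[i](nth_ord_enum k) -(nth_take k (n0 := k)) // mem_nth // size_takel // ltnW.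
Qed.

Lemma twisted_fixed_subfield : subfield (fun f => f \in @twisted_fixed_field K n a).
Proof.
have [f1 fB fdiv] := @twisted_fixed_field_divring_closed K n a a_neq0.
exact: Subfield f1 fB fdiv.
Qed.

Lemma rational_criterion (y : 'I_n -> F) (M : F -> Prop) :
    (forall i, y i \in @twisted_fixed_field K n a) ->
    extension (adjoined C y) n`! M -> (forall i, M (X i)) ->
  rational_over C (@twisted_fixed_field K n a).
Proof.
move=> Fy eM MX; have fL := adjoined_subfield C y.
have fM := extension_subfield eM.
exists n, y; split.
  apply: algebraically_independent_of_algebraic => i.
  exact: extension_mem_algebraic eM (MX i).
move=> f; split=> [/twisted_fixedE Ff|].
  apply: (artin (f := twisted_rmorphism a_neq0)) (Ff) => //.
  - exact: twisted_act_distinct.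
  - move=> s z /gen_adjoinedP; apply: (gen_min (fixed_points_subfield (twisted_rmorphism a_neq0 s))).
    move=> u [[c ->]|[i ->]]; first exact: twisted_actC.
    by have /twisted_fixedE := Fy i; apply.
  - rewrite card_Sn; have [I [e [cI Me He]]] := extension_spanned eM.
    exists I, e; split=> // z _; apply: He; apply: ratfun_subfield_full => // c.
    by apply: (extension_sub eM); apply: adjoined_base.
move=> /gen_adjoinedP; apply: (gen_min twisted_fixed_subfield) => u [[c ->]|[i ->]] //.
by apply/twisted_fixedE => s; exact: twisted_actC.
Qed.

End Criterion.

(** * Places *)

Section Power.
Variable E : fieldType.
Implicit Types L M : E -> Prop.

(** [s] lists, constant term first, the lower coefficients of a monic equation moved to the
    right-hand side; every step of a tower is checked in this form. *)
Lemma extension_power L N M (z : E) (s : seq E) : subfield L -> extension L N M ->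
    (forall i, M s`_i) -> z ^+ size s = (Poly s).[z] ->
  extension L (N * size s) (gen (add1 M z)).
Proof.
move=> fL eM Ms Hz; have fM := extension_subfield eM.
have ss : (size (- Poly s) < size ('X^(size s) : {poly E}))%N.
  by rewrite size_polyXn ltnS size_polyN size_Poly.
apply: (@extension_root _ _ _ _ _ ('X^(size s) - Poly s)) => //.
- apply: (poly_inD fM); first by move=> i; rewrite coefXn; exact: (subfield_nat fM).
  by apply: (poly_inN fM) => i; rewrite coef_Poly.
- by apply/rootP; rewrite hornerD hornerN hornerXn Hz subrr.
- by rewrite size_polyDl // size_polyXn.
Qed.

End Power.

Ltac in_subfield fM := repeat match goal with
  | H : ?G |- ?G => exact H
  | |- _ (_%:R) => apply: (subfield_nat fM)
  | |- _ 1 => apply: (subfield1 fM)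
  | |- _ 0 => apply: (subfield0 fM)
  | |- _ (_ + _) => apply: (subfieldD fM)
  | |- _ (- _) => apply: (subfieldN fM)
  | |- _ (_ * _) => apply: (subfieldM fM)
  | |- _ (_^-1) => apply: (subfieldV fM)
  | |- _ (_ ^+ _) => apply: (subfieldX fM)
  end.

Section Place.
Variables (K E : fieldType).

(* [Sp f k]: the rational function [f] is defined at the chosen point, with value [k] there. *)
Record place (Sp : E -> K -> Prop) : Prop := Place {
  place1 : Sp 1 1;
  placeB : forall f g k l, Sp f k -> Sp g l -> Sp (f - g) (k - l);
  placeM : forall f g k l, Sp f k -> Sp g l -> Sp (f * g) (k * l);
  placeV : forall f k, Sp f k -> k != 0 -> Sp f^-1 k^-1;
  place_neq0 : forall f k, Sp f k -> k != 0 -> f != 0 }.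

Variables (Sp : E -> K -> Prop) (pS : place Sp).

Lemma place0 : Sp 0 0.
Proof. by rewrite -(subrr 1) -[X in Sp _ X](subrr 1); apply: (placeB pS); apply: (place1 pS). Qed.

Lemma placeN f k : Sp f k -> Sp (- f) (- k).
Proof. by move=> fk; rewrite -sub0r -[X in Sp _ X]sub0r; apply: (placeB pS) place0 fk. Qed.

Lemma placeD f g k l : Sp f k -> Sp g l -> Sp (f + g) (k + l).
Proof.
by move=> fk gl; rewrite -[g]opprK -[l]opprK; apply: (placeB pS) => //; apply: placeN.
Qed.

Lemma place_nat n : Sp n%:R n%:R.
Proof.
elim: n => [|n IH]; first exact: place0.
by rewrite !mulrSr; apply: placeD IH (place1 pS).
Qed.

Lemma placeX f k n : Sp f k -> Sp (f ^+ n) (k ^+ n).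
Proof.
move=> fk; elim: n => [|n IH]; first by rewrite !expr0; apply: (place1 pS).
by rewrite !exprS; apply: (placeM pS).
Qed.

End Place.

(** The value is an existential variable filled in along the syntax of the expression; leaves come
    from hypotheses, and abbreviations are unfolded. *)
Ltac place_value pS := lazymatch goal with
  | |- _ (_%:R) _ => eapply (place_nat pS)
  | |- _ 1 _ => eapply (place1 pS)
  | |- _ 0 _ => eapply (place0 pS)
  | |- _ (_ + _) _ => eapply (placeD pS); [place_value pS | place_value pS]
  | |- _ (- _) _ => eapply (placeN pS); place_value pS
  | |- _ (_ ^+ _) _ => eapply (placeX pS); place_value pS
  | |- _ (_ * _) _ => eapply (placeM pS); [place_value pS | place_value pS]
  | |- _ ?f _ => first [eassumption | solve [eauto 1] | unfold f; place_value pS]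
  end.

Ltac place_nonzero pS := eapply (place_neq0 pS); [place_value pS | ].

Section Specialization.
Variables (K E K' : fieldType) (iota : {rmorphism K -> E}) (incl : {rmorphism K -> K'}).
Variables (m : nat) (y : 'I_m -> E).
Hypothesis y_indep : algebraically_independent iota y.

(** By independence a polynomial that is nonzero at [pt] is nonzero at [y], so it may serve as a
    denominator. The point may lie over a larger field [K'], since [K] can have too few elements. *)
Lemma independent_place (pt : 'I_m -> K') : exists Sp : E -> K' -> Prop,
  [/\ place Sp, forall c, Sp (iota c) (incl c) & forall i, Sp (y i) (pt i)].
Proof.
pose h := mmap iota y; pose h' := mmap incl pt.
have h_neq0 (q : {mpoly K[m]}) : h' q != 0 -> h q != 0.
  by move=> qpt; apply: contra_neq qpt => /y_indep ->; rewrite /h' rmorph0.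
exists (fun f k => exists p q : {mpoly K[m]}, [/\ h' q != 0, f = h p / h q & k = h' p / h' q]).
have poly_val (p : {mpoly K[m]}) f k : f = h p -> k = h' p -> exists p q : {mpoly K[m]},
    [/\ h' q != 0, f = h p / h q & k = h' p / h' q].
  by move=> -> ->; exists p, 1; rewrite /h /h' !rmorph1 !divr1 oner_neq0.
split; last first.
- by move=> i; apply: (poly_val 'X_i); rewrite ?/h ?/h' mmapX mmap1U.
- by move=> c; apply: (poly_val c%:MP); rewrite ?/h ?/h' mmapC.
split.
- by apply: (poly_val 1); rewrite ?/h ?/h' rmorph1.
- move=> _ _ _ _ [p [q [q0 -> ->]]] [r [s [s0 -> ->]]].
  exists (p * s - r * q), (q * s); rewrite /h /h' !rmorphB !rmorphM /= -!/h -!/h'.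
  by rewrite -!mulNr !addf_div ?h_neq0 // mulf_neq0.
- move=> _ _ _ _ [p [q [q0 -> ->]]] [r [s [s0 -> ->]]].
  exists (p * r), (q * s); rewrite /h /h' !rmorphM /= -!/h -!/h'.
  by rewrite !mulf_div mulf_neq0.
- move=> _ _ [p [q [q0 -> ->]]]; rewrite mulf_eq0 invr_eq0 (negPf q0) orbF => p0.
  by exists q, p; rewrite !invf_div.
- move=> _ _ [p [q [q0 -> ->]]]; rewrite mulf_eq0 invr_eq0 (negPf q0) orbF => p0.
  by rewrite mulf_neq0 ?invr_neq0 ?h_neq0.
Qed.

End Specialization.

(** * Degree 3 *)

(** A sum over an orbit of the cyclic group; odd permutations turn it into [cyc z y x]. *)
Definition cyc (R : comNzRingType) (x y z : R) : R := x ^+ 2 * y + y ^+ 2 * z + z ^+ 2 * x.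

Lemma rmorph_cyc (R S : comNzRingType) (phi : {rmorphism R -> S}) (x y z : R) :
  phi (cyc x y z) = cyc (phi x) (phi y) (phi z).
Proof. by rewrite /cyc !(rmorphD, rmorphXn, rmorphM). Qed.

Section Degree3.
Variables (E : fieldType) (a x y z : E).
Hypotheses (a0 : a != 0) (x0 : x != 0) (y0 : y != 0) (z0 : z != 0).
Hypotheses (xy : x != y) (xz : x != z).

Let s1 := x + y + z.
Let s2 := x * y + x * z + y * z.
Let s3 := x * y * z.
(** Over a cube root of unity, [P] and [S] are products of two conjugate Lagrange resolvents, of
    [x, y, z] and of their pairwise products; this is behind [A ^+ 2 - A * B + B ^+ 2 = P * S]. *)
Let A := cyc x y z - 3 * s3.
Let B := cyc z y x - 3 * s3.
Let P := s1 ^+ 2 - 3 * s2.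
Let S := s2 ^+ 2 - 3 * s1 * s3.
Let v := B / P.
Let v' := a * B / S.
Let s3' := a ^+ 3 / s3.
Let T := v * s3 - v' * s3'.

Hypotheses (A0 : A != 0) (B0 : B != 0) (P0 : P != 0) (S0 : S != 0).
Hypotheses (SP0 : S - a * P != 0) (s30' : s3 ^+ 2 - a ^+ 3 != 0).
Hypothesis SPs0 : s3 ^+ 2 * S - a ^+ 4 * P != 0.

Let s30 : s3 != 0. Proof. by rewrite !mulf_neq0. Qed.

Let vv' : v - v' != 0.
Proof.
rewrite (_ : _ - _ = B * (S - a * P) / (P * S)); last by rewrite /v /v'; field; rewrite P0 S0.
by rewrite !mulf_neq0 ?invr_eq0 ?mulf_neq0.
Qed.

Let ss' : s3 - s3' != 0.
Proof.
rewrite (_ : _ - _ = (s3 ^+ 2 - a ^+ 3) / s3); last by rewrite /s3'; field.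
by rewrite mulf_neq0 ?invr_eq0.
Qed.

Let T0 : T != 0.
Proof.
rewrite (_ : T = B * (s3 ^+ 2 * S - a ^+ 4 * P) / (P * S * s3)); last first.
  by rewrite /T /v /v' /s3'; field; rewrite P0 S0 s30.
by rewrite !mulf_neq0 ?invr_eq0 ?mulf_neq0.
Qed.

Definition deg3_w := A / B.
(** An odd substitution exchanges [v] with [v'] and [s3] with [s3'], so both differences and [T]
    change sign. *)
Definition deg3_U := (v - v') / T.
Definition deg3_V := (s3 - s3') / T.

(** Inversion and an odd permutation each exchange [A] and [B] up to a common factor; together they
    preserve the ratio. *)
Lemma deg3_fixed (phi : {rmorphism E -> E}) : phi a = a ->
    [/\ phi x = a / y, phi y = a / x & phi z = a / z] \/
    [/\ phi x = a / x, phi y = a / z & phi z = a / y] ->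
  [/\ phi deg3_w = deg3_w, phi deg3_U = deg3_U & phi deg3_V = deg3_V].
Proof.
move=> pa phiE.
have [p1 p2 p3] : [/\ phi s1 = a * s2 / s3, phi s2 = a ^+ 2 * s1 / s3 & phi s3 = s3'].
  rewrite /s1 /s2 /s3' /s3 !(rmorphD, rmorphM).
  by case: phiE => -[-> -> ->]; split; field; rewrite ?x0 ?y0 ?z0.
have [pA pB] : phi A = a ^+ 3 / s3 ^+ 2 * A /\ phi B = a ^+ 3 / s3 ^+ 2 * B.
  rewrite /A /B !rmorphB ![phi (3 * _)]rmorphM !rmorph_nat p3 !rmorph_cyc /s3' /s3 /cyc.
  by case: phiE => -[-> -> ->]; split; field; rewrite ?x0 ?y0 ?z0.
have pP : phi P = a ^+ 2 / s3 ^+ 2 * S.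
  by rewrite /P rmorphB rmorphXn [phi (3 * _)]rmorphM rmorph_nat p1 p2 /S; field.
have pS : phi S = a ^+ 4 / s3 ^+ 2 * P.
  by rewrite /S rmorphB rmorphXn [phi (3 * s1 * _)]rmorphM [phi (3 * _)]rmorphM rmorph_nat p1 p2 p3 /s3' /P; field.
have pv : phi v = v' by rewrite /v /v' fmorph_div pB pP; field; rewrite ?a0 ?s30 ?S0.
have pv' : phi v' = v.
  by rewrite /v /v' fmorph_div [phi (a * B)]rmorphM pa pB pS; field; rewrite ?a0 ?s30 ?P0.
have ps3' : phi s3' = s3 by rewrite /s3' fmorph_div rmorphXn pa p3 /s3'; field; rewrite ?a0 ?s30.
have pT : phi T = - T by rewrite /T rmorphB [phi (v * _)]rmorphM [phi (v' * _)]rmorphM pv pv' p3 ps3' opprB.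
split; rewrite fmorph_div.
- by rewrite pA pB /deg3_w; field; rewrite ?a0 ?s30 ?B0.
- by rewrite rmorphB pT pv pv' /deg3_U; field; rewrite ?oppr_eq0 ?T0.
- by rewrite rmorphB pT p3 ps3' /deg3_V; field; rewrite ?oppr_eq0 ?T0.
Qed.

(** The sum and the product of [v] and [v'] lie in [L], so [v] costs degree 2 and makes [s1], [s2],
    [s3] rational; [x] costs degree 3, and [y] and [z] cost nothing. *)
Lemma deg3_extension (L : E -> Prop) : subfield L -> L a ->
    L deg3_w -> L deg3_U -> L deg3_V ->
  exists M, [/\ extension L 6 M, M x, M y & M z].
Proof.
move=> fL La Lw LU LV; set w := deg3_w; set U := deg3_U; set V := deg3_V.
have U0 : U != 0 by rewrite mulf_neq0 ?invr_eq0.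
have V0 : V != 0 by rewrite mulf_neq0 ?invr_eq0.
have N0 : (w ^+ 2 - w + 1) * B ^+ 2 = P * S.
  have -> : (w ^+ 2 - w + 1) * B ^+ 2 = A ^+ 2 - A * B + B ^+ 2.
    by rewrite /w /deg3_w; field.
  by rewrite /A /B /P /S /s1 /s2 /s3 /cyc; ring.
have N0' : w ^+ 2 - w + 1 != 0.
  by apply/negP => /eqP N; move: N0; rewrite N mul0r => /esym/eqP; rewrite mulf_eq0 (negPf P0) (negPf S0).
(* [c] will be [v * v'], and [k] equals [(s3 * v' - s3' * v) / T], which makes [s3] an affine
   function of [v]. *)
set c := a / (w ^+ 2 - w + 1); set k := V ^+ 2 * c - U ^+ 2 * a ^+ 3.
have def_c : c = v * v'.
  apply: (canLR (mulfK N0')); apply: (mulIf (_ : B ^+ 2 != 0)); first by rewrite expf_neq0.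
  by rewrite -mulrA N0 /v /v'; field; rewrite P0 S0.
have v_quad : v ^+ 2 = (1 + k) / V * v - c.
  rewrite /k def_c (_ : a ^+ 3 = s3 * s3'); last by rewrite /s3'; field.
  have -> : 1 + (V ^+ 2 * (v * v') - U ^+ 2 * (s3 * s3')) = V * (v + v').
    by rewrite /V /U /deg3_V /deg3_U /T; field.
  by field.
have s3E : s3 = (V * v - k) / U.
  apply: (canRL (mulfK U0)); rewrite /k def_c (_ : a ^+ 3 = s3 * s3'); last by rewrite /s3'; field.
  by rewrite /V /U /deg3_V /deg3_U /T; field.
have v0 : v != 0 by rewrite mulf_neq0 ?invr_eq0.
have w0 : w != 0 by rewrite mulf_neq0 ?invr_eq0.
have wv : w * v = A / P by rewrite /w /deg3_w /v; field; rewrite B0 P0.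
(* This identity and the next recover [s1] and [s2] from [s3] and Masuda's [A / P] and [B / P]. *)
have s1E : s1 = (s3 + (w * v + v) * ((w * v) ^+ 2 - w * v * v + v ^+ 2)) / (w * v * v).
  apply: (canRL (mulfK (mulf_neq0 (mulf_neq0 w0 v0) v0))); rewrite wv /v.
  apply: (mulIf (expf_neq0 3 P0)).
  have -> : (s3 + (A / P + B / P) * ((A / P) ^+ 2 - A / P * (B / P) + (B / P) ^+ 2)) * P ^+ 3 =
    s3 * P ^+ 3 + (A + B) * (A ^+ 2 - A * B + B ^+ 2) by field.
  have -> : s1 * (A / P * (B / P)) * P ^+ 3 = s1 * A * B * P by field.
  by rewrite /A /B /P /s1 /s2 /s3 /cyc; ring.
have s2E : s2 = s1 * (w * v + v) - 3 * ((w * v) ^+ 2 - w * v * v + v ^+ 2).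
  rewrite wv /v; apply: (mulIf (expf_neq0 2 P0)).
  have -> : (s1 * (A / P + B / P) - 3 * ((A / P) ^+ 2 - A / P * (B / P) + (B / P) ^+ 2)) * P ^+ 2 =
    s1 * (A + B) * P - 3 * (A ^+ 2 - A * B + B ^+ 2) by field.
  by rewrite /A /B /P /s1 /s2 /s3 /cyc; ring.
have Lc : L c by rewrite /c; in_subfield fL.
have e1 := extension_power fL (extension_refl fL) (z := v) (s := [:: - c; (1 + k) / V]).
have {e1} : extension L 2 (gen (add1 L v)).
  apply: e1 => [i|]; last by rewrite horner_Poly /= v_quad; ring.
  by case: i => [|[|i]] /=; rewrite ?nth_nil /k; in_subfield fL.
set M := gen _ => eM; have fM := extension_subfield eM.
have LM z' : L z' -> M z' by apply: (extension_sub eM).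
have [Mw MU MV Mc] : [/\ M w, M U, M V & M c] by split; apply: LM.
have Ma := LM _ La; have Mv : M v by apply: gen_in; right.
have Ms3 : M s3 by rewrite s3E /k; in_subfield fM.
have Ms1 : M s1 by rewrite s1E; in_subfield fM.
have Ms2 : M s2 by rewrite s2E; in_subfield fM.
have MP : M P by rewrite /P; in_subfield fM.
have MA : M A by rewrite (_ : A = w * v * P); [in_subfield fM | rewrite wv; field].
have e2 := extension_power fL eM (z := x) (s := [:: s3; - s2; s1]).
have {e2} : extension L 6 (gen (add1 M x)).
  apply: e2 => [i|]; last by rewrite horner_Poly /= /s1 /s2 /s3; ring.
  by case: i => [|[|[|i]]] /=; rewrite ?nth_nil; in_subfield fM.
set M' := gen _ => eM'; have fM' := extension_subfield eM'.
have [Mx Ms1' Ms2' Ms3'] : [/\ M' x, M' s1, M' s2 & M' s3].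
  by split; apply: gen_in; [right | left | left | left].
have MA' : M' A by apply: gen_in; left.
have My : M' y.
  (* Once [z] and [y * z] are eliminated, the cyclic sum is affine in [y], with slope
     [(x - y) * (x - z)]. *)
  have n0 : x ^+ 2 + (s2 - x * (s1 - x)) - x * (s1 - x) != 0.
    rewrite (_ : _ - _ = (x - y) * (x - z)); last by rewrite /s1 /s2; ring.
    by rewrite mulf_neq0 // subr_eq0.
  rewrite (_ : y = (A + 3 * s3 - x * (s1 - x) ^+ 2 + x * (s2 - x * (s1 - x))) /
    (x ^+ 2 + (s2 - x * (s1 - x)) - x * (s1 - x))); first by in_subfield fM'.
  by apply: (canRL (mulfK n0)); rewrite /A /s1 /s2 /s3 /cyc; ring.
exists M'; split=> //.
by rewrite (_ : z = s1 - x - y); [in_subfield fM' | rewrite /s1; ring].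
Qed.

End Degree3.

Section Generic3.
Variables (K E : fieldType) (iota : {rmorphism K -> E}) (a : K) (x y z : E).
Hypothesis a0 : a != 0.
Hypothesis generic : forall k l m : K, exists Sp, [/\ place Sp, forall c, Sp (iota c) c,
  Sp x k, Sp y l & Sp z m].

Lemma deg3_rational : exists w U V : E,
  (forall phi : {rmorphism E -> E}, phi (iota a) = iota a ->
    [/\ phi x = iota a / y, phi y = iota a / x & phi z = iota a / z] \/
    [/\ phi x = iota a / x, phi y = iota a / z & phi z = iota a / y] ->
    [/\ phi w = w, phi U = U & phi V = V]) /\
  (forall L, subfield L -> L (iota a) -> L w -> L U -> L V ->
    exists M, [/\ extension L 6 M, M x, M y & M z]).
Proof.
have ia0 : iota a != 0 by rewrite fmorph_eq0.
(* At these points all values are [1] or minus a power of [a], nonzero in every characteristic. *)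
have [Sp1 [pS1 c1 px1 py1 pz1]] := generic 1 1 1.
have [Sp2 [pS2 c2 px2 py2 pz2]] := generic 1 1 0.
have [Sp3 [pS3 c3 px3 py3 pz3]] := generic 1 0 0.
have x0 : x != 0 by place_nonzero pS1; exact: oner_neq0.
have y0 : y != 0 by place_nonzero pS1; exact: oner_neq0.
have z0 : z != 0 by place_nonzero pS1; exact: oner_neq0.
have xy : x != y.
  by rewrite -subr_eq0; place_nonzero pS3; rewrite subr0 oner_neq0.
have xz : x != z.
  by rewrite -subr_eq0; place_nonzero pS3; rewrite subr0 oner_neq0.
have A0 : cyc x y z - 3 * (x * y * z) != 0.
  by rewrite /cyc; place_nonzero pS2; rewrite (_ : _ - _ = 1) ?oner_neq0 //; ring.
have B0 : cyc z y x - 3 * (x * y * z) != 0.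
  by rewrite /cyc; place_nonzero pS2; rewrite (_ : _ - _ = 1) ?oner_neq0 //; ring.
have P0 : (x + y + z) ^+ 2 - 3 * (x * y + x * z + y * z) != 0.
  by place_nonzero pS3; rewrite (_ : _ - _ = 1) ?oner_neq0 //; ring.
have S0 : (x * y + x * z + y * z) ^+ 2 - 3 * (x + y + z) * (x * y * z) != 0.
  by place_nonzero pS2; rewrite (_ : _ - _ = 1) ?oner_neq0 //; ring.
set A := cyc x y z - _ in A0; set B := cyc z y x - _ in B0.
set P := _ ^+ 2 - _ in P0; set S := _ - _ in S0.
have H1 : S - iota a * P != 0.
  place_nonzero pS3; rewrite (_ : _ - _ = - a) ?oppr_eq0 //; ring.
have H2 : (x * y * z) ^+ 2 - iota a ^+ 3 != 0.
  place_nonzero pS3; rewrite (_ : _ - _ = - a ^+ 3) ?oppr_eq0 ?expf_neq0 //; ring.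
have H3 : (x * y * z) ^+ 2 * S - iota a ^+ 4 * P != 0.
  place_nonzero pS3; rewrite (_ : _ - _ = - a ^+ 4) ?oppr_eq0 ?expf_neq0 //; ring.
exists (deg3_w x y z), (deg3_U (iota a) x y z), (deg3_V (iota a) x y z).
by split=> [phi pa phiE|L fL La Lw LU LV]; [apply: deg3_fixed|apply: (@deg3_extension E (iota a))].
Qed.

End Generic3.

Section Variables.
Variables (K : fieldType) (n : nat).
Local Notation F := (ratfun K n).
Local Notation C := (ratfunC K n).
Local Notation X := (@ratfunX K n).

Lemma ratfunX_independent : algebraically_independent C X.
Proof.
apply: algebraically_independent_of_algebraic => i.
exact: mem_algebraic (adjoined_subfield C X) (adjoined_gen C X i).
Qed.

Lemma ratfun_place (s : seq K) : exists Sp : F -> K -> Prop,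
  [/\ place Sp, forall c, Sp (C c) c & forall i, Sp (X i) s`_i].
Proof. exact: (independent_place idfun ratfunX_independent (fun i => s`_i)). Qed.

End Variables.

Section Rational3.
Variables (K : fieldType) (a : K).
Hypothesis a0 : a != 0.
Local Notation F := (ratfun K 3).
Local Notation C := (ratfunC K 3).
Local Notation X := (@ratfunX K 3).

Let i0 : 'I_3 := Ordinal (isT : 0 < 3)%N.
Let i1 : 'I_3 := Ordinal (isT : 1 < 3)%N.
Let i2 : 'I_3 := Ordinal (isT : 2 < 3)%N.

Lemma twisted3_rational : rational_over C (@twisted_fixed_field K 3 a).
Proof.
have [|w [U [V [fixedP extP]]]] := @deg3_rational K F C a (X i0) (X i1) (X i2) a0.
  move=> k l m; have [Sp [pS SpC SpX]] := ratfun_place 3 [:: k; l; m].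
  by exists Sp; split; [|exact: SpC|exact: (SpX i0)|exact: (SpX i1)|exact: (SpX i2)].
pose y (i : 'I_3) := [:: w; U; V]`_i.
have fL := adjoined_subfield C y.
have [M [eM M0 M1 M2]] := extP _ fL (adjoined_base C y a)
  (adjoined_gen C y i0) (adjoined_gen C y i1) (adjoined_gen C y i2).
apply: (rational_criterion a0 _ eM).
  have Fy : [/\ w \in @twisted_fixed_field K 3 a, U \in @twisted_fixed_field K 3 a
      & V \in @twisted_fixed_field K 3 a].
    have H (phi : {rmorphism F -> F}) (i j : 'I_3) : nat_of_ord j = i.+1 -> (forall c, phi (C c) = C c) ->
        phi (X i) = C a / X j -> phi (X j) = C a / X i ->
        (forall k, k != i -> k != j -> phi (X k) = C a / X k) ->
        [/\ phi w = w, phi U = U & phi V = V].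
      move=> ij pC; have [[-> ->]|[-> ->]] : (i = i0 /\ j = i1) \/ (i = i1 /\ j = i2).
        case: i j ij => [[|[|[|//]]] li] [[|[|[|//]]] lj] // _;
          by [left; split; apply: val_inj | right; split; apply: val_inj].
      - move=> p0 p1 pk; apply: fixedP; first exact: pC.
        by left; split=> //; exact: (pk i2 isT isT).
      - move=> p1 p2 pk; apply: fixedP; first exact: pC.
        by right; split=> //; exact: (pk i0 isT isT).
    split; apply: (twisted_fixed_morph a0) => phi i j ij pC pi pj pk;
      by have [] := H phi i j ij pC pi pj pk.
  by case: Fy => F0 F1 F2 [[|[|[|//]]] ?].
by move=> [[|[|[|//]]] li]; rewrite (bool_irrelevance li isT); [exact: M0|exact: M1|exact: M2].
Qed.

End Rational3.

(** * Degree 4 *)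

Section Resolvent.
Variables (E : fieldType) (a u1 u2 u3 e : E).
Hypotheses (a0 : a != 0) (u10 : u1 != 0) (u20 : u2 != 0) (u30 : u3 != 0) (e0 : e != 0).

Let p1 := u1 + u2 + u3.
Let p2 := u1 * u2 + u1 * u3 + u2 * u3.
Let p3 := u1 * u2 * u3.
Let q := 4 * p2 - p1 ^+ 2.
Let disc := p1 ^+ 2 * p2 ^+ 2 - 4 * p2 ^+ 3 - 4 * p1 ^+ 3 * p3 + 18 * p1 * p2 * p3 - 27 * p3 ^+ 2.

(** An odd substitution exchanges [p1] and [q] up to two factors whose product is the factor
    acquired by [p3]. The numerator of [deg4_de] is the product of the differences of the [u_i]. *)
Definition deg4_om := p1 * q / p3.
Definition deg4_de := (cyc u1 u2 u3 - cyc u3 u2 u1) / p3.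
Let om := deg4_om.
Let de := deg4_de.
Let o := om - 8.
Let H := cyc u1 u2 u3 / p3 - 3.
(** The image of [H], written so that the sum with [H] is visibly invariant; [psib] is the image of
    [psi], written through their invariant product. *)
Let Hb := de - 2 + 2 * (1 - de ^+ 2) / o - H.
Let psi := p1 ^+ 2 / p3.
Let psib := a * om ^+ 2 / (o * psi).
Let be := (psi - psib) / (H - Hb).
Let t := a * p3 ^+ 2 * e / o.
(** The line through [(H, psi)] and [(Hb, psib)] is invariant: [be] is its slope, and it meets the
    axis at [- w]. The invariant [eta] is the mean of [H] and [Hb] with weights [1] and [t], where
    [t] goes to its inverse. *)
Definition deg4_w := psi / be - H.
Definition deg4_xi := om / be.
Definition deg4_eta := (H + Hb * t) / (1 + t).
Let w := deg4_w.
Let xi := deg4_xi.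
Let eta := deg4_eta.
Let ep := 9 - om.

Hypotheses (p10 : p1 != 0) (q0 : q != 0) (op0 : p1 * q - 8 * p3 != 0).

Let p30 : p3 != 0. Proof. by rewrite !mulf_neq0. Qed.
Let om0 : om != 0. Proof. by rewrite !mulf_neq0 ?invr_eq0. Qed.
Let oE : o = (p1 * q - 8 * p3) / p3. Proof. by rewrite /o /om /deg4_om; field. Qed.
Let o0 : o != 0. Proof. by rewrite oE mulf_neq0 ?invr_eq0. Qed.
Let psi0 : psi != 0. Proof. by rewrite mulf_neq0 ?invr_eq0 ?expf_neq0. Qed.

Let op3 : o * p3 = (u2 + u3 - u1) * (u1 + u3 - u2) * (u1 + u2 - u3).
Proof. by rewrite oE divfK // /q /p1 /p2 /p3; ring. Qed.

Let v10 : u2 + u3 - u1 != 0.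
Proof. by have := mulf_neq0 o0 p30; rewrite op3 !mulf_eq0 !negb_or => /andP [/andP []]. Qed.
Let v20 : u1 + u3 - u2 != 0.
Proof. by have := mulf_neq0 o0 p30; rewrite op3 !mulf_eq0 !negb_or => /andP [/andP []]. Qed.
Let v30 : u1 + u2 - u3 != 0.
Proof. by have := mulf_neq0 o0 p30; rewrite op3 !mulf_eq0 !negb_or => /andP [/andP []]. Qed.

(** These are the numerators of [H - Hb], [psi - psib] and [1 + t], as polynomials ready to be
    evaluated at a point. *)
Hypothesis H_gen : (p1 * q - 8 * p3) * (p1 * p2 - 7 * p3) - 2 * p3 ^+ 2 + 2 * disc != 0.
Hypothesis psi_gen : p1 ^+ 2 * (p1 * q - 8 * p3) - a * q ^+ 2 * p3 != 0.
Hypothesis t_gen : p1 * q - 8 * p3 + a * p3 ^+ 3 * e != 0.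

Let HHb : H - Hb != 0.
Proof.
rewrite (_ : _ - _ =
  ((p1 * q - 8 * p3) * (p1 * p2 - 7 * p3) - 2 * p3 ^+ 2 + 2 * disc) / (o * p3 * p3)).
  by rewrite !mulf_neq0 ?invr_eq0 ?mulf_neq0.
apply: (canRL (mulfK (mulf_neq0 (mulf_neq0 o0 p30) p30))).
rewrite -(divfK p30 (p1 * q - 8 * p3)) -oE.
have -> : (H - Hb) * (o * p3 * p3) =
  (2 * H * p3 - (de - 2) * p3) * (o * p3) - 2 * (p3 ^+ 2 - (de * p3) ^+ 2) by rewrite /Hb; field.
have deE : de * p3 = cyc u1 u2 u3 - cyc u3 u2 u1 by rewrite /de /deg4_de divfK.
have HE : H * p3 = cyc u1 u2 u3 - 3 * p3 by rewrite /H; field.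
have -> : 2 * H * p3 - (de - 2) * p3 = 2 * (H * p3) - de * p3 + 2 * p3 by ring.
by rewrite HE deE /disc /cyc op3 /p1 /p2 /p3; ring.
Qed.

Let pp : psi - psib != 0.
Proof.
rewrite (_ : _ - _ = (p1 ^+ 2 * (p1 * q - 8 * p3) - a * q ^+ 2 * p3) / (p3 * (p1 * q - 8 * p3))).
  by rewrite !mulf_neq0 ?invr_eq0 ?mulf_neq0.
rewrite /psib oE /om /deg4_om /psi; move: op0; rewrite -/p1 -/p3 -/q => op0'.
by field; rewrite p30 p10 op0'.
Qed.

Let t1 : 1 + t != 0.
Proof.
rewrite (_ : _ + _ = (p1 * q - 8 * p3 + a * p3 ^+ 3 * e) / (p1 * q - 8 * p3)).
  by rewrite mulf_neq0 ?invr_eq0.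
by rewrite /t oE; field; rewrite op0 p30.
Qed.

Section Action.
Variable phi : {rmorphism E -> E}.
Hypotheses (pa : phi a = a) (pe : phi e = a ^+ 4 / e).
Let j1 := (u2 + u3 - u1) / (a * u2 * u3).
Let j2 := (u1 + u3 - u2) / (a * u1 * u3).
Let j3 := (u1 + u2 - u3) / (a * u1 * u2).
Hypothesis phiE : [/\ phi u1 = j1, phi u2 = j3 & phi u3 = j2] \/
  [/\ phi u1 = j2, phi u2 = j1 & phi u3 = j3].

Let nz : (a != 0, u1 != 0, u2 != 0, u3 != 0,
  u2 + u3 - u1 != 0, u1 + u3 - u2 != 0, u1 + u2 - u3 != 0) =
  (true, true, true, true, true, true, true).
Proof. by rewrite a0 u10 u20 u30 v10 v20 v30. Qed.

Let pp1 : phi p1 = q / (a * p3).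
Proof.
rewrite /p1 !rmorphD; case: phiE => -[-> -> ->]; rewrite /j1 /j2 /j3 /q /p1 /p2 /p3; field;
  by rewrite a0 u10 u20 u30.
Qed.

Let pp3 : phi p3 = o / (a ^+ 3 * p3).
Proof.
rewrite (_ : o = o * p3 / p3); last by rewrite mulfK.
rewrite op3 /p3 !rmorphM; case: phiE => -[-> -> ->]; rewrite /j1 /j2 /j3; field;
  by rewrite a0 u10 u20 u30.
Qed.

Let pp2 : phi p2 = (q * p2 - 2 * p1 * p3) / (a ^+ 2 * p3 ^+ 2).
Proof.
rewrite /p2 !(rmorphD, rmorphM); case: phiE => -[-> -> ->]; rewrite /j1 /j2 /j3 /q /p1 /p2 /p3; field;
  by rewrite a0 u10 u20 u30.
Qed.

Let pq : phi q = p1 * o / (a ^+ 2 * p3).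
Proof.
rewrite /q rmorphB rmorphXn [phi (4 * _)]rmorphM rmorph_nat pp1 pp2 oE /q; field; by rewrite a0 p30.
Qed.

Let pom : phi om = om.
Proof.
rewrite /om /deg4_om fmorph_div [phi (p1 * _)]rmorphM pp1 pq pp3; field.
by rewrite a0 p30 o0.
Qed.

Let po : phi o = o. Proof. by rewrite /o rmorphB pom rmorph_nat. Qed.

Let pde : phi de = de.
Proof.
have -> : de = (u1 - u2) * (u1 - u3) * (u2 - u3) / p3.
  by rewrite /de /deg4_de /cyc; congr (_ / _); ring.
rewrite fmorph_div ![phi (_ * (_ - _))]rmorphM !rmorphB pp3 (_ : o = o * p3 / p3); last by rewrite mulfK.
rewrite op3 /p3; case: phiE => -[-> -> ->]; rewrite /j1 /j2 /j3; field;
  by rewrite a0 u10 u20 u30 v10 v20 v30.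
Qed.

Let pH : phi H = Hb.
Proof.
rewrite /Hb (_ : o = o * p3 / p3); last by rewrite mulfK.
rewrite /H rmorphB rmorph_nat fmorph_div pp3 rmorph_cyc.
rewrite (_ : o = o * p3 / p3); last by rewrite mulfK.
rewrite /de /deg4_de op3 /p3 /cyc; case: phiE => -[-> -> ->]; rewrite /j1 /j2 /j3; field;
  by rewrite ?a0 u10 u20 u30 v10 v20 v30.
Qed.

Let pHb : phi Hb = H.
Proof.
rewrite {1}/Hb rmorphB pH rmorphD rmorphB pde [phi (_ / o)]fmorph_div po [phi (2 * _)]rmorphM.
rewrite [phi (1 - _)]rmorphB rmorphXn pde !rmorph_nat rmorph1 /Hb; ring.
Qed.

Let ppsi : phi psi = psib.
Proof.
rewrite /psi fmorph_div rmorphXn pp1 pp3 /psib /om /deg4_om /psi; field.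
by rewrite a0 p30 o0 p10.
Qed.

Let ppsib : phi psib = psi.
Proof.
rewrite /psib fmorph_div [phi (a * _)]rmorphM rmorphXn pa pom [phi (o * _)]rmorphM po ppsi /psib; field.
by rewrite a0 om0 o0 psi0.
Qed.

Let pt : phi t = t^-1.
Proof.
rewrite /t fmorph_div [phi (_ * e)]rmorphM [phi (a * _)]rmorphM rmorphXn pa pe po pp3; field.
by rewrite a0 p30 o0 e0.
Qed.


Lemma deg4_fixed : [/\ phi deg4_om = deg4_om, phi deg4_de = deg4_de, phi deg4_w = deg4_w,
  phi deg4_xi = deg4_xi & phi deg4_eta = deg4_eta].
Proof.
have be0 : be != 0 by rewrite mulf_neq0 ?invr_eq0.
have pbe : phi be = be.
  rewrite /be fmorph_div [phi (psi - _)]rmorphB [phi (H - _)]rmorphB ppsi ppsib pH pHb.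
  by rewrite -(opprB psi) -(opprB H) invrN mulrNN.
split; [exact: pom | exact: pde | | |].
- rewrite /deg4_w rmorphB [phi (psi / _)]fmorph_div ppsi pH pbe /be; field; by rewrite HHb pp.
- by rewrite /deg4_xi fmorph_div pom pbe.
- have t0 : t != 0 by rewrite !mulf_neq0 ?expf_neq0 ?invr_eq0.
  rewrite /deg4_eta fmorph_div [phi (H + _)]rmorphD [phi (1 + _)]rmorphD [phi (Hb * _)]rmorphM pH pHb pt rmorph1; field.
  by rewrite t0 t1.
Qed.

End Action.

Hypotheses (u12 : u1 - u2 != 0) (u13 : u1 - u3 != 0).

Let be0 : be != 0. Proof. by rewrite mulf_neq0 ?invr_eq0. Qed.

(** Sum and product of [H] and [Hb] are thus functions of [om] and [de], and [H] is quadratic over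
    their field. *)
Let HHbE : o * (H * Hb) = 7 * de ^+ 2 + de * ep + ep ^+ 2 - de ^+ 3.
Proof.
have -> : o * (H * Hb) = H * (o * (de - 2) + 2 * (1 - de ^+ 2) - o * H) by rewrite /Hb; field.
rewrite (_ : ep = 1 - o); last by rewrite /ep /o; ring.
rewrite (_ : o = o * p3 / p3); last by rewrite mulfK.
by rewrite /H /de /deg4_de op3 /p3 /cyc; field; rewrite u10 u20 u30.
Qed.

(** Since [psi = be * (H + w)] and [psib = be * (Hb + w)], the known product of [psi] and [psib]
    gives [a * xi ^+ 2 = o * ((H + w) * (Hb + w))], which is symmetric in [H] and [Hb]. *)
Let xiE : a * xi ^+ 2 = 7 * de ^+ 2 + de * (w + ep) + (w + ep) ^+ 2 - ep * de * w
  - ep * w ^+ 2 - de ^+ 3 - 2 * w * de ^+ 2.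
Proof.
have psiE : psi = be * (H + w) by rewrite /w /deg4_w addrC subrK mulrC divfK.
have psibE : psib = be * (Hb + w).
  have -> : psib = psi - be * (H - Hb) by rewrite /be divfK // opprB addrC subrK.
  by rewrite psiE; ring.
have e1 : a * xi ^+ 2 = o * ((H + w) * (Hb + w)).
  have h : psi * psib = a * om ^+ 2 / o by rewrite /psib; field; rewrite o0 psi0.
  apply: (mulIf (expf_neq0 2 be0)); rewrite /xi /deg4_xi.
  rewrite (_ : a * (om / be) ^+ 2 * be ^+ 2 = o * (a * om ^+ 2 / o)); last by field; rewrite be0 o0.
  by rewrite -h psiE psibE; ring.
rewrite e1 (_ : o * _ = o * (H * Hb) + o * w * (H + Hb) + o * w ^+ 2); last by ring.
rewrite HHbE (_ : H + Hb = de - 2 + 2 * (1 - de ^+ 2) / o); last by rewrite /Hb; ring.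
rewrite (_ : o * w * (_ + _) = w * (o * (de - 2) + 2 * (1 - de ^+ 2))); last by field.
by rewrite (_ : ep = 1 - o); [ring | rewrite /ep /o; ring].
Qed.

(** The relation between the invariants; the shift by 9 moves its double point to the origin. *)
Lemma deg4_cubic : a * deg4_xi ^+ 2 = 7 * deg4_de ^+ 2 + deg4_de * (deg4_w + (9 - deg4_om))
  + (deg4_w + (9 - deg4_om)) ^+ 2 - (9 - deg4_om) * deg4_de * deg4_w - (9 - deg4_om) * deg4_w ^+ 2
  - deg4_de ^+ 3 - 2 * deg4_w * deg4_de ^+ 2.
Proof. exact: xiE. Qed.


(** [H] costs degree 2 and [u1] degree 3. In between, the invariant line gives [psi] from [H], the
    quotients [p1 ^+ 3 / p3] and [p1 ^+ 2 / p3] give [p1] and [p3], and [eta] gives [t], hence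
    [e]. *)
Lemma deg4_extension (L : E -> Prop) : subfield L ->
    L a -> L deg4_om -> L deg4_de -> L deg4_w -> L deg4_xi -> L deg4_eta ->
  exists M, [/\ extension L 6 M, M u1, M u2, M u3 & M e].
Proof.
move=> fL La Lom Lde Lw Lxi Leta.
have Lo : L o by rewrite /o; in_subfield fL.
have Lep : L ep by rewrite /ep; in_subfield fL.
pose sH := de - 2 + 2 * (1 - de ^+ 2) / o.
pose pH := (7 * de ^+ 2 + de * ep + ep ^+ 2 - de ^+ 3) / o.
have LsH : L sH by rewrite /sH; in_subfield fL.
have LpH : L pH by rewrite /pH; in_subfield fL.
have e1 := extension_power fL (extension_refl fL) (z := H) (s := [:: - pH; sH]).
have {e1} : extension L 2 (gen (add1 L H)).
  apply: e1 => [i|].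
    by case: i => [|[|i]] /=; rewrite ?nth_nil; in_subfield fL.
  rewrite horner_Poly /= /pH -HHbE (_ : sH = H + Hb); last by rewrite /sH /Hb; ring.
  by field.
set M := gen _ => eM; have fM := extension_subfield eM.
have LM z : L z -> M z by apply: (extension_sub eM).
have [Ma Mom Mde Mw Mxi] : [/\ M a, M om, M de, M w & M xi] by split; apply: LM.
have [Meta Mo MsH] : [/\ M eta, M o & M sH] by split; apply: LM.
have MH : M H by apply: gen_in; right.
have MHb : M Hb by rewrite (_ : Hb = sH - H); [in_subfield fM | rewrite /sH /Hb; ring].
have beE : be = om / xi by rewrite /xi /deg4_xi; field; rewrite om0 be0.
have psiE : psi = om / xi * (H + w) by rewrite -beE /w /deg4_w addrC subrK mulrC divfK.
have Mpsi : M psi by rewrite psiE; in_subfield fM.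
pose m := 2 * H + 9 - de.
have mE : p1 * p2 = m * p3.
  by rewrite /m /H /de /deg4_de /p1 /p2 /p3 /cyc; field; rewrite u10 u20 u30.
have Mm : M m by rewrite /m; in_subfield fM.
have p13 : p1 ^+ 3 / p3 = 4 * m - om.
  apply: (mulIf p30); rewrite mulrBl -[4 * m * p3]mulrA -mE divfK // /om /deg4_om divfK // /q; ring.
have Mp1 : M p1.
  rewrite (_ : p1 = (4 * m - om) / psi); first by in_subfield fM.
  by rewrite -p13 /psi; field; rewrite p10 p30.
have Mp3 : M p3.
  rewrite (_ : p3 = p1 ^+ 2 / psi); first by in_subfield fM.
  by rewrite /psi; field; rewrite p10 p30.
have Mp2 : M p2.
  rewrite (_ : p2 = m * p3 / p1); first by in_subfield fM.
  by rewrite -mE; field.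
have Mq : M q by rewrite /q; in_subfield fM.
have Mcyc : M (cyc u1 u2 u3).
  rewrite (_ : cyc u1 u2 u3 = (H + 3) * p3); first by in_subfield fM.
  by rewrite /H; field.
have Mt : M t.
  rewrite (_ : t = (eta - H) / (Hb - eta)); first by in_subfield fM.
  have -> : Hb - eta = (Hb - H) / (1 + t) by rewrite /eta /deg4_eta; field.
  have -> : eta - H = (Hb - H) * t / (1 + t) by rewrite /eta /deg4_eta; field.
  have : Hb - H != 0 by rewrite -oppr_eq0 opprB.
  by move=> h; field; rewrite t1 h.
have Me : M e.
  rewrite (_ : e = t * o / (a * p3 ^+ 2)); first by in_subfield fM.
  by rewrite /t; field; rewrite a0 p30 o0.
have e2 := extension_power fL eM (z := u1) (s := [:: p3; - p2; p1]).
have {e2} : extension L 6 (gen (add1 M u1)).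
  apply: e2 => [i|]; last by rewrite horner_Poly /= /p1 /p2 /p3; ring.
  by case: i => [|[|[|i]]] /=; rewrite ?nth_nil; in_subfield fM.
set M' := gen _ => eM'; have fM' := extension_subfield eM'.
have MM' z : M z -> M' z by move=> Mz; apply: gen_in; left.
have Mu1 : M' u1 by apply: gen_in; right.
have [Mp1' Mp2' Mp3' Mcyc'] : [/\ M' p1, M' p2, M' p3 & M' (cyc u1 u2 u3)] by split; apply: MM'.
have Mu2 : M' u2.
  have n0 : u1 ^+ 2 + (p2 - u1 * (p1 - u1)) - u1 * (p1 - u1) != 0.
    rewrite (_ : _ - _ = (u1 - u2) * (u1 - u3)); last by rewrite /p1 /p2; ring.
    by rewrite mulf_neq0.
  rewrite (_ : u2 = (cyc u1 u2 u3 - u1 * (p1 - u1) ^+ 2 + u1 * (p2 - u1 * (p1 - u1))) /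
    (u1 ^+ 2 + (p2 - u1 * (p1 - u1)) - u1 * (p1 - u1))); first by in_subfield fM'.
  by apply: (canRL (mulfK n0)); rewrite /p1 /p2 /cyc; ring.
exists M'; split=> //; last exact: MM'.
by rewrite (_ : u3 = p1 - u1 - u2); [in_subfield fM' | rewrite /p1; ring].
Qed.

End Resolvent.

(** * The Klein four-group: four variables and their three resolvents *)

Section Degree4.
Variables (E : fieldType) (a x1 x2 x3 x4 : E).
Hypotheses (a0 : a != 0) (x10 : x1 != 0) (x20 : x2 != 0) (x30 : x3 != 0) (x40 : x4 != 0).

Let l1 := x1 + x2 - x3 - x4.
Let l2 := x1 + x3 - x2 - x4.
Let l3 := x1 + x4 - x2 - x3.
Let m1 := x1 * x2 - x3 * x4.
Let m2 := x1 * x3 - x2 * x4.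
Let m3 := x1 * x4 - x2 * x3.
Hypotheses (l10 : l1 != 0) (l20 : l2 != 0) (l30 : l3 != 0).
Hypotheses (m10 : m1 != 0) (m20 : m2 != 0) (m30 : m3 != 0).
Hypotheses (x12 : x1 - x2 != 0) (x13 : x1 - x3 != 0) (x14 : x1 - x4 != 0) (x23 : x2 - x3 != 0) (x24 : x2 - x4 != 0).

(** The Möbius involution exchanging [x1] with [x2] and [x3] with [x4] has the equation
    [l1 * x * y - m1 * (x + y) + n1 = 0], and [u1] is [l1 / m1]. The map [x -> a / x] exchanges [l1]
    and [n1] up to powers of [a]. *)
Definition deg4_u1 := (x1 + x2 - x3 - x4) / (x1 * x2 - x3 * x4).
Definition deg4_u2 := (x1 + x3 - x2 - x4) / (x1 * x3 - x2 * x4).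
Definition deg4_u3 := (x1 + x4 - x2 - x3) / (x1 * x4 - x2 * x3).
Let u1 := deg4_u1.
Let u2 := deg4_u2.
Let u3 := deg4_u3.
Let e4 := x1 * x2 * x3 * x4.

Let u1E : u1 = l1 / m1. Proof. by []. Qed.
Let u2E : u2 = l2 / m2. Proof. by []. Qed.
Let u3E : u3 = l3 / m3. Proof. by []. Qed.

Lemma deg4_u1_neq0 : u1 != 0. Proof. by rewrite mulf_neq0 ?invr_eq0. Qed.
Lemma deg4_u2_neq0 : u2 != 0. Proof. by rewrite mulf_neq0 ?invr_eq0. Qed.
Lemma deg4_u3_neq0 : u3 != 0. Proof. by rewrite mulf_neq0 ?invr_eq0. Qed.

Lemma deg4_u12 : u1 - u2 != 0.
Proof.
rewrite (_ : _ - _ = - ((x1 - x4) * (x2 - x3) * l3) / (m1 * m2)).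
  by rewrite !mulf_neq0 ?invr_eq0 ?oppr_eq0 ?mulf_neq0.
have -> : - ((x1 - x4) * (x2 - x3) * l3) = l1 * m2 - l2 * m1.
  by rewrite /l1 /l2 /l3 /m1 /m2; ring.
by rewrite u1E u2E; field; rewrite m10 m20.
Qed.

Lemma deg4_u13 : u1 - u3 != 0.
Proof.
rewrite (_ : _ - _ = - ((x1 - x3) * (x2 - x4) * l2) / (m1 * m3)).
  by rewrite !mulf_neq0 ?invr_eq0 ?oppr_eq0 ?mulf_neq0.
have -> : - ((x1 - x3) * (x2 - x4) * l2) = l1 * m3 - l3 * m1.
  by rewrite /l1 /l2 /l3 /m1 /m3; ring.
by rewrite u1E u3E; field; rewrite m10 m30.
Qed.

Let n1 := x1 * x2 * (x3 + x4) - x3 * x4 * (x1 + x2).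
Let n2 := x1 * x3 * (x2 + x4) - x2 * x4 * (x1 + x3).
Let n3 := x1 * x4 * (x2 + x3) - x2 * x3 * (x1 + x4).

(** The three involutions commute, which reads [l1 * n2 + n1 * l2 = 2 * m1 * m2] and its analogues;
    this is how the [n_i / m_i] depend on the [u_i]. *)
Let n1E : (u2 + u3 - u1) / (u2 * u3) = n1 / m1.
Proof.
rewrite u1E u2E u3E; have : n1 * (l2 * l3) = l2 * m1 * m3 + l3 * m1 * m2 - l1 * m2 * m3.
  by rewrite /n1 /l1 /l2 /l3 /m1 /m2 /m3; ring.
move/(canRL (mulfK (mulf_neq0 l20 l30))) ->; field; by rewrite l20 l30 m10 m20 m30.
Qed.

Let n2E : (u1 + u3 - u2) / (u1 * u3) = n2 / m2.
Proof.
rewrite u1E u2E u3E; have : n2 * (l1 * l3) = l1 * m2 * m3 + l3 * m1 * m2 - l2 * m1 * m3.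
  by rewrite /n2 /l1 /l2 /l3 /m1 /m2 /m3; ring.
move/(canRL (mulfK (mulf_neq0 l10 l30))) ->; field; by rewrite l10 l30 m10 m20 m30.
Qed.

Let n3E : (u1 + u2 - u3) / (u1 * u2) = n3 / m3.
Proof.
rewrite u1E u2E u3E; have : n3 * (l1 * l2) = l1 * m2 * m3 + l2 * m1 * m3 - l3 * m1 * m2.
  by rewrite /n3 /l1 /l2 /l3 /m1 /m2 /m3; ring.
move/(canRL (mulfK (mulf_neq0 l10 l20))) ->; field; by rewrite l10 l20 m10 m20 m30.
Qed.

Lemma deg4_u_action (phi : {rmorphism E -> E}) : phi a = a ->
    [\/ [/\ phi x1 = a / x2, phi x2 = a / x1, phi x3 = a / x3 & phi x4 = a / x4],
        [/\ phi x1 = a / x1, phi x2 = a / x3, phi x3 = a / x2 & phi x4 = a / x4]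
      | [/\ phi x1 = a / x1, phi x2 = a / x2, phi x3 = a / x4 & phi x4 = a / x3]] ->
  let j1 := (u2 + u3 - u1) / (a * u2 * u3) in
  let j2 := (u1 + u3 - u2) / (a * u1 * u3) in
  let j3 := (u1 + u2 - u3) / (a * u1 * u2) in
  phi e4 = a ^+ 4 / e4 /\
  ([/\ phi u1 = j1, phi u2 = j3 & phi u3 = j2] \/ [/\ phi u1 = j2, phi u2 = j1 & phi u3 = j3]).
Proof.
move=> pa phiX j1 j2 j3.
have j1E : j1 = n1 / m1 / a.
  by rewrite -n1E /j1; field; rewrite a0 deg4_u2_neq0 deg4_u3_neq0.
have j2E : j2 = n2 / m2 / a.
  by rewrite -n2E /j2; field; rewrite a0 deg4_u1_neq0 deg4_u3_neq0.
have j3E : j3 = n3 / m3 / a.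
  by rewrite -n3E /j3; field; rewrite a0 deg4_u1_neq0 deg4_u2_neq0.
have e40 : e4 != 0 by rewrite !mulf_neq0.
have nzx : [&& x1 != 0, x2 != 0, x3 != 0 & x4 != 0] by rewrite x10 x20 x30 x40.
have ratio s n m : s != 0 -> m != 0 -> s * (a * n / e4) / (s * (a ^+ 2 * m / e4)) = n / m / a.
  by move=> s0 m0; field; rewrite a0 e40 m0 s0.
have N1 : -1 != 0 :> E by rewrite oppr_eq0 oner_eq0.
split.
  by rewrite /e4 !rmorphM; case: phiX => -[-> -> -> ->]; field; rewrite ?x10 ?x20 ?x30 ?x40.
rewrite j1E j2E j3E u1E u2E u3E !fmorph_div.
case: phiX => -[p1 p2 p3 p4]; [left | right | left].
- have -> : phi l1 = -1 * (a * n1 / e4).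
    by rewrite /l1 !(rmorphB, rmorphD) p1 p2 p3 p4 /n1 /e4; field; rewrite ?x10 ?x20 ?x30 ?x40.
  have -> : phi m1 = -1 * (a ^+ 2 * m1 / e4).
    by rewrite /m1 rmorphB !rmorphM p1 p2 p3 p4 /e4; field; rewrite ?x10 ?x20 ?x30 ?x40.
  have -> : phi l2 = 1 * (a * n3 / e4).
    by rewrite /l2 !(rmorphB, rmorphD) p1 p2 p3 p4 /n3 /e4; field; rewrite ?x10 ?x20 ?x30 ?x40.
  have -> : phi m2 = 1 * (a ^+ 2 * m3 / e4).
    by rewrite /m2 /m3 rmorphB !rmorphM p1 p2 p3 p4 /e4; field; rewrite ?x10 ?x20 ?x30 ?x40.
  have -> : phi l3 = 1 * (a * n2 / e4).
    by rewrite /l3 !(rmorphB, rmorphD) p1 p2 p3 p4 /n2 /e4; field; rewrite ?x10 ?x20 ?x30 ?x40.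
  have -> : phi m3 = 1 * (a ^+ 2 * m2 / e4).
    by rewrite /m2 /m3 rmorphB !rmorphM p1 p2 p3 p4 /e4; field; rewrite ?x10 ?x20 ?x30 ?x40.
  by rewrite !ratio ?oner_neq0.
- have -> : phi l1 = -1 * (a * n2 / e4).
    by rewrite /l1 !(rmorphB, rmorphD) p1 p2 p3 p4 /n2 /e4; field; rewrite ?x10 ?x20 ?x30 ?x40.
  have -> : phi m1 = -1 * (a ^+ 2 * m2 / e4).
    by rewrite /m1 /m2 rmorphB !rmorphM p1 p2 p3 p4 /e4; field; rewrite ?x10 ?x20 ?x30 ?x40.
  have -> : phi l2 = -1 * (a * n1 / e4).
    by rewrite /l2 !(rmorphB, rmorphD) p1 p2 p3 p4 /n1 /e4; field; rewrite ?x10 ?x20 ?x30 ?x40.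
  have -> : phi m2 = -1 * (a ^+ 2 * m1 / e4).
    by rewrite /m2 /m1 rmorphB !rmorphM p1 p2 p3 p4 /e4; field; rewrite ?x10 ?x20 ?x30 ?x40.
  have -> : phi l3 = -1 * (a * n3 / e4).
    by rewrite /l3 !(rmorphB, rmorphD) p1 p2 p3 p4 /n3 /e4; field; rewrite ?x10 ?x20 ?x30 ?x40.
  have -> : phi m3 = -1 * (a ^+ 2 * m3 / e4).
    by rewrite /m3 rmorphB !rmorphM p1 p2 p3 p4 /e4; field; rewrite ?x10 ?x20 ?x30 ?x40.
  by rewrite !ratio.
- have -> : phi l1 = -1 * (a * n1 / e4).
    by rewrite /l1 !(rmorphB, rmorphD) p1 p2 p3 p4 /n1 /e4; field; rewrite ?x10 ?x20 ?x30 ?x40.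
  have -> : phi m1 = -1 * (a ^+ 2 * m1 / e4).
    by rewrite /m1 rmorphB !rmorphM p1 p2 p3 p4 /e4; field; rewrite ?x10 ?x20 ?x30 ?x40.
  have -> : phi l2 = -1 * (a * n3 / e4).
    by rewrite /l2 !(rmorphB, rmorphD) p1 p2 p3 p4 /n3 /e4; field; rewrite ?x10 ?x20 ?x30 ?x40.
  have -> : phi m2 = -1 * (a ^+ 2 * m3 / e4).
    by rewrite /m2 /m3 rmorphB !rmorphM p1 p2 p3 p4 /e4; field; rewrite ?x10 ?x20 ?x30 ?x40.
  have -> : phi l3 = -1 * (a * n2 / e4).
    by rewrite /l3 !(rmorphB, rmorphD) p1 p2 p3 p4 /n2 /e4; field; rewrite ?x10 ?x20 ?x30 ?x40.
  have -> : phi m3 = -1 * (a ^+ 2 * m2 / e4).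
    by rewrite /m2 /m3 rmorphB !rmorphM p1 p2 p3 p4 /e4; field; rewrite ?x10 ?x20 ?x30 ?x40.
  by rewrite !ratio.
Qed.

Let p1 := u1 + u2 + u3.
Let p2 := u1 * u2 + u1 * u3 + u2 * u3.
Let p3 := u1 * u2 * u3.
Let e1 := x1 + x2 + x3 + x4.
Let e2 := x1 * x2 + x1 * x3 + x1 * x4 + x2 * x3 + x2 * x4 + x3 * x4.
Let e3 := x1 * x2 * x3 + x1 * x2 * x4 + x1 * x3 * x4 + x2 * x3 * x4.

Let p30 : p3 != 0.
Proof. by rewrite !mulf_neq0 ?invr_eq0. Qed.

Let mmm0 : m1 * m2 * m3 != 0. Proof. by rewrite !mulf_neq0. Qed.

(** With the next two identities, the quartic of the variables has its coefficients in the field of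
    [p1], [p2], [p3] and [e4]. *)
Let e1E : e1 = e4 * p3 + (4 * p2 - p1 ^+ 2) / p3.
Proof.
have p3E : p3 = l1 * l2 * l3 / (m1 * m2 * m3).
  by rewrite /p3 u1E u2E u3E; field; rewrite m10 m20 m30.
apply: (mulIf p30); rewrite [RHS]mulrDl divfK //; apply: (mulIf (expf_neq0 2 mmm0)).
rewrite [RHS]mulrDl (_ : (4 * p2 - p1 ^+ 2) * _ = 4 * (l1 * l2 * m3 + l1 * l3 * m2 + l2 * l3 * m1) *
  (m1 * m2 * m3) - (l1 * m2 * m3 + l2 * m1 * m3 + l3 * m1 * m2) ^+ 2); last first.
  by rewrite /p2 /p1 u1E u2E u3E; field; rewrite m10 m20 m30.
have -> : e1 * p3 * (m1 * m2 * m3) ^+ 2 = e1 * (l1 * l2 * l3) * (m1 * m2 * m3).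
  by rewrite p3E; field; rewrite m10 m20 m30.
have -> : e4 * p3 * p3 * (m1 * m2 * m3) ^+ 2 = e4 * (l1 * l2 * l3) ^+ 2.
  by rewrite p3E; field; rewrite m10 m20 m30.
by rewrite /e1 /e4 /l1 /l2 /l3 /m1 /m2 /m3; ring.
Qed.

Let e2E : e2 = (p2 * e1 - 2 * p1) / p3.
Proof.
apply: (canRL (mulfK p30)); apply: (mulIf mmm0).
have -> : e2 * p3 * (m1 * m2 * m3) = e2 * (l1 * l2 * l3).
  by rewrite /p3 u1E u2E u3E; field; rewrite m10 m20 m30.
have -> : (p2 * e1 - 2 * p1) * (m1 * m2 * m3) = (l1 * l2 * m3 + l1 * l3 * m2 + l2 * l3 * m1) * e1
    - 2 * (l1 * m2 * m3 + l2 * m1 * m3 + l3 * m1 * m2).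
  by rewrite /p2 /p1 u1E u2E u3E; field; rewrite m10 m20 m30.
by rewrite /e1 /e2 /l1 /l2 /l3 /m1 /m2 /m3; ring.
Qed.

Let e3E : e3 = (p1 * e1 - 8) / p3.
Proof.
apply: (canRL (mulfK p30)); apply: (mulIf mmm0).
have -> : e3 * p3 * (m1 * m2 * m3) = e3 * (l1 * l2 * l3).
  by rewrite /p3 u1E u2E u3E; field; rewrite m10 m20 m30.
have -> : (p1 * e1 - 8) * (m1 * m2 * m3) =
    (l1 * m2 * m3 + l2 * m1 * m3 + l3 * m1 * m2) * e1 - 8 * (m1 * m2 * m3).
  by rewrite /p1 u1E u2E u3E; field; rewrite m10 m20 m30.
by rewrite /e1 /e3 /l1 /l2 /l3 /m1 /m2 /m3; ring.
Qed.

Lemma deg4_quartic (L : E -> Prop) : subfield L -> L p1 -> L p2 -> L p3 -> L e4 ->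
  exists s : seq E, (forall i, L s`_i) /\
    forall x, x \in [:: x1; x2; x3; x4] -> x ^+ 4 = (Poly s).[x] /\ size s = 4%N.
Proof.
move=> fL Lp1 Lp2 Lp3 Le4; exists [:: - e4; e3; - e2; e1].
have Le1 : L e1 by rewrite e1E; in_subfield fL.
have Le2 : L e2 by rewrite e2E; in_subfield fL.
have Le3 : L e3 by rewrite e3E; in_subfield fL.
split=> [[|[|[|[|i]]]] /=|x]; rewrite ?nth_nil; in_subfield fL.
by rewrite !inE => /or4P [] /eqP ->; rewrite horner_Poly /= /e1 /e2 /e3 /e4; split=> //; ring.
Qed.

(** The three involutions have their coefficients in [M], and they carry [x1] to [x2], [x3] and
    [x4]. *)
Lemma deg4_full (M : E -> Prop) : subfield M -> M u1 -> M u2 -> M u3 -> M x1 ->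
  [/\ M x2, M x3 & M x4].
Proof.
move=> fM M1 M2 M3 Mx.
have step u l m n y : u = l / m -> m != 0 -> l * x1 - m != 0 -> l * x1 * y - m * (x1 + y) + n = 0 ->
    M u -> M (n / m) -> M y.
  move=> uE m0 d0 yE Mu Mn; have d0' : u * x1 - 1 != 0.
    by rewrite uE (_ : _ - 1 = (l * x1 - m) / m) ?mulf_neq0 ?invr_eq0 //; field.
  rewrite (_ : y = (x1 - n / m) / (u * x1 - 1)); first by in_subfield fM.
  apply: (canRL (mulfK d0')); apply: (mulIf m0).
  rewrite uE (_ : y * (l / m * x1 - 1) * m = y * (l * x1 - m)); last by field.
  rewrite (_ : (x1 - n / m) * m = x1 * m - n); last by field.
  by apply/eqP; rewrite -subr_eq0 -[X in _ == X]yE; apply/eqP; ring.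
split.
- apply: (step u1 l1 m1 n1) => //.
  + by rewrite (_ : _ - _ = (x1 - x3) * (x1 - x4)) ?mulf_neq0 // /l1 /m1; ring.
  + by rewrite /l1 /m1 /n1; ring.
  + by rewrite -n1E; in_subfield fM.
- apply: (step u2 l2 m2 n2) => //.
  + by rewrite (_ : _ - _ = (x1 - x2) * (x1 - x4)) ?mulf_neq0 // /l2 /m2; ring.
  + by rewrite /l2 /m2 /n2; ring.
  + by rewrite -n2E; in_subfield fM.
- apply: (step u3 l3 m3 n3) => //.
  + by rewrite (_ : _ - _ = (x1 - x2) * (x1 - x3)) ?mulf_neq0 // /l3 /m3; ring.
  + by rewrite /l3 /m3 /n3; ring.
  + by rewrite -n3E; in_subfield fM.
Qed.

End Degree4.

Lemma place_eq0 (K E : fieldType) (Sp : E -> K -> Prop) (f : E) (k : K) :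
  place Sp -> Sp f k -> f = 0 -> k = 0.
Proof.
move=> pS fk f0; apply/eqP/negP => /negP k0.
by have := place_neq0 pS fk k0; rewrite f0 eqxx.
Qed.

Lemma algebraic_power (E : fieldType) (L : E -> Prop) (z : E) (s : seq E) : subfield L ->
  (forall i, L s`_i) -> z ^+ size s = (Poly s).[z] -> algebraic L z.
Proof.
move=> fL Ls zE; apply: extension_mem_algebraic fL (extension_power fL (extension_refl fL) Ls zE) _.
by apply: gen_in; right.
Qed.

(** * Nonvanishing and generators in degree 4 *)

Section Generic4.
Variables (K E : fieldType) (iota : {rmorphism K -> E}) (a : K) (x1 x2 x3 x4 : E).
Hypothesis a0 : a != 0.
Hypothesis generic : forall y : 'I_4 -> E,
  (forall x, x \in [:: x1; x2; x3; x4] -> algebraic (adjoined iota y) x) ->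
  algebraically_independent iota y.
Local Notation A := (iota a).

(** Used with three coordinate systems: the variables, then [p1, p2, p3, e4], then
    [om, de, w, eta]. *)
Lemma deg4_place (s : seq E) (pt : seq K) :
    (forall L, subfield L -> (forall c, L (iota c)) -> L s`_0 -> L s`_1 -> L s`_2 -> L s`_3 ->
      forall x, x \in [:: x1; x2; x3; x4] -> algebraic L x) ->
  exists Sp, [/\ place Sp, forall c, Sp (iota c) c, Sp s`_0 pt`_0, Sp s`_1 pt`_1 &
    Sp s`_2 pt`_2 /\ Sp s`_3 pt`_3].
Proof.
move=> Hs; pose y (i : 'I_4) := s`_i; pose ord i (lt : (i < 4)%N) : 'I_4 := Ordinal lt.
have indy : algebraically_independent iota y.
  apply: generic => x; apply: Hs; first exact: adjoined_subfield.
  - exact: adjoined_base.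
  - exact: (adjoined_gen iota y (@ord 0%N isT)).
  - exact: (adjoined_gen iota y (@ord 1%N isT)).
  - exact: (adjoined_gen iota y (@ord 2%N isT)).
  - exact: (adjoined_gen iota y (@ord 3%N isT)).
have [Sp [pS cS yS]] := independent_place idfun indy (fun i => pt`_i).
exists Sp; split=> //; [exact: (yS (@ord 0%N isT))|exact: (yS (@ord 1%N isT))|].
by split; [exact: (yS (@ord 2%N isT))|exact: (yS (@ord 3%N isT))].
Qed.

Let u1 := deg4_u1 x1 x2 x3 x4.
Let u2 := deg4_u2 x1 x2 x3 x4.
Let u3 := deg4_u3 x1 x2 x3 x4.
Let e4 := x1 * x2 * x3 * x4.
Let p1 := u1 + u2 + u3.
Let p2 := u1 * u2 + u1 * u3 + u2 * u3.
Let p3 := u1 * u2 * u3.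

Let om := deg4_om u1 u2 u3.
Let de := deg4_de u1 u2 u3.
Let w := deg4_w A u1 u2 u3.
Let xi := deg4_xi A u1 u2 u3.
Let eta := deg4_eta A u1 u2 u3 e4.

Lemma deg4_rational : exists g : 'I_4 -> E,
  (forall phi : {rmorphism E -> E}, phi A = A ->
    [\/ [/\ phi x1 = A / x2, phi x2 = A / x1, phi x3 = A / x3 & phi x4 = A / x4],
        [/\ phi x1 = A / x1, phi x2 = A / x3, phi x3 = A / x2 & phi x4 = A / x4]
      | [/\ phi x1 = A / x1, phi x2 = A / x2, phi x3 = A / x4 & phi x4 = A / x3]] ->
    forall i, phi (g i) = g i) /\
  exists M, extension (adjoined iota g) 24 M /\ forall x, x \in [:: x1; x2; x3; x4] -> M x.
Proof.
have A0 : A != 0 by rewrite fmorph_eq0.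
have placeX pt : exists Sp, [/\ place Sp, forall c, Sp (iota c) c, Sp x1 pt`_0, Sp x2 pt`_1 &
    Sp x3 pt`_2 /\ Sp x4 pt`_3].
  apply: (@deg4_place [:: x1; x2; x3; x4] pt) => L fL _ L1 L2 L3 L4 x.
  by rewrite !inE => /or4P [] /eqP ->; apply: mem_algebraic.
have [Sp1 [S1 C1 X11 X12 [X13 X14]]] := placeX [:: 1; 1; 1; 1].
have [Sp2 [S2 C2 X21 X22 [X23 X24]]] := placeX [:: 1; 0; 0; 0].
have [Sp3 [S3 C3 X31 X32 [X33 X34]]] := placeX [:: 1; 1; 0; 0].
have [Sp4 [S4 C4 X41 X42 [X43 X44]]] := placeX [:: 1; 0; 1; 0].
have [Sp5 [S5 C5 X51 X52 [X53 X54]]] := placeX [:: 1; 0; 0; 1].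
rewrite /= in X11 X12 X13 X14 X21 X22 X23 X24 X31 X32 X33 X34 X41 X42 X43 X44 X51 X52 X53 X54.
have x10 : x1 != 0 by place_nonzero S1; exact: oner_neq0.
have x20 : x2 != 0 by place_nonzero S1; exact: oner_neq0.
have x30 : x3 != 0 by place_nonzero S1; exact: oner_neq0.
have x40 : x4 != 0 by place_nonzero S1; exact: oner_neq0.
have x12 : x1 - x2 != 0 by place_nonzero S2; rewrite subr0 oner_neq0.
have x13 : x1 - x3 != 0 by place_nonzero S2; rewrite subr0 oner_neq0.
have x14 : x1 - x4 != 0 by place_nonzero S2; rewrite subr0 oner_neq0.
have x23 : x2 - x3 != 0 by place_nonzero S3; rewrite subr0 oner_neq0.
have x24 : x2 - x4 != 0 by place_nonzero S3; rewrite subr0 oner_neq0.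
have l10 : x1 + x2 - x3 - x4 != 0 by place_nonzero S2; rewrite !subr0 addr0 oner_neq0.
have l20 : x1 + x3 - x2 - x4 != 0 by place_nonzero S2; rewrite !subr0 addr0 oner_neq0.
have l30 : x1 + x4 - x2 - x3 != 0 by place_nonzero S2; rewrite !subr0 addr0 oner_neq0.
have m10 : x1 * x2 - x3 * x4 != 0 by place_nonzero S3; rewrite !mulr0 subr0 mulr1 oner_neq0.
have m20 : x1 * x3 - x2 * x4 != 0 by place_nonzero S4; rewrite !mulr0 subr0 mulr1 oner_neq0.
have m30 : x1 * x4 - x2 * x3 != 0 by place_nonzero S5; rewrite !mulr0 subr0 mulr1 oner_neq0.
have u10 : u1 != 0 by apply: deg4_u1_neq0.
have u20 : u2 != 0 by apply: deg4_u2_neq0.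
have u30 : u3 != 0 by apply: deg4_u3_neq0.
have u12 : u1 - u2 != 0 by apply: deg4_u12.
have u13 : u1 - u3 != 0 by apply: deg4_u13.
have e40 : e4 != 0 by rewrite !mulf_neq0.
have p30 : p3 != 0 := mulf_neq0 (mulf_neq0 u10 u20) u30.
have placeP pt : exists Sp, [/\ place Sp, forall c, Sp (iota c) c, Sp p1 pt`_0, Sp p2 pt`_1 &
    Sp p3 pt`_2 /\ Sp e4 pt`_3].
  apply: (@deg4_place [:: p1; p2; p3; e4] pt) => L fL _ L1 L2 L3 L4 x xX.
  have [s [Ls Hs]] : exists s : seq E, (forall i, L s`_i) /\
    forall x, x \in [:: x1; x2; x3; x4] -> x ^+ 4 = (Poly s).[x] /\ size s = 4%N.
    by apply: deg4_quartic.
  by have [xs ss] := Hs x xX; apply: (algebraic_power fL Ls); rewrite ss.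
have [Sq1 [Q1 D1 Y11 Y12 [Y13 Y14]]] := placeP [:: 1; 0; 0; 0].
have [Sq2 [Q2 D2 Y21 Y22 [Y23 Y24]]] := placeP [:: 1; 1; 0; 0].
have [Sq3 [Q3 D3 Y31 Y32 [Y33 Y34]]] := placeP [:: 0; 1; 0; 0].
rewrite /= in Y11 Y12 Y13 Y14 Y21 Y22 Y23 Y24 Y31 Y32 Y33 Y34.
have N1 : -1 != 0 :> K by rewrite oppr_eq0 oner_neq0.
have p10 : p1 != 0 by place_nonzero Q1; exact: oner_neq0.
have q0 : 4 * p2 - p1 ^+ 2 != 0.
  by place_nonzero Q1; rewrite (_ : _ - _ = -1) //; ring.
have op0 : p1 * (4 * p2 - p1 ^+ 2) - 8 * p3 != 0.
  by place_nonzero Q1; rewrite (_ : _ - _ = -1) //; ring.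
have psi_gen : p1 ^+ 2 * (p1 * (4 * p2 - p1 ^+ 2) - 8 * p3) - A * (4 * p2 - p1 ^+ 2) ^+ 2 * p3 != 0.
  by place_nonzero Q1; rewrite (_ : _ - _ = -1) //; ring.
have t_gen : p1 * (4 * p2 - p1 ^+ 2) - 8 * p3 + A * p3 ^+ 3 * e4 != 0.
  by place_nonzero Q1; rewrite (_ : _ + _ = -1) //; ring.
have H_gen : (p1 * (4 * p2 - p1 ^+ 2) - 8 * p3) * (p1 * p2 - 7 * p3) - 2 * p3 ^+ 2 +
    2 * (p1 ^+ 2 * p2 ^+ 2 - 4 * p2 ^+ 3 - 4 * p1 ^+ 3 * p3 + 18 * p1 * p2 * p3 - 27 * p3 ^+ 2) != 0.
  (* Two points are combined to cover every characteristic: the values are [- 3] and [- 8], which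
     cannot both vanish because [(- 3) ^+ 2 - 8 = 1]. *)
  apply/negP => /eqP H0; have := oner_neq0 K.
  have [k2 [v2 E2]] : exists k, Sq2 0 k /\ k = - 3 :> K.
    by rewrite -{1}H0; eexists; split; [place_value Q2 | ring].
  have [k3 [v3 E3]] : exists k, Sq3 0 k /\ k = - 8 :> K.
    by rewrite -{1}H0; eexists; split; [place_value Q3 | ring].
  have {}E2 : - 3 = 0 :> K by rewrite -E2; exact: place_eq0 Q2 v2 (erefl _).
  have {}E3 : - 8 = 0 :> K by rewrite -E3; exact: place_eq0 Q3 v3 (erefl _).
  have -> : 1 = (- 3) ^+ 2 + - 8 :> K by ring.
  by rewrite E2 E3 expr0n addr0 eqxx.
have tower L : subfield L -> L A -> L om -> L de -> L w -> L xi -> L eta ->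
    exists M, extension L 24 M /\ forall x, x \in [:: x1; x2; x3; x4] -> M x.
  move=> fL LA Lom Lde Lw Lxi Leta.
  have [M [eM M1 M2 M3 Me]] : exists M, [/\ extension L 6 M, M u1, M u2, M u3 & M e4].
    exact: (@deg4_extension E A u1 u2 u3 e4).
  have fM := extension_subfield eM.
  have [s [Ms Hs]] : exists s : seq E, (forall i, M s`_i) /\
    forall x, x \in [:: x1; x2; x3; x4] -> x ^+ 4 = (Poly s).[x] /\ size s = 4%N.
    apply: deg4_quartic => //.
    - by rewrite -/u1 -/u2 -/u3; in_subfield fM.
    - by rewrite -/u1 -/u2 -/u3; in_subfield fM.
    - by rewrite -/u1 -/u2 -/u3; in_subfield fM.
  have [xs ss] := Hs x1 (mem_head _ _).
  have := extension_power fL eM (z := x1) Ms; rewrite ss => /(_ xs) eM'.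
  have fM' := extension_subfield eM'.
  have Mx1 : gen (add1 M x1) x1 by apply: gen_in; right.
  have sub z : M z -> gen (add1 M x1) z by move=> Mz; apply: gen_in; left.
  have [Mx2 Mx3 Mx4] : [/\ gen (add1 M x1) x2, gen (add1 M x1) x3 & gen (add1 M x1) x4].
    by apply: (@deg4_full E x1 x2 x3 x4) => //; apply: sub.
  exists (gen (add1 M x1)); split=> // x.
  by rewrite !inE => /or4P [] /eqP ->.
have cubic : A * xi ^+ 2 = 7 * de ^+ 2 + de * (w + (9 - om)) + (w + (9 - om)) ^+ 2
    - (9 - om) * de * w - (9 - om) * w ^+ 2 - de ^+ 3 - 2 * w * de ^+ 2.
  exact: (@deg4_cubic E A u1 u2 u3).
(* By the cubic relation [xi] is a square root over the field of [om], [de] and [w], so these and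
   [eta] are coordinates too. *)
have placeD pt : exists Sp, [/\ place Sp, forall c, Sp (iota c) c, Sp om pt`_0, Sp de pt`_1 &
    Sp w pt`_2 /\ Sp eta pt`_3].
  apply: (@deg4_place [:: om; de; w; eta] pt) => L fL LK L1 L2 L3 L4 x xX.
  have LA : L A by exact: LK.
  have xi2 : xi ^+ 2 = (A * xi ^+ 2) / A by rewrite mulrC mulKf.
  have eL : extension L 2 (gen (add1 L xi)).
    apply: (extension_power fL (extension_refl fL) (s := [:: A * xi ^+ 2 / A; 0])).
      by rewrite cubic; case=> [|[|i]] /=; rewrite ?nth_nil; in_subfield fL.
    by rewrite horner_Poly /= -xi2; ring.
  have fL' := extension_subfield eL.
  have sub z : L z -> gen (add1 L xi) z by move=> Lz; apply: gen_in; left.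
  have [M [eM MX]] : exists M, extension (gen (add1 L xi)) 24 M /\
      forall x, x \in [:: x1; x2; x3; x4] -> M x.
    by apply: tower => //; try (apply: sub; assumption); apply: gen_in; right.
  exact: extension_mem_algebraic fL (extension_trans fL eL eM) (MX x xX).
have [Sr1 [R1 F1 Z11 Z12 [Z13 Z14]]] := placeD [:: 0; 1; 0; 0].
rewrite /= in Z11 Z12 Z13 Z14.
have de0 : de != 0 by place_nonzero R1; exact: oner_neq0.
pose W := w / de; pose Ep := (9 - om) / de; pose Xi := xi / de.
pose g (i : 'I_4) := [:: W; Ep; Xi; eta]`_i.
exists g; split.
  move=> phi pA pX.
  have [pe pu] := deg4_u_action A0 x10 x20 x30 x40 l10 l20 l30 m10 m20 m30 pA pX.
  have [pom pde pw pxi peta] : [/\ phi om = om, phi de = de, phi w = w, phi xi = xi & phi eta = eta].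
    exact: (@deg4_fixed E A u1 u2 u3 e4).
  case=> [[|[|[|[|//]]]] lti]; rewrite /g /=.
  - by rewrite /W fmorph_div pw pde.
  - by rewrite /Ep fmorph_div rmorphB rmorph_nat pom pde.
  - by rewrite /Xi fmorph_div pxi pde.
  - exact: peta.
have fL := adjoined_subfield iota g.
pose ord i (lt : (i < 4)%N) : 'I_4 := Ordinal lt.
have LA : adjoined iota g A by apply: adjoined_base.
have LW : adjoined iota g W := adjoined_gen iota g (@ord 0%N isT).
have LEp : adjoined iota g Ep := adjoined_gen iota g (@ord 1%N isT).
have LXi : adjoined iota g Xi := adjoined_gen iota g (@ord 2%N isT).
have Leta : adjoined iota g eta := adjoined_gen iota g (@ord 3%N isT).
(* The cubic relation has a node at the origin, so it is linear in [de] along the line through it. *)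
have den0 : 1 + 2 * W + Ep * W + Ep * W ^+ 2 != 0.
  have : de ^+ 3 + 2 * w * de ^+ 2 + (9 - om) * w * de + (9 - om) * w ^+ 2 != 0.
    by place_nonzero R1; rewrite (_ : _ + _ = 1) ?oner_neq0 //; ring.
  apply: contraNneq => h; rewrite (_ : _ + _ = de ^+ 3 * (1 + 2 * W + Ep * W + Ep * W ^+ 2)).
    by rewrite h mulr0.
  by rewrite /W /Ep; field.
have deE : de = (7 + (W + Ep) + (W + Ep) ^+ 2 - A * Xi ^+ 2) / (1 + 2 * W + Ep * W + Ep * W ^+ 2).
  apply: (canRL (mulfK den0)); rewrite (_ : A * Xi ^+ 2 = A * xi ^+ 2 / de ^+ 2).
    by rewrite cubic /W /Ep; field.
  by rewrite /Xi; field.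
have Lde : adjoined iota g de by rewrite deE; in_subfield fL.
apply: tower => //.
- by rewrite (_ : om = 9 - Ep * de); [in_subfield fL | rewrite /Ep divfK //; ring].
- by rewrite (_ : w = W * de); [in_subfield fL | rewrite /W divfK].
- by rewrite (_ : xi = Xi * de); [in_subfield fL | rewrite /Xi divfK].
Qed.

End Generic4.

Section Rational4.
Variables (K : fieldType) (a : K).
Hypothesis a0 : a != 0.
Local Notation F := (ratfun K 4).
Local Notation C := (ratfunC K 4).
Local Notation X := (@ratfunX K 4).

Let i0 : 'I_4 := Ordinal (isT : 0 < 4)%N.
Let i1 : 'I_4 := Ordinal (isT : 1 < 4)%N.
Let i2 : 'I_4 := Ordinal (isT : 2 < 4)%N.
Let i3 : 'I_4 := Ordinal (isT : 3 < 4)%N.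

Let mem4 (P : F -> Prop) : (forall x, x \in [:: X i0; X i1; X i2; X i3] -> P x) ->
  forall i, P (X i).
Proof.
move=> PX i; apply: PX; apply: (@map_f _ _ X [:: i0; i1; i2; i3]).
by case: i => [[|[|[|[|//]]]] li].
Qed.

Lemma twisted4_rational : rational_over C (@twisted_fixed_field K 4 a).
Proof.
have [|g [fixedP [M [eM MX]]]] := @deg4_rational K F C a (X i0) (X i1) (X i2) (X i3) a0.
  by move=> y yX; apply: algebraically_independent_of_algebraic; exact: mem4.
apply: (rational_criterion a0 _ eM); last exact: mem4.
move=> k; apply: (twisted_fixed_morph a0) => phi i j ij pC pi pj pk.
apply: fixedP; first exact: pC.
case: i j ij pi pj pk => [[|[|[|[|//]]]] li] [[|[|[|[|//]]]] lj] // _;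
  rewrite (bool_irrelevance li isT) (bool_irrelevance lj isT) => p0 p1 pk.
- by constructor 1; split; [exact: p0|exact: p1|exact: (pk i2 isT isT)|exact: (pk i3 isT isT)].
- by constructor 2; split; [exact: (pk i0 isT isT)|exact: p0|exact: p1|exact: (pk i3 isT isT)].
- by constructor 3; split; [exact: (pk i0 isT isT)|exact: (pk i1 isT isT)|exact: p0|exact: p1].
Qed.

End Rational4.

(** * Degree 5 *)

Section InvariantForms5.
Variable R : comNzRingType.

(* Send [x4], [x5] to [0], [oo] and the other points to [r1], [r2], [r3], with elementary symmetric
   functions [s1], [s2], [s3]. The transposition (34) then translates the coordinate, (45) inverts it,
   up to a common factor. [P], [I] and [I4] are invariant under translation; [n / d] is an
   equivariant point: it is moved by these substitutions as the coordinate itself. *)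
Definition deg5_P (s1 s2 s3 : R) := 3 * s1 ^+ 2 - 8 * s2.
Definition deg5_I (s1 s2 s3 : R) := s2 ^+ 2 - 3 * s1 * s3.
Definition deg5_P' (s1 s2 s3 : R) := 3 * s2 ^+ 2 - 8 * s1 * s3.
Definition deg5_I' (s1 s2 s3 : R) := s1 ^+ 2 - 3 * s2.
(** The invariant of degree 4 of the binary quintic whose roots are the five points. *)
Definition deg5_I4 (s1 s2 s3 : R) :=
  6 * s2 ^+ 3 - 19 * s1 * s2 * s3 + 9 * s3 ^+ 2 + 6 * s1 ^+ 3 * s3 - 2 * s1 ^+ 2 * s2 ^+ 2.
(** [n5 / d5] and [n7 / d7] are the roots of the linear covariants of degree 5 and 7 of the
    quintic. *)
Definition deg5_n5 (s1 s2 s3 : R) := 4*s1^+3*s2*s3 - s1^+2*s2^+3 - 8*s1^+2*s3^+2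
  - 12*s1*s2^+2*s3 + 3*s2^+4 + 24*s2*s3^+2.
Definition deg5_d5 (s1 s2 s3 : R) := 3*s1^+4*s3 - s1^+3*s2^+2 - 12*s1^+2*s2*s3
  + 4*s1*s2^+3 + 24*s1*s3^+2 - 8*s2^+2*s3.
Definition deg5_n7 (s1 s2 s3 : R) :=
  -24*s1^+5*s3^+2 + 13*s1^+4*s2^+2*s3 - 2*s1^+3*s2^+4 + 128*s1^+3*s2*s3^+2
  - 62*s1^+2*s2^+3*s3 - 240*s1^+2*s3^+3 + 9*s1*s2^+5 + 40*s1*s2^+2*s3^+2 - 6*s2^+4*s3 + 144*s2*s3^+3.
Definition deg5_d7 (s1 s2 s3 : R) := -9*s1^+5*s2*s3 + 2*s1^+4*s2^+3 + 6*s1^+4*s3^+2 + 62*s1^+3*s2^+2*s3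
  - 13*s1^+2*s2^+4 - 40*s1^+2*s2*s3^+2 - 128*s1*s2^+3*s3 - 144*s1*s3^+3 + 24*s2^+5 + 240*s2^+2*s3^+2.

Definition deg5_tn (s1 s2 s3 c c' : R) :=
  3 * s2 ^+ 3 + 3 * s1 ^+ 3 * s3 - s1 ^+ 2 * s2 ^+ 2 - 24 * s3 ^+ 2 - 9 * s3 * c - 10 * s3 * c'.
(** Half the sum of [deg5_I4] and the square root [r1 * r2 * r3 * (r1 - r2) * (r1 - r3) * (r2 - r3)]
    of the discriminant; its coefficients are integral, so it makes sense in characteristic 2. *)
Definition deg5_th (r1 r2 r3 : R) := deg5_tn (r1 + r2 + r3) (r1 * r2 + r1 * r3 + r2 * r3)
  (r1 * r2 * r3) (cyc r1 r2 r3) (cyc r3 r2 r1).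

(** The invariant of degree 8: a quarter of the square of [deg5_I4] minus the discriminant, again
    integral. *)
Definition deg5_J (s1 s2 s3 : R) := 9*s1^+6*s3^+2 - 6*s1^+5*s2^+2*s3 + s1^+4*s2^+4 - 57*s1^+4*s2*s3^+2
  + 37*s1^+3*s2^+3*s3 + 28*s1^+3*s3^+3 - 6*s1^+2*s2^+5 + 81*s1^+2*s2^+2*s3^+2 - 57*s1*s2^+4*s3
  - 90*s1*s2*s3^+3 + 9*s2^+6 + 28*s2^+3*s3^+2 + 27*s3^+4.

Lemma deg5_thJ r1 r2 r3 : 
  let s1 := r1 + r2 + r3 in let s2 := r1 * r2 + r1 * r3 + r2 * r3 in let s3 := r1 * r2 * r3 in
  deg5_th r1 r2 r3 * (deg5_I4 s1 s2 s3 - deg5_th r1 r2 r3) = deg5_J s1 s2 s3.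
Proof. by rewrite /deg5_J /deg5_th /deg5_tn /deg5_I4 /cyc; ring. Qed.

End InvariantForms5.

Section MorphismForms5.
Variables (E E' : comNzRingType) (phi : {rmorphism E -> E'}).
Lemma rmorph_deg5_I4 s1 s2 s3 : phi (deg5_I4 s1 s2 s3) = deg5_I4 (phi s1) (phi s2) (phi s3).
Proof. by rewrite /deg5_I4 !(rmorph_nat, rmorphXn, rmorphM, rmorphN, rmorphB, rmorphD). Qed.
Lemma rmorph_deg5_P s1 s2 s3 : phi (deg5_P s1 s2 s3) = deg5_P (phi s1) (phi s2) (phi s3).
Proof. by rewrite /deg5_P !(rmorph_nat, rmorphXn, rmorphM, rmorphN, rmorphB, rmorphD). Qed.
Lemma rmorph_deg5_I s1 s2 s3 : phi (deg5_I s1 s2 s3) = deg5_I (phi s1) (phi s2) (phi s3).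
Proof. by rewrite /deg5_I !(rmorph_nat, rmorphXn, rmorphM, rmorphN, rmorphB, rmorphD). Qed.
Lemma rmorph_deg5_n5 s1 s2 s3 : phi (deg5_n5 s1 s2 s3) = deg5_n5 (phi s1) (phi s2) (phi s3).
Proof. by rewrite /deg5_n5 !(rmorph_nat, rmorphXn, rmorphM, rmorphN, rmorphB, rmorphD). Qed.
Lemma rmorph_deg5_n7 s1 s2 s3 : phi (deg5_n7 s1 s2 s3) = deg5_n7 (phi s1) (phi s2) (phi s3).
Proof. by rewrite /deg5_n7 !(rmorph_nat, rmorphXn, rmorphM, rmorphN, rmorphB, rmorphD). Qed.
Lemma rmorph_deg5_d5 s1 s2 s3 : phi (deg5_d5 s1 s2 s3) = deg5_d5 (phi s1) (phi s2) (phi s3).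
Proof. by rewrite /deg5_d5 !(rmorph_nat, rmorphXn, rmorphM, rmorphN, rmorphB, rmorphD). Qed.
Lemma rmorph_deg5_d7 s1 s2 s3 : phi (deg5_d7 s1 s2 s3) = deg5_d7 (phi s1) (phi s2) (phi s3).
Proof. by rewrite /deg5_d7 !(rmorph_nat, rmorphXn, rmorphM, rmorphN, rmorphB, rmorphD). Qed.
Lemma rmorph_deg5_th r1 r2 r3 : phi (deg5_th r1 r2 r3) = deg5_th (phi r1) (phi r2) (phi r3).
Proof. by rewrite /deg5_th /deg5_tn /cyc !(rmorph_nat, rmorphXn, rmorphM, rmorphN, rmorphB, rmorphD). Qed.
End MorphismForms5.

Section TranslateForms5.
Variable R : comNzRingType.
Variables r1 r2 r3 : R.
Let s1 := r1 + r2 + r3.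
Let s2 := r1 * r2 + r1 * r3 + r2 * r3.
Let s3 := r1 * r2 * r3.
Let u1 := (r1 - r3) + (r2 - r3) - r3.
Let u2 := (r1 - r3) * (r2 - r3) + (r1 - r3) * - r3 + (r2 - r3) * - r3.
Let u3 := (r1 - r3) * (r2 - r3) * - r3.

Lemma deg5_P_translate : deg5_P u1 u2 u3 = deg5_P s1 s2 s3.
Proof. by rewrite /deg5_P /u1 /u2 /u3 /s1 /s2 /s3; ring. Qed.
Lemma deg5_I_translate : deg5_I u1 u2 u3 = deg5_I s1 s2 s3.
Proof. by rewrite /deg5_I /u1 /u2 /u3 /s1 /s2 /s3; ring. Qed.
Lemma deg5_I4_translate : deg5_I4 u1 u2 u3 = deg5_I4 s1 s2 s3.
Proof. by rewrite /deg5_I4 /u1 /u2 /u3 /s1 /s2 /s3; ring. Qed.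
Lemma deg5_d5_translate : deg5_d5 u1 u2 u3 = deg5_d5 s1 s2 s3.
Proof. by rewrite /deg5_d5 /u1 /u2 /u3 /s1 /s2 /s3; ring. Qed.
Lemma deg5_n5_translate : deg5_n5 u1 u2 u3 = deg5_n5 s1 s2 s3 - r3 * deg5_d5 s1 s2 s3.
Proof. by rewrite /deg5_n5 /deg5_d5 /u1 /u2 /u3 /s1 /s2 /s3; ring. Qed.
Lemma deg5_d7_translate : deg5_d7 u1 u2 u3 = deg5_d7 s1 s2 s3.
Proof. by rewrite /deg5_d7 /u1 /u2 /u3 /s1 /s2 /s3; ring. Qed.
Lemma deg5_n7_translate : deg5_n7 u1 u2 u3 = deg5_n7 s1 s2 s3 - r3 * deg5_d7 s1 s2 s3.
Proof. by rewrite /deg5_n7 /deg5_d7 /u1 /u2 /u3 /s1 /s2 /s3; ring. Qed.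
Lemma deg5_th_translate : deg5_th (r1 - r3) (r2 - r3) (- r3) = deg5_I4 s1 s2 s3 - deg5_th r1 r2 r3.
Proof. by rewrite /deg5_I4 /deg5_th /deg5_tn /cyc /s1 /s2 /s3; ring. Qed.
End TranslateForms5.

Section ScaleForms5.
Variable R : comNzRingType.
Variables k s1 s2 s3 r1 r2 r3 : R.
(** The exponents of [k] are the weights of the forms; both quotients [n / d] get weight one, like
    the coordinate. *)
Lemma deg5_P_scale : deg5_P (k * s1) (k ^+ 2 * s2) (k ^+ 3 * s3) = k ^+ 2 * deg5_P s1 s2 s3.
Proof. by rewrite /deg5_P; ring. Qed.
Lemma deg5_I_scale : deg5_I (k * s1) (k ^+ 2 * s2) (k ^+ 3 * s3) = k ^+ 4 * deg5_I s1 s2 s3.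
Proof. by rewrite /deg5_I; ring. Qed.
Lemma deg5_I4_scale : deg5_I4 (k * s1) (k ^+ 2 * s2) (k ^+ 3 * s3) = k ^+ 6 * deg5_I4 s1 s2 s3.
Proof. by rewrite /deg5_I4; ring. Qed.
Lemma deg5_n5_scale : deg5_n5 (k * s1) (k ^+ 2 * s2) (k ^+ 3 * s3) = k ^+ 8 * deg5_n5 s1 s2 s3.
Proof. by rewrite /deg5_n5; ring. Qed.
Lemma deg5_d5_scale : deg5_d5 (k * s1) (k ^+ 2 * s2) (k ^+ 3 * s3) = k ^+ 7 * deg5_d5 s1 s2 s3.
Proof. by rewrite /deg5_d5; ring. Qed.
Lemma deg5_n7_scale : deg5_n7 (k * s1) (k ^+ 2 * s2) (k ^+ 3 * s3) = k ^+ 11 * deg5_n7 s1 s2 s3.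
Proof. by rewrite /deg5_n7; ring. Qed.
Lemma deg5_d7_scale : deg5_d7 (k * s1) (k ^+ 2 * s2) (k ^+ 3 * s3) = k ^+ 10 * deg5_d7 s1 s2 s3.
Proof. by rewrite /deg5_d7; ring. Qed.
Lemma deg5_th_scale : deg5_th (k * r1) (k * r2) (k * r3) = k ^+ 6 * deg5_th r1 r2 r3.
Proof. by rewrite /deg5_th /deg5_tn /cyc; ring. Qed.
Lemma deg5_th_swap12 : deg5_th r2 r1 r3 =
  deg5_I4 (r1 + r2 + r3) (r1 * r2 + r1 * r3 + r2 * r3) (r1 * r2 * r3) - deg5_th r1 r2 r3.
Proof. by rewrite /deg5_th /deg5_tn /deg5_I4 /cyc; ring. Qed.
Lemma deg5_th_swap23 : deg5_th r1 r3 r2 =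
  deg5_I4 (r1 + r2 + r3) (r1 * r2 + r1 * r3 + r2 * r3) (r1 * r2 * r3) - deg5_th r1 r2 r3.
Proof. by rewrite /deg5_th /deg5_tn /deg5_I4 /cyc; ring. Qed.
End ScaleForms5.

Section InvertForms5.
Variable R : fieldType.
Variables s1 s2 s3 r1 r2 r3 : R.
Hypotheses (r10 : r1 != 0) (r20 : r2 != 0) (r30 : r3 != 0) (s30 : s3 != 0).
Lemma deg5_P_invert : deg5_P (s2 / s3) (s1 / s3) s3^-1 = deg5_P' s1 s2 s3 / s3 ^+ 2.
Proof. by rewrite /deg5_P /deg5_P'; field. Qed.
Lemma deg5_I_invert : deg5_I (s2 / s3) (s1 / s3) s3^-1 = deg5_I' s1 s2 s3 / s3 ^+ 2.
Proof. by rewrite /deg5_I /deg5_I'; field. Qed.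
Lemma deg5_I4_invert : deg5_I4 (s2 / s3) (s1 / s3) s3^-1 = deg5_I4 s1 s2 s3 / s3 ^+ 4.
Proof. by rewrite /deg5_I4; field. Qed.
Lemma deg5_n5_invert : deg5_n5 (s2 / s3) (s1 / s3) s3^-1 = deg5_d5 s1 s2 s3 / s3 ^+ 5.
Proof. by rewrite /deg5_n5 /deg5_d5; field. Qed.
Lemma deg5_d5_invert : deg5_d5 (s2 / s3) (s1 / s3) s3^-1 = deg5_n5 s1 s2 s3 / s3 ^+ 5.
Proof. by rewrite /deg5_n5 /deg5_d5; field. Qed.
Lemma deg5_n7_invert : deg5_n7 (s2 / s3) (s1 / s3) s3^-1 = - deg5_d7 s1 s2 s3 / s3 ^+ 7.
Proof. by rewrite /deg5_n7 /deg5_d7; field. Qed.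
Lemma deg5_d7_invert : deg5_d7 (s2 / s3) (s1 / s3) s3^-1 = - deg5_n7 s1 s2 s3 / s3 ^+ 7.
Proof. by rewrite /deg5_n7 /deg5_d7; field. Qed.
Lemma deg5_th_invert : deg5_th r1^-1 r2^-1 r3^-1 =
  (deg5_I4 (r1 + r2 + r3) (r1 * r2 + r1 * r3 + r2 * r3) (r1 * r2 * r3) - deg5_th r1 r2 r3) /
  (r1 * r2 * r3) ^+ 4.
Proof. by rewrite /deg5_I4 /deg5_th /deg5_tn /cyc; field; rewrite r10 r20 r30. Qed.
End InvertForms5.

Section Coordinate5.
Variable R : fieldType.
Variables s1 s2 s3 : R.
Let P := deg5_P s1 s2 s3.
Let I := deg5_I s1 s2 s3.
Let P' := deg5_P' s1 s2 s3.
Let I' := deg5_I' s1 s2 s3.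
Let I4 := deg5_I4 s1 s2 s3.
Let J := deg5_J s1 s2 s3.

(* [g = P * I / I4] is fixed by the substitutions fixing [x5]; its five conjugates are the roots
   of a quintic over [K(j)] that is linear in [v]. *)
Definition deg5_v (g j : R) :=
  (g ^+ 5 + 8 * g ^+ 4 + (38 - 50 * j) * g ^+ 3 + (-135 + 26 * j + 625 * j ^+ 2) * g
   - (784 - 4192 * j + 5520 * j ^+ 2)) / (g ^+ 2 + 3 * g + 9 - 27 * j).

Lemma rmorph_deg5_v (phi : {rmorphism R -> R}) g j : phi (deg5_v g j) = deg5_v (phi g) (phi j).
Proof.
by rewrite /deg5_v fmorph_div !(rmorph_nat, rmorphXn, rmorphM, rmorphN, rmorphB, rmorphD).
Qed.

Let N (h : R) := h ^+ 5 + 8 * h ^+ 4 * I4 + (38 * I4 ^+ 2 - 50 * J) * h ^+ 3 +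
  (-135 * I4 ^+ 4 + 26 * J * I4 ^+ 2 + 625 * J ^+ 2) * h -
  (784 * I4 ^+ 5 - 4192 * J * I4 ^+ 3 + 5520 * J ^+ 2 * I4).

Hypotheses (I40 : I4 != 0) (I0 : I != 0) (I'0 : I' != 0) (s30 : s3 != 0).

Lemma deg5_Qv : (P * I / I4) ^+ 2 + 3 * (P * I / I4) + 9 - 27 * (J / I4 ^+ 2) = I ^+ 3 / I4 ^+ 2.
Proof.
have -> : I ^+ 3 = (P * I) ^+ 2 + 3 * (P * I) * I4 + 9 * I4 ^+ 2 - 27 * J.
  by rewrite /I /P /I4 /J /deg5_I /deg5_P /deg5_I4 /deg5_J; ring.
by field.
Qed.

Let Qv' : (P' * I' / I4) ^+ 2 + 3 * (P' * I' / I4) + 9 - 27 * (J / I4 ^+ 2) = s3 ^+ 2 * I' ^+ 3 / I4 ^+ 2.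
Proof.
have -> : s3 ^+ 2 * I' ^+ 3 = (P' * I') ^+ 2 + 3 * (P' * I') * I4 + 9 * I4 ^+ 2 - 27 * J.
  by rewrite /I' /P' /I4 /J /deg5_I' /deg5_P' /deg5_I4 /deg5_J; ring.
by field.
Qed.

(** Among the adjacent transpositions only (45) moves [x5], hence [g]: it turns [P * I / I4] into
    [P' * I' / I4]. The denominators of [deg5_v] being known, one polynomial identity remains. *)
Lemma deg5_v_invert : deg5_v (P * I / I4) (J / I4 ^+ 2) = deg5_v (P' * I' / I4) (J / I4 ^+ 2).
Proof.
have NI : N (P * I) * (s3 ^+ 2 * I' ^+ 3) = N (P' * I') * I ^+ 3.
  rewrite /N /I /P /I' /P' /I4 /J /deg5_I /deg5_P /deg5_I' /deg5_P' /deg5_I4 /deg5_J; ring.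
have vE h G : G != 0 -> (h / I4) ^+ 2 + 3 * (h / I4) + 9 - 27 * (J / I4 ^+ 2) = G / I4 ^+ 2 ->
    deg5_v (h / I4) (J / I4 ^+ 2) = N h / (I4 ^+ 3 * G).
  by move=> G0; rewrite /deg5_v /N => ->; field; rewrite I40 G0.
rewrite (vE _ (I ^+ 3)) ?deg5_Qv ?expf_neq0 // (vE _ (s3 ^+ 2 * I' ^+ 3)) ?Qv' ?mulf_neq0 ?expf_neq0 //.
by apply/eqP; rewrite eqr_div ?mulf_neq0 ?expf_neq0 // mulrCA NI mulrCA.
Qed.

End Coordinate5.

(** * Odd substitutions in the coordinate that sends [x4], [x5] to zero and infinity *)

Section Action5.
Variables (E : fieldType) (A x1 x2 x3 x4 x5 : E).
Hypotheses (A0 : A != 0) (x10 : x1 != 0) (x20 : x2 != 0) (x30 : x3 != 0) (x40 : x4 != 0) (x50 : x5 != 0).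
Hypotheses (x15 : x1 - x5 != 0) (x25 : x2 - x5 != 0) (x35 : x3 - x5 != 0) (x45 : x4 - x5 != 0).
Hypotheses (x14 : x1 - x4 != 0) (x24 : x2 - x4 != 0) (x34 : x3 - x4 != 0).

Let r1 := (x1 - x4) / (x1 - x5).
Let r2 := (x2 - x4) / (x2 - x5).
Let r3 := (x3 - x4) / (x3 - x5).

(** The inverse of [x -> (x - x4) / (x - x5)]: the point whose coordinate is [b]. *)
Definition deg5_B b := (x4 - b * x5) / (1 - b).

Definition deg5_flip (phi : E -> E) :=
  [\/ [/\ phi x1 = A / x2, phi x2 = A / x1, phi x3 = A / x3, phi x4 = A / x4 & phi x5 = A / x5],
      [/\ phi x1 = A / x1, phi x2 = A / x3, phi x3 = A / x2, phi x4 = A / x4 & phi x5 = A / x5],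
      [/\ phi x1 = A / x1, phi x2 = A / x2, phi x3 = A / x4, phi x4 = A / x3 & phi x5 = A / x5]
    | [/\ phi x1 = A / x1, phi x2 = A / x2, phi x3 = A / x3, phi x4 = A / x5 & phi x5 = A / x4]].

Variable phi : {rmorphism E -> E}.
Hypotheses (phiX : deg5_flip phi).

Let Bmove (f : E -> E) := forall b, b != 0 -> phi b = f b -> phi (deg5_B b) = A / deg5_B b.

(** [c b] is the factor common to numerator and denominator of the image of the point; it
    cancels. *)
Let BmoveP (f : E -> E) (c : E -> E) : (forall b, b != 0 -> c b != 0) ->
  (forall b, b != 0 -> phi x4 - f b * phi x5 = c b * (A * (1 - b))) ->
  (forall b, b != 0 -> 1 - f b = c b * (x4 - b * x5)) -> Bmove f.
Proof.
move=> c0 Hn Hd b b0 fb; rewrite /deg5_B fmorph_div [phi (_ - _)]rmorphB [phi (b * _)]rmorphM fb Hn //.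
rewrite [phi (1 - b)]rmorphB rmorph1 fb Hd // -mulf_div divff ?c0 // mul1r.
by rewrite [in RHS]invf_div mulrA.
Qed.

Lemma deg5_r_action : exists k, k != 0 /\
  [\/ [/\ phi r1 = k * r2, phi r2 = k * r1, phi r3 = k * r3 & Bmove (fun b => k * b)],
      [/\ phi r1 = k * r1, phi r2 = k * r3, phi r3 = k * r2 & Bmove (fun b => k * b)],
      [/\ phi r1 = k * (r1 - r3), phi r2 = k * (r2 - r3), phi r3 = k * - r3 &
          Bmove (fun b => k * (b - r3))]
    | [/\ phi r1 = k * r1^-1, phi r2 = k * r2^-1, phi r3 = k * r3^-1 & Bmove (fun b => k * b^-1)]].
Proof.
have opp x y : x - y != 0 -> y - x != 0 by move=> h; rewrite -opprB oppr_eq0.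
have [x51 x52 x53 x54] : [/\ x5 - x1 != 0, x5 - x2 != 0, x5 - x3 != 0 & x5 - x4 != 0] by split; exact: opp.
have [x41 x42 x43] : [/\ x4 - x1 != 0, x4 - x2 != 0 & x4 - x3 != 0] by split; exact: opp.
(* The factor [w / v] does not depend on [u], so inverting all points rescales the coordinate. *)
have swap u v w : u != 0 -> v != 0 -> w != 0 -> u - w != 0 -> w - u != 0 ->
    (A / u - A / v) / (A / u - A / w) = w / v * ((u - v) / (u - w)).
  move=> u0 v0 w0 uw wu; field.
  by rewrite u0 v0 w0 uw (_ : _ + _ = A * (w - u)) ?mulf_neq0 //; ring.
have phir x : phi ((x - x4) / (x - x5)) = (phi x - phi x4) / (phi x - phi x5).
  by rewrite fmorph_div !rmorphB.
have B12 : phi x4 = A / x4 -> phi x5 = A / x5 -> Bmove (fun b => x5 / x4 * b).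
  move=> p4 p5; apply: (BmoveP (c := fun=> x4^-1)) => b _; first by rewrite invr_neq0.
    by rewrite p4 p5; field; rewrite x40 x50.
  by field; rewrite x40.
rewrite /r1 /r2 /r3; case: phiX => -[p1 p2 p3 p4 p5].
- exists (x5 / x4); split; first by rewrite mulf_neq0 ?invr_eq0.
  by constructor 1; split; [..|exact: B12]; rewrite phir ?p1 ?p2 ?p3 p4 p5 swap.
- exists (x5 / x4); split; first by rewrite mulf_neq0 ?invr_eq0.
  by constructor 2; split; [..|exact: B12]; rewrite phir ?p1 ?p2 ?p3 p4 p5 swap.
- exists (x5 / x3 * ((x3 - x5) / (x4 - x5))); split; first by rewrite !mulf_neq0 ?invr_eq0.
  constructor 3; split.
  + by rewrite phir p1 p4 p5 swap //; field; rewrite x30 x45 x35 x15.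
  + by rewrite phir p2 p4 p5 swap //; field; rewrite x30 x45 x35 x25.
  + by rewrite phir p3 p4 p5 swap //; field; rewrite x30 x45 x35.
  + apply: (BmoveP (c := fun=> x3^-1 * ((x3 - x5) / (x4 - x5)))) => b _.
    * by rewrite !mulf_neq0 ?invr_eq0.
    * by rewrite p4 p5; field; rewrite x30 x50 x45 x35.
    * by field; rewrite x30 x45 x35.
- exists (x4 / x5); split; first by rewrite mulf_neq0 ?invr_eq0.
  constructor 4; split; try by rewrite phir ?p1 ?p2 ?p3 p4 p5 swap // invf_div.
  apply: (BmoveP (c := fun b => - (x5 * b)^-1)) => b b0.
  + by rewrite oppr_eq0 invr_eq0 mulf_neq0.
  + by rewrite p4 p5; field; rewrite b0 x40 x50.
  + by field; rewrite b0 x50.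
Qed.

Let s1 := r1 + r2 + r3.
Let s2 := r1 * r2 + r1 * r3 + r2 * r3.
Let s3 := r1 * r2 * r3.
Let P := deg5_P s1 s2 s3.
Let I := deg5_I s1 s2 s3.
Let I4 := deg5_I4 s1 s2 s3.
Let J := deg5_J s1 s2 s3.
Let n5 := deg5_n5 s1 s2 s3.
Let d5 := deg5_d5 s1 s2 s3.
Let n7 := deg5_n7 s1 s2 s3.
Let d7 := deg5_d7 s1 s2 s3.
Let th := deg5_th r1 r2 r3 / I4.
Hypotheses (I0 : I != 0) (I40 : I4 != 0) (n50 : n5 != 0) (d50 : d5 != 0) (n70 : n7 != 0) (d70 : d7 != 0).

Lemma deg5_thE : th * (1 - th) = J / I4 ^+ 2.
Proof. by rewrite /J -(deg5_thJ r1 r2 r3) -/s1 -/s2 -/s3 -/I4 /th; field. Qed.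

Lemma deg5_action : [/\ phi th = 1 - th,
  phi (deg5_v (P * I / I4) (J / I4 ^+ 2)) = deg5_v (P * I / I4) (J / I4 ^+ 2),
  phi (deg5_B (n5 / d5)) = A / deg5_B (n5 / d5) & phi (deg5_B (n7 / d7)) = A / deg5_B (n7 / d7)].
Proof.
have r10 : r1 != 0 by rewrite mulf_neq0 ?invr_eq0.
have r20 : r2 != 0 by rewrite mulf_neq0 ?invr_eq0.
have r30 : r3 != 0 by rewrite mulf_neq0 ?invr_eq0.
have s30 : s3 != 0 := mulf_neq0 (mulf_neq0 r10 r20) r30.
have ps1 : phi s1 = phi r1 + phi r2 + phi r3 by rewrite /s1 [LHS]rmorphD [phi (r1 + r2)]rmorphD.
have ps2 : phi s2 = phi r1 * phi r2 + phi r1 * phi r3 + phi r2 * phi r3.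
  by rewrite /s2 [LHS]rmorphD [phi (_ + _)]rmorphD [phi (r1 * r2)]rmorphM [phi (r1 * r3)]rmorphM [phi (r2 * r3)]rmorphM.
have ps3 : phi s3 = phi r1 * phi r2 * phi r3 by rewrite /s3 [LHS]rmorphM [phi (r1 * r2)]rmorphM.
have pth : phi (deg5_th r1 r2 r3) = deg5_th (phi r1) (phi r2) (phi r3).
  exact: rmorph_deg5_th.
have pv g j : phi (deg5_v g j) = deg5_v (phi g) (phi j) by exact: rmorph_deg5_v.
have pj : phi th = 1 - th -> phi (J / I4 ^+ 2) = J / I4 ^+ 2.
  move=> pth'; rewrite -deg5_thE [LHS]rmorphM [phi (1 - _)]rmorphB rmorph1 pth'; ring.
have pQ5 : phi (n5 / d5) = phi n5 / phi d5 by exact: fmorph_div.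
have pQ7 : phi (n7 / d7) = phi n7 / phi d7 by exact: fmorph_div.
have pth' : phi th = phi (deg5_th r1 r2 r3) / phi I4 by exact: fmorph_div.
have pg : phi (P * I / I4) = phi P * phi I / phi I4 by rewrite [LHS]fmorph_div [phi (P * I)]rmorphM.
have [k [k0 act]] := deg5_r_action.
have b50 : n5 / d5 != 0 by rewrite mulf_neq0 ?invr_eq0.
have b70 : n7 / d7 != 0 by rewrite mulf_neq0 ?invr_eq0.
(* Common end of the cases (12) and (23), where the symmetric functions of the [r_i] are only
   rescaled. *)
have main_sym : phi s1 = k * s1 -> phi s2 = k ^+ 2 * s2 -> phi s3 = k ^+ 3 * s3 ->
    phi (deg5_th r1 r2 r3) = k ^+ 6 * (I4 - deg5_th r1 r2 r3) -> Bmove (fun b => k * b) ->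
  [/\ phi th = 1 - th,
  phi (deg5_v (P * I / I4) (J / I4 ^+ 2)) = deg5_v (P * I / I4) (J / I4 ^+ 2),
  phi (deg5_B (n5 / d5)) = A / deg5_B (n5 / d5) & phi (deg5_B (n7 / d7)) = A / deg5_B (n7 / d7)].
  move=> p1 p2 p3 pt Bm.
  have pI4 : phi I4 = k ^+ 6 * I4 by rewrite /I4 rmorph_deg5_I4 p1 p2 p3 deg5_I4_scale.
  have pI : phi I = k ^+ 4 * I by rewrite /I rmorph_deg5_I p1 p2 p3 deg5_I_scale.
  have pP : phi P = k ^+ 2 * P by rewrite /P rmorph_deg5_P p1 p2 p3 deg5_P_scale.
  have pn5 : phi n5 = k ^+ 8 * n5 by rewrite /n5 rmorph_deg5_n5 p1 p2 p3 deg5_n5_scale.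
  have pd5 : phi d5 = k ^+ 7 * d5 by rewrite /d5 rmorph_deg5_d5 p1 p2 p3 deg5_d5_scale.
  have pn7 : phi n7 = k ^+ 11 * n7 by rewrite /n7 rmorph_deg5_n7 p1 p2 p3 deg5_n7_scale.
  have pd7 : phi d7 = k ^+ 10 * d7 by rewrite /d7 rmorph_deg5_d7 p1 p2 p3 deg5_d7_scale.
  have pt1 : phi th = 1 - th by rewrite pth' pt pI4 /th; field; rewrite k0 I40.
  split=> //.
  - rewrite pv pj // pg pP pI pI4; congr (deg5_v _ _); by field; rewrite k0 I40.
  - by apply: (Bm _ b50); rewrite pQ5 pn5 pd5; field; rewrite k0 d50.
  - by apply: (Bm _ b70); rewrite pQ7 pn7 pd7; field; rewrite k0 d70.
case: act => -[p1 p2 p3 Bm].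
- apply: main_sym => //; rewrite ?ps1 ?ps2 ?ps3 ?pth p1 p2 p3 /s1 /s2 /s3; try ring.
  by rewrite deg5_th_scale deg5_th_swap12.
- apply: main_sym => //; rewrite ?ps1 ?ps2 ?ps3 ?pth p1 p2 p3 /s1 /s2 /s3; try ring.
  by rewrite deg5_th_scale deg5_th_swap23.
- have {ps1} ps1 : phi s1 = k * (r1 - r3 + (r2 - r3) - r3) by rewrite ps1 p1 p2 p3; ring.
  have {ps2} ps2 : phi s2 = k ^+ 2 * ((r1 - r3) * (r2 - r3) + (r1 - r3) * - r3 + (r2 - r3) * - r3).
    by rewrite ps2 p1 p2 p3; ring.
  have {ps3} ps3 : phi s3 = k ^+ 3 * ((r1 - r3) * (r2 - r3) * - r3) by rewrite ps3 p1 p2 p3; ring.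
  have pI4 : phi I4 = k ^+ 6 * I4 by rewrite /I4 rmorph_deg5_I4 ps1 ps2 ps3 deg5_I4_scale deg5_I4_translate.
  have pI : phi I = k ^+ 4 * I by rewrite /I rmorph_deg5_I ps1 ps2 ps3 deg5_I_scale deg5_I_translate.
  have pP : phi P = k ^+ 2 * P by rewrite /P rmorph_deg5_P ps1 ps2 ps3 deg5_P_scale deg5_P_translate.
  have pn5 : phi n5 = k ^+ 8 * (n5 - r3 * d5) by rewrite /n5 rmorph_deg5_n5 ps1 ps2 ps3 deg5_n5_scale deg5_n5_translate.
  have pd5 : phi d5 = k ^+ 7 * d5 by rewrite /d5 rmorph_deg5_d5 ps1 ps2 ps3 deg5_d5_scale deg5_d5_translate.
  have pn7 : phi n7 = k ^+ 11 * (n7 - r3 * d7) by rewrite /n7 rmorph_deg5_n7 ps1 ps2 ps3 deg5_n7_scale deg5_n7_translate.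
  have pd7 : phi d7 = k ^+ 10 * d7 by rewrite /d7 rmorph_deg5_d7 ps1 ps2 ps3 deg5_d7_scale deg5_d7_translate.
  have pt : phi (deg5_th r1 r2 r3) = k ^+ 6 * (I4 - deg5_th r1 r2 r3).
    by rewrite pth p1 p2 p3 deg5_th_scale deg5_th_translate.
  have pt1 : phi th = 1 - th by rewrite pth' pt pI4 /th; field; rewrite k0 I40.
  split=> //.
  - rewrite pv pj // pg pP pI pI4; congr (deg5_v _ _); by field; rewrite k0 I40.
  - by apply: (Bm _ b50); rewrite pQ5 pn5 pd5; field; rewrite k0 d50.
  - by apply: (Bm _ b70); rewrite pQ7 pn7 pd7; field; rewrite k0 d70.
- have {ps1} ps1 : phi s1 = k * (s2 / s3).
    by rewrite ps1 p1 p2 p3 /s2 /s3; field; rewrite r10 r20 r30.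
  have {ps2} ps2 : phi s2 = k ^+ 2 * (s1 / s3).
    by rewrite ps2 p1 p2 p3 /s1 /s3; field; rewrite r10 r20 r30.
  have {ps3} ps3 : phi s3 = k ^+ 3 * s3^-1 by rewrite ps3 p1 p2 p3 /s3; field; rewrite r10 r20 r30.
  pose P' := deg5_P' s1 s2 s3; pose I' := deg5_I' s1 s2 s3.
  have pI4 : phi I4 = k ^+ 6 * (I4 / s3 ^+ 4).
    by rewrite /I4 rmorph_deg5_I4 ps1 ps2 ps3 deg5_I4_scale deg5_I4_invert.
  have pI : phi I = k ^+ 4 * (I' / s3 ^+ 2).
    by rewrite /I rmorph_deg5_I ps1 ps2 ps3 deg5_I_scale deg5_I_invert.
  have pP : phi P = k ^+ 2 * (P' / s3 ^+ 2).
    by rewrite /P rmorph_deg5_P ps1 ps2 ps3 deg5_P_scale deg5_P_invert.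
  have pn5 : phi n5 = k ^+ 8 * (d5 / s3 ^+ 5).
    by rewrite /n5 rmorph_deg5_n5 ps1 ps2 ps3 deg5_n5_scale deg5_n5_invert.
  have pd5 : phi d5 = k ^+ 7 * (n5 / s3 ^+ 5).
    by rewrite /d5 rmorph_deg5_d5 ps1 ps2 ps3 deg5_d5_scale deg5_d5_invert.
  have pn7 : phi n7 = k ^+ 11 * (- d7 / s3 ^+ 7).
    by rewrite /n7 rmorph_deg5_n7 ps1 ps2 ps3 deg5_n7_scale deg5_n7_invert.
  have pd7 : phi d7 = k ^+ 10 * (- n7 / s3 ^+ 7).
    by rewrite /d7 rmorph_deg5_d7 ps1 ps2 ps3 deg5_d7_scale deg5_d7_invert.
  have pt : phi (deg5_th r1 r2 r3) = k ^+ 6 * ((I4 - deg5_th r1 r2 r3) / s3 ^+ 4).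
    by rewrite pth p1 p2 p3 deg5_th_scale deg5_th_invert.
  have I'0 : I' != 0.
    have : phi I != 0 by rewrite fmorph_eq0.
    by apply: contraNneq => I'0; rewrite pI I'0 mul0r mulr0.
  have pt1 : phi th = 1 - th by rewrite pth' pt pI4 /th; field; rewrite k0 I40 s30.
  split=> //.
  - rewrite pv pj // pg pP pI pI4 deg5_v_invert //; congr (deg5_v _ _).
    by rewrite -/P' -/I' -/I4; field; rewrite k0 I40 s30.
  - by apply: (Bm _ b50); rewrite pQ5 pn5 pd5; field; rewrite k0 d50 n50 s30.
  - by apply: (Bm _ b70); rewrite pQ7 pn7 pd7; field; rewrite oppr_eq0 k0 d70 n70 s30.
Qed.

End Action5.

(** Roots are split off one by one: [f1, f2, f3] and then [h1, h2] are the symmetric functions of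
    the remaining roots, and the last root is rational. *)
Lemma quartic_tower (E : fieldType) (L M : E -> Prop) N (t1 t2 t3 t4 : E) : subfield L ->
    extension L N M ->
    M (t1 + t2 + t3 + t4) -> M (t1 * t2 + t1 * t3 + t2 * t3 + (t1 + t2 + t3) * t4) ->
    M (t1 * t2 * t3 + (t1 * t2 + t1 * t3 + t2 * t3) * t4) -> M (t1 * t2 * t3 * t4) ->
  exists M', [/\ extension L (N * 4 * 3 * 2) M', forall z, M z -> M' z, M' t1, M' t2 & M' t3 /\ M' t4].
Proof.
move=> fL eM; have fM := extension_subfield eM.
set e1 := t1 + t2 + t3 + t4; set e2 := _ + (t1 + t2 + t3) * t4; set e3 := _ + _ * t4.
set e4 := t1 * t2 * t3 * t4 => m1 m2 m3 m4.
have eM1 : extension L (N * 4) (gen (add1 M t4)).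
  apply: (extension_power fL eM (s := [:: - e4; e3; - e2; e1])).
    by case=> [|[|[|[|i]]]] /=; rewrite ?nth_nil; in_subfield fM.
  by rewrite horner_Poly /= /e1 /e2 /e3 /e4; ring.
have fM1 := extension_subfield eM1; set M1 := gen _ in eM1 fM1.
have sub1 z : M z -> M1 z by move=> Mz; apply: gen_in; left.
have M1t : M1 t4 by apply: gen_in; right.
pose f1 := e1 - t4; pose f2 := e2 - t4 * f1; pose f3 := e3 - t4 * f2.
have n1 : M1 f1 by apply: subfieldB => //; apply: sub1.
have n2 : M1 f2 by apply: subfieldB => //; [apply: sub1 | apply: subfieldM].
have n3 : M1 f3 by apply: subfieldB => //; [apply: sub1 | apply: subfieldM].
have eM2 : extension L (N * 4 * 3) (gen (add1 M1 t1)).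
  apply: (extension_power fL eM1 (s := [:: f3; - f2; f1])).
    by case=> [|[|[|i]]] /=; rewrite ?nth_nil; in_subfield fM1.
  by rewrite horner_Poly /= /f3 /f2 /f1 /e1 /e2 /e3; ring.
have fM2 := extension_subfield eM2; set M2 := gen _ in eM2 fM2.
have sub2 z : M1 z -> M2 z by move=> Mz; apply: gen_in; left.
have M2t : M2 t1 by apply: gen_in; right.
pose h1 := f1 - t1; pose h2 := f2 - t1 * h1.
have k1 : M2 h1 by apply: subfieldB => //; apply: sub2.
have k2 : M2 h2 by apply: subfieldB => //; [apply: sub2 | apply: subfieldM].
have eM3 : extension L (N * 4 * 3 * 2) (gen (add1 M2 t2)).
  apply: (extension_power fL eM2 (s := [:: - h2; h1])).
    by case=> [|[|i]] /=; rewrite ?nth_nil; in_subfield fM2.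
  by rewrite horner_Poly /= /h2 /h1 /f2 /f1 /e1 /e2; ring.
have fM3 := extension_subfield eM3; set M3 := gen _ in eM3 fM3.
have sub3 z : M2 z -> M3 z by move=> Mz; apply: gen_in; left.
have M3t : M3 t2 by apply: gen_in; right.
exists M3; split=> //.
- by move=> z Mz; apply/sub3/sub2/sub1.
- exact: sub3.
split; last by apply/sub3/sub2.
rewrite (_ : t3 = h1 - t2); first by apply: subfieldB => //; apply: sub3.
by rewrite /h1 /f1 /e1; ring.
Qed.

(** * From the invariants of five points to their coordinate, up to scale *)

Section Cross5.
Variables (E : fieldType) (r1 r2 r3 : E).
Let s1 := r1 + r2 + r3.
Let s2 := r1 * r2 + r1 * r3 + r2 * r3.
Let s3 := r1 * r2 * r3.
Let P := deg5_P s1 s2 s3.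
Let I := deg5_I s1 s2 s3.
Let I4 := deg5_I4 s1 s2 s3.
Let J := deg5_J s1 s2 s3.
(** [P] and [Q] are the leading coefficients of the Hessian and of the sextic covariant of the
    quartic with roots [r1, r2, r3, 0]. The coordinate [(P * r + N) / Q] is unchanged when the [r_i]
    are scaled or translated, so the symmetric functions of the [t_i] depend on [g] and [j]
    alone. *)
Definition deg5_N s1 s2 s3 : E := - s1 * s2 + 6 * s3.
Definition deg5_Q s1 s2 s3 : E := - s1 ^+ 3 + 4 * s1 * s2 - 8 * s3.
Let N := deg5_N s1 s2 s3.
Let Q := deg5_Q s1 s2 s3.
Hypotheses (I0 : I != 0) (I40 : I4 != 0) (Q0 : Q != 0).
Let g := P * I / I4.
Let j := J / I4 ^+ 2.
Let v := deg5_v g j.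
Let t1 := (P * r1 + N) / Q.
Let t2 := (P * r2 + N) / Q.
Let t3 := (P * r3 + N) / Q.
Let t4 := N / Q.
Let f1 := t1 + t2 + t3.
Let f2 := t1 * t2 + t1 * t3 + t2 * t3.
Let f3 := t1 * t2 * t3.
Let W := 3 * g ^+ 3 + 16 * g ^+ 2 + 48 * g + 64 - 192 * j - 80 * g * j.
Let C := 5 * g ^+ 3 + 27 * g ^+ 2 + 81 * g + 108 - 324 * j - 135 * g * j.
Let F := 3 * g ^+ 6 + 31 * g ^+ 5 - 156 * g ^+ 4 * j + 174 * g ^+ 4 - 1179 * g ^+ 3 * j + 609 * g ^+ 3
  + 2025 * g ^+ 2 * j ^+ 2 - 4374 * g ^+ 2 * j + 1377 * g ^+ 2 + 9720 * g * j ^+ 2 - 9072 * g * j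
  + 1944 * g + 11664 * j ^+ 2 - 7776 * j + 1296.
Let prod := P ^+ 3 * s3 + P ^+ 2 * N * s2 + P * N ^+ 2 * s1 + N ^+ 3.
Let prs := P ^+ 2 * s2 + 2 * P * N * s1 + 3 * N ^+ 2.
Let cn := - (prod + N * prs).

Let WE : W * I4 ^+ 3 = Q ^+ 2 * I ^+ 3.
Proof.
have -> : W * I4 ^+ 3 = 3 * (P * I) ^+ 3 + 16 * (P * I) ^+ 2 * I4 + 48 * (P * I) * I4 ^+ 2 + 64 * I4 ^+ 3
   - 192 * J * I4 - 80 * (P * I) * J by rewrite /W /g /j; field.
by rewrite /Q /I /P /I4 /J /deg5_Q /deg5_I /deg5_P /deg5_I4 /deg5_J; ring.
Qed.

Let CE : C * I4 ^+ 3 * Q = cn * I ^+ 3.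
Proof.
have -> : C * I4 ^+ 3 = 5 * (P * I) ^+ 3 + 27 * (P * I) ^+ 2 * I4 + 81 * (P * I) * I4 ^+ 2 + 108 * I4 ^+ 3
   - 324 * J * I4 - 135 * (P * I) * J by rewrite /C /g /j; field.
by rewrite /cn /prod /prs /Q /N /I /P /I4 /J /deg5_Q /deg5_N /deg5_I /deg5_P /deg5_I4 /deg5_J; ring.
Qed.

Let FE : F * I4 ^+ 6 = N * prod * I ^+ 6.
Proof.
pose h := P * I.
have -> : F * I4 ^+ 6 = 3 * h ^+ 6 + 31 * h ^+ 5 * I4 - 156 * h ^+ 4 * J + 174 * h ^+ 4 * I4 ^+ 2
  - 1179 * h ^+ 3 * J * I4 + 609 * h ^+ 3 * I4 ^+ 3
  + 2025 * h ^+ 2 * J ^+ 2 - 4374 * h ^+ 2 * J * I4 ^+ 2 + 1377 * h ^+ 2 * I4 ^+ 4 + 9720 * h * J ^+ 2 * I4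
  - 9072 * h * J * I4 ^+ 3 + 1944 * h * I4 ^+ 5 + 11664 * J ^+ 2 * I4 ^+ 2 - 7776 * J * I4 ^+ 4 + 1296 * I4 ^+ 6.
  by rewrite /F /g /j -/h; field.
by rewrite /h /prod /prs /Q /N /I /P /I4 /J /deg5_N /deg5_I /deg5_P /deg5_I4 /deg5_J; ring.
Qed.

Let W0 : W != 0.
Proof.
apply/negP => /eqP W0; have := WE; rewrite W0 mul0r => /esym /eqP; apply/negP.
by rewrite mulf_neq0 ?expf_neq0.
Qed.

Let cE : C / W = cn / Q ^+ 3.
Proof.
apply/eqP; rewrite eqr_div ?expf_neq0 //; apply/eqP/(mulIf (expf_neq0 3 I40)).
rewrite -[cn * W * _]mulrA WE (_ : C * _ * _ = (C * I4 ^+ 3 * Q) * Q ^+ 2); last by ring.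
by rewrite CE; ring.
Qed.

Let eE : F / W ^+ 2 = N * prod / Q ^+ 4.
Proof.
apply/eqP; rewrite eqr_div ?expf_neq0 //; apply/eqP/(mulIf (expf_neq0 6 I40)).
rewrite (_ : N * prod * W ^+ 2 * _ = N * prod * (W * I4 ^+ 3) ^+ 2); last by ring.
rewrite (_ : F * _ * _ = (F * I4 ^+ 6) * Q ^+ 4); last by ring.
by rewrite WE FE; ring.
Qed.

Let sumE : f1 + t4 = - 3.
Proof.
rewrite /f1 /t1 /t2 /t3 /t4.
apply: (mulIf Q0); rewrite (_ : _ * Q = P * s1 + 4 * N); last by rewrite /s1; field.
by rewrite /Q /N /P /deg5_Q /deg5_N /deg5_P; ring.
Qed.

Let pairE : f2 + f1 * t4 = 2 * (C / W).
Proof.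
rewrite cE; apply: (mulIf (expf_neq0 3 Q0)).
rewrite (_ : _ * Q ^+ 3 = (prs + N * (P * s1 + 3 * N)) * Q); last first.
  by rewrite /prs /f1 /f2 /t1 /t2 /t3 /t4 /s1 /s2 /s3; field.
rewrite (_ : _ * Q ^+ 3 = 2 * cn); last by field.
by rewrite /cn /prs /prod /Q /N /P /deg5_Q /deg5_N /deg5_P; ring.
Qed.

Let tripleE : f3 + f2 * t4 = - (C / W).
Proof. by rewrite cE /cn /prod /prs /f3 /f2 /t1 /t2 /t3 /t4 /s1 /s2 /s3; field. Qed.

Let quadE : f3 * t4 = F / W ^+ 2.
Proof. by rewrite eE /prod /f3 /t1 /t2 /t3 /t4 /s1 /s2 /s3; field. Qed.
(** [g] has degree at most 5 over the field of [v] and [j], and the [t_i] contribute [4 * 3 * 2].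
    The differences [t_i - t4] give the coordinate up to the factor [P / Q]. *)
Lemma deg5_extension (L : E -> Prop) : subfield L -> L v -> L j -> exists M,
  [/\ extension L 120 M, forall z, L z -> M z, M (P / Q * r1), M (P / Q * r2) & M (P / Q * r3)].
Proof.
move=> fL Lv Lj.
have D0 : g ^+ 2 + 3 * g + 9 - 27 * j != 0.
  by rewrite deg5_Qv // mulf_neq0 ?invr_eq0 ?expf_neq0.
have eM : extension L 5 (gen (add1 L g)).
  apply: (extension_power fL (extension_refl fL) (s := [:: v * (9 - 27 * j) + (784 - 4192 * j + 5520 * j ^+ 2);
     3 * v - (-135 + 26 * j + 625 * j ^+ 2); v; - (38 - 50 * j); - 8])).
    by case=> [|[|[|[|[|i]]]]] /=; rewrite ?nth_nil; in_subfield fL.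
  rewrite horner_Poly /=; apply/eqP; rewrite -subr_eq0; apply/eqP.
  set d := g ^+ 2 + 3 * g + 9 - 27 * j in D0.
  have vd : v * d = g ^+ 5 + 8 * g ^+ 4 + (38 - 50 * j) * g ^+ 3 +
    (-135 + 26 * j + 625 * j ^+ 2) * g - (784 - 4192 * j + 5520 * j ^+ 2) by exact: divfK.
  apply: etrans (etrans (congr1 (+%R^~ (- (v * d))) (esym vd)) (subrr _)).
  by rewrite /d; ring.
have fM := extension_subfield eM; set M := gen _ in eM fM.
have sub z : L z -> M z by move=> Lz; apply: gen_in; left.
have Mg : M g by apply: gen_in; right.
have Mj : M j by exact: sub.
have MW : M W by rewrite /W; in_subfield fM.
have MC : M C by rewrite /C; in_subfield fM.
have MF : M F by rewrite /F; in_subfield fM.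
have [M' [eM' sub' m1 m2 [m3 m4]]] : exists M', [/\ extension L (5 * 4 * 3 * 2) M', forall z, M z -> M' z,
    M' t1, M' t2 & M' t3 /\ M' t4].
  apply: (quartic_tower fL eM).
  - by rewrite -/f1 sumE; in_subfield fM.
  - by rewrite -/f1 -/f2 pairE; in_subfield fM.
  - by rewrite -/f3 -/f2 tripleE; in_subfield fM.
  - by rewrite -/f3 quadE; in_subfield fM.
have fM' := extension_subfield eM'.
have E1 : P / Q * r1 = t1 - t4 by rewrite /t1 /t4; field.
have E2 : P / Q * r2 = t2 - t4 by rewrite /t2 /t4; field.
have E3 : P / Q * r3 = t3 - t4 by rewrite /t3 /t4; field.
exists M'; split; rewrite ?E1 ?E2 ?E3; try exact: subfieldB.
  exact: eM'.
by move=> z Lz; apply/sub'/sub.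
Qed.

End Cross5.

(** * Nonvanishing of the quintic forms in every characteristic *)

Section Generic5.
Variables (K E : fieldType) (iota : {rmorphism K -> E}) (a : K) (x4 x5 s1 s2 s3 T : E).
Hypothesis a0 : a != 0.
Local Notation A := (iota a).

(** The numerator of [n5 / d5 - n7 / d7]; it keeps the two equivariant points apart. *)
Definition deg5_w := deg5_n5 s1 s2 s3 * deg5_d7 s1 s2 s3 - deg5_n7 s1 s2 s3 * deg5_d5 s1 s2 s3.
(* Up to a factor, the value at [n5 / d5] of the cubic with roots [r1], [r2], [r3]. *)
Definition deg5_chi := deg5_n5 s1 s2 s3 ^+ 3 - s1 * deg5_n5 s1 s2 s3 ^+ 2 * deg5_d5 s1 s2 s3 +
  s2 * deg5_n5 s1 s2 s3 * deg5_d5 s1 s2 s3 ^+ 2 - s3 * deg5_d5 s1 s2 s3 ^+ 3.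
(** The numerator of the sum of five ratios by which the scale of the variables is found, see
    [deg5_cross_sum]. *)
Definition deg5_G :=
  (4 * deg5_n5 s1 s2 s3 * deg5_d7 s1 s2 s3 + deg5_n7 s1 s2 s3 * deg5_d5 s1 s2 s3) * deg5_chi -
  deg5_w * deg5_n5 s1 s2 s3 * (3 * deg5_n5 s1 s2 s3 ^+ 2 -
    2 * s1 * deg5_n5 s1 s2 s3 * deg5_d5 s1 s2 s3 + s2 * deg5_d5 s1 s2 s3 ^+ 2).

Ltac deg5_unfold :=
  rewrite ?/deg5_G ?/deg5_chi ?/deg5_w ?/deg5_n5 ?/deg5_d5 ?/deg5_n7 ?/deg5_d7.

Lemma place_neq0_eq (K' : fieldType) (Sp : E -> K' -> Prop) f k l :
  place Sp -> l != 0 -> Sp f k -> k = l -> f != 0.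
Proof. by move=> pS l0 fk kl; apply: (place_neq0 pS fk); rewrite kl. Qed.

(* In characteristic 2, [deg5_G] and [deg5_d7 - deg5_n7] vanish at all points over the prime field;
   the element [T] provides a point over a larger field. *)
Hypotheses (T0 : T != 0) (T1 : T + 1 != 0).
Hypothesis s_place : forall (K' : fieldType) (incl : {rmorphism K -> K'}) (k1 k2 k3 l4 l5 : K'),
  exists Sp : E -> K' -> Prop, [/\ place Sp, forall c, Sp (iota c) (incl c),
    Sp s1 k1, Sp s2 k2 & [/\ Sp s3 k3, Sp x4 l4 & Sp x5 l5]].

Lemma deg5_nonzero :
  [/\ deg5_P s1 s2 s3 != 0, deg5_I s1 s2 s3 != 0, deg5_I4 s1 s2 s3 != 0 & deg5_Q s1 s2 s3 != 0] /\
  [/\ deg5_n5 s1 s2 s3 != 0, deg5_d5 s1 s2 s3 != 0, deg5_n7 s1 s2 s3 != 0 & deg5_d7 s1 s2 s3 != 0] /\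
  [/\ deg5_w != 0, deg5_chi != 0 & deg5_G != 0] /\
  [/\ deg5_d5 s1 s2 s3 - deg5_n5 s1 s2 s3 != 0, deg5_d7 s1 s2 s3 - deg5_n7 s1 s2 s3 != 0 &
      deg5_d5 s1 s2 s3 * x4 - deg5_n5 s1 s2 s3 * x5 != 0] /\
  deg5_d7 s1 s2 s3 * x4 - deg5_n7 s1 s2 s3 * x5 != 0 /\
  (deg5_d7 s1 s2 s3 * x4 - deg5_n7 s1 s2 s3 * x5)
    ^+ 2 - A * (deg5_d7 s1 s2 s3 - deg5_n7 s1 s2 s3) ^+ 2 != 0.
Proof.
have N1 : -1 != 0 :> K by rewrite oppr_eq0 oner_neq0.
have one := oner_neq0 K.
have [Sp1 [P1 C1 Y11 Y12 [Y13 Y14 Y15]]] := s_place idfun 2 1 0 1 0.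
have [Sp2 [P2 C2 Y21 Y22 [Y23 Y24 Y25]]] := s_place idfun 1 1 0 1 0.
have [Sp3 [P3 C3 Y31 Y32 [Y33 Y34 Y35]]] := s_place idfun 1 0 0 1 0.
have [Sp4 [P4 C4 Y41 Y42 [Y43 Y44 Y45]]] := s_place idfun 0 1 0 1 0.
have hI : deg5_I s1 s2 s3 != 0.
  by eapply (place_neq0_eq P4 one); rewrite /deg5_I; [place_value P4 | ring].
have hQ : deg5_Q s1 s2 s3 != 0.
  by eapply (place_neq0_eq P3 N1); rewrite /deg5_Q; [place_value P3 | ring].
have hn5 : deg5_n5 s1 s2 s3 != 0.
  by eapply (place_neq0_eq P1 N1); rewrite /deg5_n5; [place_value P1 | ring].
have hdn5 : deg5_d5 s1 s2 s3 - deg5_n5 s1 s2 s3 != 0.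
  by eapply (place_neq0_eq P1 one); rewrite /deg5_n5 /deg5_d5; [place_value P1 | ring].
(* Away from characteristic 2 the points are chosen to give powers of 2 up to sign, once with a
   factor [a]; in characteristic 2 they give odd integers or products of [T], [T + 1] and [A]. *)
have [two0 | two] := eqVneq (2 : K) 0; last first.
  have two' n : 2 ^+ n != 0 :> K by rewrite expf_neq0.
  have two'' n : - 2 ^+ n != 0 :> K by rewrite oppr_eq0 expf_neq0.
  have [Sp5 [P5 C5 Y51 Y52 [Y53 Y54 Y55]]] := s_place idfun 0 1 1 1 0.
  have [Sp6 [P6 C6 Y61 Y62 [Y63 Y64 Y65]]] := s_place idfun 2 1 0 0 0.
have hP : deg5_P s1 s2 s3 != 0.
    by eapply (place_neq0_eq P1 (two' 2)); rewrite /deg5_P; [place_value P1 | ring].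
  have hI4 : deg5_I4 s1 s2 s3 != 0.
    by eapply (place_neq0_eq P1 (two'' 1)); rewrite /deg5_I4; [place_value P1 | ring].
  have hd5 : deg5_d5 s1 s2 s3 != 0.
    by eapply (place_neq0_eq P5 (two'' 3)); deg5_unfold; [place_value P5 | ring].
  have hn7 : deg5_n7 s1 s2 s3 != 0.
    by eapply (place_neq0_eq P1 (two' 1)); deg5_unfold; [place_value P1 | ring].
  have hd7 : deg5_d7 s1 s2 s3 != 0.
    by eapply (place_neq0_eq P1 (two' 2)); deg5_unfold; [place_value P1 | ring].
  have hw : deg5_w != 0.
    by eapply (place_neq0_eq P1 (two'' 2)); deg5_unfold; [place_value P1 | ring].
  have hc : deg5_chi != 0.
    by eapply (place_neq0_eq P1 N1); deg5_unfold; [place_value P1 | ring].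
  have hG : deg5_G != 0.
    by eapply (place_neq0_eq P1 (two' 2)); deg5_unfold; [place_value P1 | ring].
  have hdn : deg5_d7 s1 s2 s3 - deg5_n7 s1 s2 s3 != 0.
    by eapply (place_neq0_eq P1 (two' 1)); deg5_unfold; [place_value P1 | ring].
  have hB5 : deg5_d5 s1 s2 s3 * x4 - deg5_n5 s1 s2 s3 * x5 != 0.
    by eapply (place_neq0_eq P5 (two'' 3)); deg5_unfold; [place_value P5 | ring].
  have hB7 : deg5_d7 s1 s2 s3 * x4 - deg5_n7 s1 s2 s3 * x5 != 0.
    by eapply (place_neq0_eq P1 (two' 2)); deg5_unfold; [place_value P1 | ring].
  have hBs : (deg5_d7 s1 s2 s3 * x4 - deg5_n7 s1 s2 s3 * x5)
      ^+ 2 - A * (deg5_d7 s1 s2 s3 - deg5_n7 s1 s2 s3) ^+ 2 != 0.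
    eapply (place_neq0_eq P6 (l := - (a * 2 ^+ 2))); first by rewrite oppr_eq0 mulf_neq0.
    { deg5_unfold; place_value P6. } rewrite /=; ring.
  by [].
have odd (k q : K) : k = 1 + 2 * q -> k = 1 by rewrite two0 mul0r addr0.
have [Sp5 [P5 C5 Y51 Y52 [Y53 Y54 Y55]]] := s_place idfun 0 0 1 1 0.
have [Sp6 [P6 C6 Y61 Y62 [Y63 Y64 Y65]]] := s_place iota T 1 0 0 0.
  have hP : deg5_P s1 s2 s3 != 0.
    by eapply (place_neq0_eq P2 one); rewrite /deg5_P; [place_value P2 | apply: (odd _ (- 3)); ring].
  have hI4 : deg5_I4 s1 s2 s3 != 0.
    by eapply (place_neq0_eq P5 one); rewrite /deg5_I4; [place_value P5 | apply: (odd _ 4); ring].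
  have hd5 : deg5_d5 s1 s2 s3 != 0.
    by eapply (place_neq0_eq P2 one); deg5_unfold; [place_value P2 | apply: (odd _ 1); ring].
  have hn7 : deg5_n7 s1 s2 s3 != 0.
    by eapply (place_neq0_eq P2 one); deg5_unfold; [place_value P2 | apply: (odd _ 3); ring].
  have hd7 : deg5_d7 s1 s2 s3 != 0.
    by eapply (place_neq0_eq P2 one); deg5_unfold; [place_value P2 | apply: (odd _ 6); ring].
  have hw : deg5_w != 0.
    by eapply (place_neq0_eq P2 one); deg5_unfold; [place_value P2 | apply: (odd _ 2); ring].
  have hc : deg5_chi != 0.
    by eapply (place_neq0_eq P4 one); deg5_unfold; [place_value P4 | apply: (odd _ 13); ring].
  have hB5 : deg5_d5 s1 s2 s3 * x4 - deg5_n5 s1 s2 s3 * x5 != 0.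
    by eapply (place_neq0_eq P2 one); deg5_unfold; [place_value P2 | apply: (odd _ 1); ring].
  have hB7 : deg5_d7 s1 s2 s3 * x4 - deg5_n7 s1 s2 s3 * x5 != 0.
    by eapply (place_neq0_eq P2 one); deg5_unfold; [place_value P2 | apply: (odd _ 6); ring].
have two0' : 2 = 0 :> E by rewrite -(rmorph_nat iota) two0 rmorph0.
  (* The witnesses [q] below are half the difference between the integral polynomial in [T] that is
     the value and its factored form modulo 2. *)
  have even (k l q : E) : k = l + 2 * q -> k = l by rewrite two0' mul0r addr0.
  have hG : deg5_G != 0.
    eapply (place_neq0_eq P6 (l := T ^+ 2 * (T + 1) ^+ 8)).
    + by rewrite mulf_neq0 ?expf_neq0.
    + deg5_unfold; place_value P6.
    apply: (even _ _ (972 + 2713 * T ^+ 2 - 4 * T ^+ 3 - 5873 * T ^+ 4 - 28 * T ^+ 5 + 4333 * T ^+ 6 - 28 * T ^+ 7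
      - 1704 * T ^+ 8 - 4 * T ^+ 9 + 365 * T ^+ 10 - 42 * T ^+ 12 + 2 * T ^+ 14)); ring.
  have hdn : deg5_d7 s1 s2 s3 - deg5_n7 s1 s2 s3 != 0.
    eapply (place_neq0_eq P6 (l := T * (T + 1))).
    + by rewrite mulf_neq0.
    + deg5_unfold; place_value P6.
    apply: (even _ _ (12 - 5 * T - 7 * T ^+ 2 + T ^+ 3 + T ^+ 4)); ring.
  have hBs : (deg5_d7 s1 s2 s3 * x4 - deg5_n7 s1 s2 s3 * x5)
      ^+ 2 - A * (deg5_d7 s1 s2 s3 - deg5_n7 s1 s2 s3) ^+ 2 != 0.
    eapply (place_neq0_eq P6 (l := - (A * (T * (T + 1)) ^+ 2))).
    + by rewrite oppr_eq0 mulf_neq0 ?expf_neq0 ?mulf_neq0 ?fmorph_eq0.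
    + deg5_unfold; place_value P6.
    rewrite -[T * (T + 1)](even (T * (T + 1) + 2 * (12 - 5 * T - 7 * T ^+ 2 + T ^+ 3 + T ^+ 4)) _ _ erefl); ring.
by [].
Qed.

End Generic5.

(** With [b = n5 / d5] and [c = n7 / d7], each ratio is [1 + (b - c) / (r_i - b)], and the inverses
    of the [r_i - b] add up to minus the logarithmic derivative at [b] of the cubic with roots
    [r_i]. *)
Lemma deg5_cross_sum (E : fieldType) (r1 r2 r3 n5 d5 n7 d7 : E) : d5 != 0 -> d7 != 0 -> n5 != 0 ->
    r1 - n5 / d5 != 0 -> r2 - n5 / d5 != 0 -> r3 - n5 / d5 != 0 ->
  let s1 := r1 + r2 + r3 in let s2 := r1 * r2 + r1 * r3 + r2 * r3 in let s3 := r1 * r2 * r3 in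
  let chi := n5 ^+ 3 - s1 * n5 ^+ 2 * d5 + s2 * n5 * d5 ^+ 2 - s3 * d5 ^+ 3 in
  (4 * n5 * d7 + n7 * d5) * chi - (n5 * d7 - n7 * d5) * n5 *
     (3 * n5 ^+ 2 - 2 * s1 * n5 * d5 + s2 * d5 ^+ 2) =
  n5 * d7 * chi * (1 + n7 / d7 / (n5 / d5) + (r1 - n7 / d7) / (r1 - n5 / d5) +
    (r2 - n7 / d7) / (r2 - n5 / d5) + (r3 - n7 / d7) / (r3 - n5 / d5)).
Proof.
move=> d50 d70 n50; set b := n5 / d5; set c := n7 / d7.
have -> : n5 = b * d5 by rewrite divfK.
have -> : n7 = c * d7 by rewrite divfK.
move=> u1 u2 u3 s1 s2 s3 chi; rewrite /chi /s1 /s2 /s3.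
have b0 : b != 0 by rewrite mulf_neq0 ?invr_eq0.
by field; rewrite b0 u1 u2 u3.
Qed.

(** * The five generators in degree 5 and the recovery of the variables *)

Section Recover5.
Variables (E : fieldType) (A x1 x2 x3 x4 x5 : E).
Hypotheses (A0 : A != 0) (x10 : x1 != 0) (x20 : x2 != 0) (x30 : x3 != 0) (x40 : x4 != 0) (x50 : x5 != 0).
Hypotheses (x15 : x1 - x5 != 0) (x25 : x2 - x5 != 0) (x35 : x3 - x5 != 0) (x45 : x4 - x5 != 0).
Hypotheses (x14 : x1 - x4 != 0) (x24 : x2 - x4 != 0) (x34 : x3 - x4 != 0).
Hypotheses (x12 : x1 - x2 != 0) (x13 : x1 - x3 != 0) (x23 : x2 - x3 != 0).

Let r1 := (x1 - x4) / (x1 - x5).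
Let r2 := (x2 - x4) / (x2 - x5).
Let r3 := (x3 - x4) / (x3 - x5).
Let s1 := r1 + r2 + r3.
Let s2 := r1 * r2 + r1 * r3 + r2 * r3.
Let s3 := r1 * r2 * r3.
Let P := deg5_P s1 s2 s3.
Let I := deg5_I s1 s2 s3.
Let I4 := deg5_I4 s1 s2 s3.
Let Q := deg5_Q s1 s2 s3.
Let J := deg5_J s1 s2 s3.
Let n5 := deg5_n5 s1 s2 s3.
Let d5 := deg5_d5 s1 s2 s3.
Let n7 := deg5_n7 s1 s2 s3.
Let d7 := deg5_d7 s1 s2 s3.
Let th := deg5_th r1 r2 r3 / I4.
Let B := deg5_B x4 x5.
Hypotheses (P0 : P != 0) (I0 : I != 0) (I40 : I4 != 0) (Q0 : Q != 0).
Hypotheses (n50 : n5 != 0) (d50 : d5 != 0) (n70 : n7 != 0) (d70 : d7 != 0).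
Hypotheses (w0 : deg5_w s1 s2 s3 != 0) (chi0 : deg5_chi s1 s2 s3 != 0) (G0 : deg5_G s1 s2 s3 != 0).
Hypotheses (dn50 : d5 - n5 != 0) (dn70 : d7 - n7 != 0).
Hypotheses (B50 : d5 * x4 - n5 * x5 != 0) (B70 : d7 * x4 - n7 * x5 != 0).
Hypotheses (Bsq0 : (d7 * x4 - n7 * x5) ^+ 2 - A * (d7 - n7) ^+ 2 != 0).

Let b5 := n5 / d5.
Let b7 := n7 / d7.
Let B1 := B b7.
Let B2 := B b5.
(** The square root of the discriminant over [I4], which changes sign; [Y], [f2] and [f3] combine it
    with elements that change sign too. *)
Let om := th - (1 - th).
Let Y := (B1 - A / B1) / om.
Let X := B1 - th * Y.
Let f2 := - (B1 / (B2 - B1) + th) / om.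
Let D := (x1 - B1) / (x1 - B2) + (x2 - B1) / (x2 - B2) + (x3 - B1) / (x3 - B2) +
  (x4 - B1) / (x4 - B2) + (x5 - B1) / (x5 - B2).
Let f3 := D * (B2 / (B2 - B1)) * om.
Let v := deg5_v (P * I / I4) (J / I4 ^+ 2).

Let b50 : b5 != 0. Proof. by rewrite mulf_neq0 ?invr_eq0. Qed.
Let b70 : b7 != 0. Proof. by rewrite mulf_neq0 ?invr_eq0. Qed.
Let b51 : 1 - b5 != 0.
Proof. by rewrite (_ : _ - _ = (d5 - n5) / d5) ?mulf_neq0 ?invr_eq0 // /b5; field. Qed.
Let b71 : 1 - b7 != 0.
Proof. by rewrite (_ : _ - _ = (d7 - n7) / d7) ?mulf_neq0 ?invr_eq0 // /b7; field. Qed.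
Let b57 : b5 - b7 != 0.
Proof.
rewrite (_ : _ - _ = (n5 * d7 - n7 * d5) / (d5 * d7)); last by rewrite /b5 /b7; field; rewrite d50 d70.
by rewrite mulf_neq0 ?invr_eq0 ?mulf_neq0.
Qed.

Let B1E : B1 = (d7 * x4 - n7 * x5) / (d7 - n7).
Proof. by rewrite /B1 /B /deg5_B /b7; field; rewrite d70 dn70. Qed.
Let B2E : B2 = (d5 * x4 - n5 * x5) / (d5 - n5).
Proof. by rewrite /B2 /B /deg5_B /b5; field; rewrite d50 dn50. Qed.
Let B1_0 : B1 != 0. Proof. by rewrite B1E mulf_neq0 ?invr_eq0. Qed.
Let B2_0 : B2 != 0. Proof. by rewrite B2E mulf_neq0 ?invr_eq0. Qed.
Let B21 : B2 - B1 != 0.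
Proof.
rewrite (_ : _ - _ = (x4 - x5) * (b5 - b7) / ((1 - b5) * (1 - b7))).
  by rewrite !mulf_neq0 ?invr_eq0 ?mulf_neq0.
by rewrite /B1 /B2 /B /deg5_B; field; rewrite b51 b71.
Qed.
Let Bsq : B1 - A / B1 != 0.
Proof.
have : B1 ^+ 2 - A != 0.
  rewrite (_ : _ - _ = ((d7 * x4 - n7 * x5) ^+ 2 - A * (d7 - n7) ^+ 2) / (d7 - n7) ^+ 2).
    by rewrite mulf_neq0 ?invr_eq0 ?expf_neq0.
  by rewrite B1E; field.
have -> : B1 ^+ 2 - A = (B1 - A / B1) * B1 by field.
by apply: contraNneq => ->; rewrite mul0r.
Qed.

Let r_diff x y : x - y != 0 -> x - x5 != 0 -> y - x5 != 0 ->
  (x - x4) / (x - x5) - (y - x4) / (y - x5) != 0.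
Proof.
move=> xy xx5 yx5; rewrite (_ : _ - _ = (x - y) * (x4 - x5) / ((x - x5) * (y - x5))).
  by rewrite !mulf_neq0 ?invr_eq0 ?mulf_neq0.
by field; rewrite xx5 yx5.
Qed.
Let r10 : r1 != 0. Proof. by rewrite mulf_neq0 ?invr_eq0. Qed.
Let r20 : r2 != 0. Proof. by rewrite mulf_neq0 ?invr_eq0. Qed.
Let r30 : r3 != 0. Proof. by rewrite mulf_neq0 ?invr_eq0. Qed.

Let om0 : om != 0.
Proof.
rewrite (_ : om = s3 * ((r1 - r2) * (r1 - r3) * (r2 - r3)) / I4); last first.
  rewrite /om /th; apply: (mulIf I40); rewrite divfK // (_ : _ * I4 = 2 * deg5_th r1 r2 r3 - I4); last by field.
  by rewrite /I4 /deg5_th /deg5_tn /cyc /deg5_I4 /s1 /s2 /s3; ring.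
apply: mulf_neq0; last by rewrite invr_eq0.
apply: mulf_neq0; first exact: mulf_neq0 (mulf_neq0 r10 r20) r30.
by apply: mulf_neq0; [apply: mulf_neq0|]; exact: r_diff.
Qed.

Let chiE : deg5_chi s1 s2 s3 = d5 ^+ 3 * ((b5 - r1) * (b5 - r2) * (b5 - r3)).
Proof.
rewrite /deg5_chi -/n5 -/d5 (_ : n5 = b5 * d5); last by rewrite /b5 divfK.
by rewrite /s1 /s2 /s3; ring.
Qed.

Let rb : [/\ r1 - b5 != 0, r2 - b5 != 0 & r3 - b5 != 0].
Proof.
have := chi0; rewrite chiE !mulf_eq0 !negb_or => /andP [_ /andP [/andP [h1 h2] h3]].
by split; rewrite -opprB oppr_eq0.
Qed.

(** [A] is the product of [B1 = X + th * Y] and its image [X + (1 - th) * Y], where [th] enters only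
    through [th * (1 - th)]. *)
Lemma deg5_XY : J / I4 ^+ 2 = (A - X ^+ 2 - X * Y) / Y ^+ 2.
Proof.
have Y0 : Y != 0 by rewrite mulf_neq0 ?invr_eq0.
rewrite -deg5_thE -/th //; apply: (canRL (mulfK (expf_neq0 2 Y0))).
have XY : X + (1 - th) * Y = A / B1.
  rewrite (_ : _ + _ = B1 - om * Y); last by rewrite /X /om; ring.
  by rewrite /Y mulrC divfK //; ring.
have -> : A = (X + th * Y) * (X + (1 - th) * Y) by rewrite XY /X subrK mulrC divfK.
by ring.
Qed.

Let m1 := (r1 - b7) / (r1 - b5).
Let m2 := (r2 - b7) / (r2 - b5).
Let m3 := (r3 - b7) / (r3 - b5).
Let m4 := b7 / b5.
Let sc := (1 - b5) / (1 - b7).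

(** A Möbius change of coordinate multiplies the ratio of the differences to two given points by a
    constant, here [sc]. *)
Let cross_gen x : x - x5 != 0 -> let r := (x - x4) / (x - x5) in r - b5 != 0 ->
  x - B2 != 0 /\ (x - B1) / (x - B2) = sc * ((r - b7) / (r - b5)).
Proof.
move=> xx5 r rb5.
have r1x : 1 - r != 0.
  by rewrite (_ : 1 - r = (x4 - x5) / (x - x5)) ?mulf_neq0 ?invr_eq0 // /r; field.
have xE b : 1 - b != 0 -> x - B b = (x4 - x5) * (r - b) / ((1 - r) * (1 - b)).
  have -> : x = (x4 - r * x5) / (1 - r).
    by apply: (canRL (mulfK r1x)); rewrite /r; field.
  by move=> b1; rewrite /B /deg5_B; field; rewrite r1x b1.
split; first by rewrite xE ?mulf_neq0 ?invr_eq0 ?mulf_neq0.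
by rewrite !xE // /sc; field; rewrite x45 rb5 r1x b71 b51.
Qed.

Let cross1 : x1 - B2 != 0 /\ (x1 - B1) / (x1 - B2) = sc * m1.
Proof. by case: rb => *; apply: cross_gen. Qed.
Let cross2 : x2 - B2 != 0 /\ (x2 - B1) / (x2 - B2) = sc * m2.
Proof. by case: rb => *; apply: cross_gen. Qed.
Let cross3 : x3 - B2 != 0 /\ (x3 - B1) / (x3 - B2) = sc * m3.
Proof. by case: rb => *; apply: cross_gen. Qed.
Let cross4 : x4 - B2 != 0 /\ (x4 - B1) / (x4 - B2) = sc * m4.
Proof.
have xE b : 1 - b != 0 -> x4 - B b = - (x4 - x5) * b / (1 - b) by move=> b1; rewrite /B /deg5_B; field.
split; first by rewrite xE ?mulf_neq0 ?invr_eq0 ?oppr_eq0.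
by rewrite !xE // /sc /m4; field; rewrite oppr_eq0 x45 b50 b71 b51.
Qed.
(** The coordinate of [x5] is infinite, and the ratio is [1] there. *)
Let cross5 : x5 - B2 != 0 /\ (x5 - B1) / (x5 - B2) = sc * 1.
Proof.
have xE b : 1 - b != 0 -> x5 - B b = - (x4 - x5) / (1 - b) by move=> b1; rewrite /B /deg5_B; field.
split; first by rewrite xE ?mulf_neq0 ?invr_eq0 ?oppr_eq0.
by rewrite !xE // /sc; field; rewrite oppr_eq0 x45 b71 b51.
Qed.

Lemma deg5_fixed (phi : {rmorphism E -> E}) : phi A = A -> deg5_flip A x1 x2 x3 x4 x5 phi ->
  [/\ phi v = v, phi X = X, phi Y = Y, phi f2 = f2 & phi f3 = f3].
Proof.
move=> pA pX.
have [pth pv pB2 pB1] : [/\ phi th = 1 - th, phi v = v, phi B2 = A / B2 & phi B1 = A / B1].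
  exact: (@deg5_action E A x1 x2 x3 x4 x5).
have pom : phi om = - om.
  by rewrite /om [LHS]rmorphB [phi (1 - _)]rmorphB rmorph1 pth; ring.
have pY : phi Y = Y.
  rewrite /Y fmorph_div [phi (B1 - _)]rmorphB [phi (A / _)]fmorph_div pA pB1 pom.
  by rewrite (_ : A / (A / B1) = B1); field; rewrite ?A0 ?B1_0 ?oppr_eq0 ?om0.
have pXX : phi X = X.
  have YE : om * Y = B1 - A / B1 by rewrite /Y mulrC divfK.
  rewrite /X [LHS]rmorphB [phi (th * _)]rmorphM pB1 pth pY.
  apply/eqP; rewrite -subr_eq0; apply/eqP.
  rewrite [LHS](_ : _ = om * Y - (B1 - A / B1)); first by rewrite YE subrr.
  by rewrite /om; ring.
have pu : phi (B2 - B1) = A / B2 - A / B1 by rewrite rmorphB pB1 pB2.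
have BB : A / B2 - A / B1 = - (A * (B2 - B1)) / (B1 * B2) by field; rewrite B1_0 B2_0.
have BB0 : - (A * (B2 - B1)) != 0 by rewrite oppr_eq0 mulf_neq0.
have pf2 : phi f2 = f2.
  rewrite /f2 fmorph_div rmorphN [phi (_ + _)]rmorphD [phi (B1 / _)]fmorph_div pu pom pB1 pth BB.
  rewrite [A / B1 / _](_ : _ = - 1 - B1 / (B2 - B1)).
    by field; rewrite oppr_eq0 om0 B21.
  by field; rewrite BB0 B21 B1_0 B2_0.
(* Inversion multiplies every ratio by [B2 / B1], and the permutation only reorders the sum. *)
have pD : phi D = B2 / B1 * D.
  have ratio x : x != 0 -> x - B2 != 0 ->
      (A / x - A / B1) / (A / x - A / B2) = B2 / B1 * ((x - B1) / (x - B2)).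
    move=> x0 xB2; rewrite (_ : A / x - A / B2 = - A * (x - B2) / (x * B2)); last by field; rewrite x0 B2_0.
    rewrite (_ : A / x - A / B1 = - A * (x - B1) / (x * B1)); last by field; rewrite x0 B1_0.
    by field; rewrite ?oppr_eq0 A0 x0 B1_0 B2_0 xB2.
  have px x : phi ((x - B1) / (x - B2)) = (phi x - A / B1) / (phi x - A / B2).
    by rewrite fmorph_div [phi (x - B1)]rmorphB [phi (x - B2)]rmorphB pB1 pB2.
  have [[h1 _] [h2 _] [h3 _] [[h4 _] [h5 _]]] := And4 cross1 cross2 cross3 (conj cross4 cross5).
  have -> : phi D = phi ((x1 - B1) / (x1 - B2)) + phi ((x2 - B1) / (x2 - B2)) +
      phi ((x3 - B1) / (x3 - B2)) + phi ((x4 - B1) / (x4 - B2)) + phi ((x5 - B1) / (x5 - B2)).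
    by rewrite -!rmorphD.
  rewrite !px; have := (ratio x1 x10 h1, ratio x2 x20 h2, ratio x3 x30 h3, ratio x4 x40 h4, ratio x5 x50 h5).
  move=> rs; case: pX => -[-> -> -> -> ->]; rewrite !rs /D; ring.
have pf3 : phi f3 = f3.
  rewrite /f3 [LHS]rmorphM [phi (D * _)]rmorphM [phi (B2 / _)]fmorph_div pD pu pom pB2 BB.
  by field; rewrite BB0 B21 B1_0 B2_0.
by split.
Qed.

Let e1m := 1 + m4 + m1 + m2 + m3.
Let e1m0 : e1m != 0.
Proof.
have [u1 u2 u3] := rb; have := deg5_cross_sum n7 d50 d70 n50 u1 u2 u3.
rewrite /= => H; move: G0; apply: contra_neq => h.
rewrite /deg5_G /deg5_w /deg5_chi; apply: (etrans H).
by rewrite (_ : _ + (r3 - n7 / d7) / (r3 - n5 / d5) = 0) ?mulr0 //; exact: h.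
Qed.

(** The unknown factor [mu] cancels in quantities of weight zero, so [th] and the [m_i] lie in [M].
    Then [X] and [Y] give [B1], [f2] gives [B2], and [f3] gives [D], hence [sc]; each variable is
    found from its ratio [sc * m_i]. *)
Lemma deg5_recover (M : E -> Prop) : subfield M -> M X -> M Y -> M f2 -> M f3 ->
  (exists mu, [/\ mu != 0, M (mu * r1), M (mu * r2) & M (mu * r3)]) ->
  [/\ M x1, M x2, M x3, M x4 & M x5].
Proof.
move=> fM MX MY Mf2 Mf3 [mu [mu0 Mr1 Mr2 Mr3]].
have Ms1 : M (mu * s1).
  by rewrite (_ : mu * s1 = mu * r1 + mu * r2 + mu * r3); [in_subfield fM | rewrite /s1; ring].
have Ms2 : M (mu ^+ 2 * s2).
  rewrite (_ : _ * s2 = (mu * r1) * (mu * r2) + (mu * r1) * (mu * r3) + (mu * r2) * (mu * r3)).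
    by in_subfield fM.
  by rewrite /s2; ring.
have Ms3 : M (mu ^+ 3 * s3).
  by rewrite (_ : _ * s3 = (mu * r1) * (mu * r2) * (mu * r3)); [in_subfield fM | rewrite /s3; ring].
have Mn5 : M (mu ^+ 8 * n5) by rewrite -deg5_n5_scale /deg5_n5; in_subfield fM.
have Md5 : M (mu ^+ 7 * d5) by rewrite -deg5_d5_scale /deg5_d5; in_subfield fM.
have Mn7 : M (mu ^+ 11 * n7) by rewrite -deg5_n7_scale /deg5_n7; in_subfield fM.
have Md7 : M (mu ^+ 10 * d7) by rewrite -deg5_d7_scale /deg5_d7; in_subfield fM.
have MI4 : M (mu ^+ 6 * I4) by rewrite -deg5_I4_scale /deg5_I4; in_subfield fM.
have Mtn : M (mu ^+ 6 * deg5_th r1 r2 r3).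
  by rewrite -deg5_th_scale /deg5_th /deg5_tn /cyc; in_subfield fM.
have Mth : M th.
  rewrite (_ : th = (mu ^+ 6 * deg5_th r1 r2 r3) / (mu ^+ 6 * I4)); first by in_subfield fM.
  by rewrite /th; field; rewrite mu0 I40.
have Mb5 : M (mu * b5).
  rewrite (_ : mu * b5 = (mu ^+ 8 * n5) / (mu ^+ 7 * d5)); first by in_subfield fM.
  by rewrite /b5; field; rewrite mu0 d50.
have Mb7 : M (mu * b7).
  rewrite (_ : mu * b7 = (mu ^+ 11 * n7) / (mu ^+ 10 * d7)); first by in_subfield fM.
  by rewrite /b7; field; rewrite mu0 d70.
have Mm r : M (mu * r) -> r - b5 != 0 -> M ((r - b7) / (r - b5)).
  move=> Mr rb0; rewrite (_ : _ / _ = (mu * r - mu * b7) / (mu * r - mu * b5)); first by in_subfield fM.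
  by rewrite -!mulrBr -mulf_div divff // mul1r.
have [u1 u2 u3] := rb.
have Mm1 : M m1 by exact: Mm.
have Mm2 : M m2 by exact: Mm.
have Mm3 : M m3 by exact: Mm.
have Mm4 : M m4.
  rewrite (_ : m4 = (mu * b7) / (mu * b5)); first by in_subfield fM.
  by rewrite -mulf_div divff // mul1r.
have Mom : M om by rewrite /om; in_subfield fM.
have MB1 : M B1 by rewrite (_ : B1 = X + th * Y); [in_subfield fM | rewrite /X subrK].
have MB2 : M B2.
  have g2E : - (th + om * f2) = B1 / (B2 - B1).
    by rewrite /f2 mulrC divfK //; ring.
  rewrite (_ : B2 = B1 + B1 / - (th + om * f2)); first by in_subfield fM.
  by rewrite g2E; field; rewrite ?B1_0 ?B21.
have Mdf : M (B2 - B1) by in_subfield fM.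
have DE : D = sc * e1m.
  have [[_ h1] [_ h2] [_ h3] [[_ h4] [_ h5]]] := And4 cross1 cross2 cross3 (conj cross4 cross5).
  by rewrite /D h1 h2 h3 h4 h5 /e1m; ring.
have MD : M D.
  rewrite (_ : D = f3 * (B2 - B1) / (B2 * om)); first by in_subfield fM.
  by rewrite /f3; field; rewrite om0 B2_0 B21.
have Msc : M sc.
  rewrite (_ : sc = D / e1m); first by rewrite /e1m; in_subfield fM.
  by rewrite DE mulfK.
have Mx x m : x - B2 != 0 /\ (x - B1) / (x - B2) = sc * m -> M m -> M x.
  move=> [xB2 xE] Mm'; have My : M (sc * m) by in_subfield fM.
  rewrite (_ : x = (B1 - sc * m * B2) / (1 - sc * m)); first by in_subfield fM.
  rewrite -xE (_ : 1 - _ / _ = (B1 - B2) / (x - B2)); last by field.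
  have B12 : B1 - B2 != 0 by rewrite -opprB oppr_eq0.
  by field; rewrite xB2 B12.
by split; [exact: (Mx _ m1)|exact: (Mx _ m2)|exact: (Mx _ m3)|exact: (Mx _ m4)|apply: (Mx _ 1 cross5); exact: subfield1].
Qed.

Lemma deg5_full (L : E -> Prop) : subfield L -> L A -> L v -> L X -> L Y -> L f2 -> L f3 ->
  exists M, extension L 120 M /\ [/\ M x1, M x2, M x3, M x4 & M x5].
Proof.
move=> fL LA Lv LX LY Lf2 Lf3.
have Lj : L (J / I4 ^+ 2) by rewrite deg5_XY; in_subfield fL.
have [M [eM sub M1 M2 M3]] : exists M, [/\ extension L 120 M, forall z, L z -> M z, M (P / Q * r1),
    M (P / Q * r2) & M (P / Q * r3)] by exact: (@deg5_extension E r1 r2 r3).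
exists M; split=> //; apply: deg5_recover; try (apply: sub; assumption).
  exact: extension_subfield eM.
by exists (P / Q); split=> //; rewrite mulf_neq0 ?invr_eq0.
Qed.

End Recover5.

Section Rational5Generic.
Variables (K E : fieldType) (iota : {rmorphism K -> E}) (a : K) (x1 x2 x3 x4 x5 : E).
Hypothesis a0 : a != 0.
Hypothesis generic : forall y : 'I_5 -> E,
  (forall x, x \in [:: x1; x2; x3; x4; x5] -> algebraic (adjoined iota y) x) ->
  algebraically_independent iota y.
Local Notation A := (iota a).

Lemma deg5_place (K' : fieldType) (incl : {rmorphism K -> K'}) (s : seq E) (pt : seq K') :
    (forall L, subfield L -> L s`_0 -> L s`_1 -> L s`_2 -> L s`_3 -> L s`_4 ->
      forall x, x \in [:: x1; x2; x3; x4; x5] -> algebraic L x) ->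
  exists Sp, [/\ place Sp, forall c, Sp (iota c) (incl c), Sp s`_0 pt`_0, Sp s`_1 pt`_1 &
    [/\ Sp s`_2 pt`_2, Sp s`_3 pt`_3 & Sp s`_4 pt`_4]].
Proof.
move=> Hs; pose y (i : 'I_5) := s`_i; pose ord i (lt : (i < 5)%N) : 'I_5 := Ordinal lt.
have indy : algebraically_independent iota y.
  apply: generic => x; apply: Hs; first exact: adjoined_subfield.
  - exact: (adjoined_gen iota y (@ord 0%N isT)).
  - exact: (adjoined_gen iota y (@ord 1%N isT)).
  - exact: (adjoined_gen iota y (@ord 2%N isT)).
  - exact: (adjoined_gen iota y (@ord 3%N isT)).
  - exact: (adjoined_gen iota y (@ord 4%N isT)).
have [Sp [pS cS yS]] := independent_place incl indy (fun i => pt`_i).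
exists Sp; split=> //; [exact: (yS (@ord 0%N isT))|exact: (yS (@ord 1%N isT))|].
by split; [exact: (yS (@ord 2%N isT))|exact: (yS (@ord 3%N isT))|exact: (yS (@ord 4%N isT))].
Qed.

Let r1 := (x1 - x4) / (x1 - x5).
Let r2 := (x2 - x4) / (x2 - x5).
Let r3 := (x3 - x4) / (x3 - x5).
Let s1 := r1 + r2 + r3.
Let s2 := r1 * r2 + r1 * r3 + r2 * r3.
Let s3 := r1 * r2 * r3.
Let P := deg5_P s1 s2 s3.
Let I := deg5_I s1 s2 s3.
Let I4 := deg5_I4 s1 s2 s3.
Let J := deg5_J s1 s2 s3.
Let th := deg5_th r1 r2 r3 / I4.
Let B1 := deg5_B x4 x5 (deg5_n7 s1 s2 s3 / deg5_d7 s1 s2 s3).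
Let B2 := deg5_B x4 x5 (deg5_n5 s1 s2 s3 / deg5_d5 s1 s2 s3).
Let om := th - (1 - th).
Let Y := (B1 - A / B1) / om.
Let X := B1 - th * Y.
Let f2 := - (B1 / (B2 - B1) + th) / om.
Let D := (x1 - B1) / (x1 - B2) + (x2 - B1) / (x2 - B2) + (x3 - B1) / (x3 - B2) +
  (x4 - B1) / (x4 - B2) + (x5 - B1) / (x5 - B2).
Let f3 := D * (B2 / (B2 - B1)) * om.
Let v := deg5_v (P * I / I4) (J / I4 ^+ 2).

Lemma deg5_rational : exists g : 'I_5 -> E,
  (forall phi : {rmorphism E -> E}, phi A = A -> deg5_flip A x1 x2 x3 x4 x5 phi ->
    forall i, phi (g i) = g i) /\
  exists M, extension (adjoined iota g) 120 M /\
    forall x, x \in [:: x1; x2; x3; x4; x5] -> M x.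
Proof.
have A0 : A != 0 by rewrite fmorph_eq0.
have all5 (Q : E -> Prop) : Q x1 -> Q x2 -> Q x3 -> Q x4 -> Q x5 ->
    forall x, x \in [:: x1; x2; x3; x4; x5] -> Q x.
  move=> q1 q2 q3 q4 q5 x; rewrite !inE.
  by case/orP=> [/eqP ->//|/or4P [] /eqP ->].
have placeX pt : exists Sp, [/\ place Sp, forall c, Sp (iota c) c, Sp x1 pt`_0, Sp x2 pt`_1 &
    [/\ Sp x3 pt`_2, Sp x4 pt`_3 & Sp x5 pt`_4]].
  apply: (@deg5_place K idfun [:: x1; x2; x3; x4; x5] pt) => L fL L1 L2 L3 L4 L5.
  by apply: all5; apply: mem_algebraic.
have [Sp1 [S1 C1 X11 X12 [X13 X14 X15]]] := placeX [:: 1; 1; 1; 1; 1].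
have [Sp2 [S2 C2 X21 X22 [X23 X24 X25]]] := placeX [:: 1; 0; 0; 0; 0].
have [Sp3 [S3 C3 X31 X32 [X33 X34 X35]]] := placeX [:: 1; 1; 0; 0; 0].
have [Sp4 [S4 C4 X41 X42 [X43 X44 X45]]] := placeX [:: 1; 1; 1; 0; 0].
have [Sp5 [S5 C5 X51 X52 [X53 X54 X55]]] := placeX [:: 0; 0; 0; 1; 0].
rewrite /= in X11 X12 X13 X14 X15 X21 X22 X23 X24 X25 X31 X32 X33 X34 X35.
rewrite /= in X41 X42 X43 X44 X45 X51 X52 X53 X54 X55.
have x10 : x1 != 0 by place_nonzero S1; exact: oner_neq0.
have x20 : x2 != 0 by place_nonzero S1; exact: oner_neq0.
have x30 : x3 != 0 by place_nonzero S1; exact: oner_neq0.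
have x40 : x4 != 0 by place_nonzero S1; exact: oner_neq0.
have x50 : x5 != 0 by place_nonzero S1; exact: oner_neq0.
have x12 : x1 - x2 != 0 by place_nonzero S2; rewrite subr0 oner_neq0.
have x13 : x1 - x3 != 0 by place_nonzero S2; rewrite subr0 oner_neq0.
have x14 : x1 - x4 != 0 by place_nonzero S2; rewrite subr0 oner_neq0.
have x15 : x1 - x5 != 0 by place_nonzero S2; rewrite subr0 oner_neq0.
have x23 : x2 - x3 != 0 by place_nonzero S3; rewrite subr0 oner_neq0.
have x24 : x2 - x4 != 0 by place_nonzero S3; rewrite subr0 oner_neq0.
have x25 : x2 - x5 != 0 by place_nonzero S3; rewrite subr0 oner_neq0.
have x34 : x3 - x4 != 0 by place_nonzero S4; rewrite subr0 oner_neq0.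
have x35 : x3 - x5 != 0 by place_nonzero S4; rewrite subr0 oner_neq0.
have x45 : x4 - x5 != 0 by place_nonzero S5; rewrite subr0 oner_neq0.
have x11 : x1 + 1 != 0 by place_nonzero S5; rewrite add0r oner_neq0.
(* The [r_i] are roots of a cubic over the field of [s1, s2, s3], and [x4], [x5] turn them back into
   variables, so these five elements are coordinates. *)
have placeS (K' : fieldType) (incl : {rmorphism K -> K'}) (k1 k2 k3 l4 l5 : K') :
    exists Sp : E -> K' -> Prop, [/\ place Sp, forall c, Sp (iota c) (incl c),
      Sp s1 k1, Sp s2 k2 & [/\ Sp s3 k3, Sp x4 l4 & Sp x5 l5]].
  apply: (@deg5_place K' incl [:: s1; s2; s3; x4; x5] [:: k1; k2; k3; l4; l5]) => L fL L1 L2 L3 L4 L5.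
  rewrite /= in L1 L2 L3 L4 L5.
  have Lx x (r := (x - x4) / (x - x5)) : x - x5 != 0 -> r ^+ 3 = s1 * r ^+ 2 - s2 * r + s3 -> algebraic L x.
    move=> xx5 rE; have eM : extension L 3 (gen (add1 L r)).
      apply: (extension_power fL (extension_refl fL) (s := [:: s3; - s2; s1])).
        by case=> [|[|[|i]]] /=; rewrite ?nth_nil; in_subfield fL.
      by rewrite horner_Poly /= rE; ring.
    have fM := extension_subfield eM.
    have Mr : gen (add1 L r) r by apply: gen_in; right.
    have sub z : L z -> gen (add1 L r) z by move=> Lz; apply: gen_in; left.
    apply: (extension_mem_algebraic fL eM).
    have M4 := sub _ L4; have M5 := sub _ L5.
    have r1x : 1 - r != 0.
      by rewrite (_ : 1 - r = (x4 - x5) / (x - x5)) ?mulf_neq0 ?invr_eq0 // /r; field.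
    rewrite (_ : x = (x4 - r * x5) / (1 - r)); first by in_subfield fM.
    by apply: (canRL (mulfK r1x)); rewrite /r; field.
  apply: all5; [apply: Lx => //|apply: Lx => //|apply: Lx => //|exact: mem_algebraic|exact: mem_algebraic].
  - by rewrite -/r1 /s1 /s2 /s3; ring.
  - by rewrite -/r2 /s1 /s2 /s3; ring.
  - by rewrite -/r3 /s1 /s2 /s3; ring.
(* The variable [x1] serves as [T]. *)
have [[P0 I0 I40 Q0] [[n50 d50 n70 d70] [[w0 chi0 G0] [[dn5 dn7 B50] [B70 Bsq]]]]] :=
  deg5_nonzero a0 x10 x11 placeS.
pose g (i : 'I_5) := [:: v; X; Y; f2; f3]`_i.
exists g; split.
  move=> phi pA pX.
  have [pv pXX pY pf2 pf3] : [/\ phi v = v, phi X = X, phi Y = Y, phi f2 = f2 & phi f3 = f3].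
    exact: (@deg5_fixed E A x1 x2 x3 x4 x5).
  by case=> [[|[|[|[|[|//]]]]] lti]; rewrite /g /=.
have fL := adjoined_subfield iota g.
pose ord i (lt : (i < 5)%N) : 'I_5 := Ordinal lt.
have LA : adjoined iota g A by apply: adjoined_base.
have Lv : adjoined iota g v := adjoined_gen iota g (@ord 0%N isT).
have LX : adjoined iota g X := adjoined_gen iota g (@ord 1%N isT).
have LY : adjoined iota g Y := adjoined_gen iota g (@ord 2%N isT).
have Lf2 : adjoined iota g f2 := adjoined_gen iota g (@ord 3%N isT).
have Lf3 : adjoined iota g f3 := adjoined_gen iota g (@ord 4%N isT).
have [M [eM [M1 M2 M3 M4 M5]]] : exists M, extension (adjoined iota g) 120 M /\
    [/\ M x1, M x2, M x3, M x4 & M x5].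
  exact: (@deg5_full E A x1 x2 x3 x4 x5).
by exists M; split=> //; apply: all5.
Qed.

End Rational5Generic.

Section Rational5.
Variables (K : fieldType) (a : K).
Hypothesis a0 : a != 0.
Local Notation F := (ratfun K 5).
Local Notation C := (ratfunC K 5).
Local Notation X := (@ratfunX K 5).

Let i0 : 'I_5 := Ordinal (isT : 0 < 5)%N.
Let i1 : 'I_5 := Ordinal (isT : 1 < 5)%N.
Let i2 : 'I_5 := Ordinal (isT : 2 < 5)%N.
Let i3 : 'I_5 := Ordinal (isT : 3 < 5)%N.
Let i4 : 'I_5 := Ordinal (isT : 4 < 5)%N.

Let mem5 (P : F -> Prop) : (forall x, x \in [:: X i0; X i1; X i2; X i3; X i4] -> P x) ->
  forall i, P (X i).
Proof.
move=> PX i; apply: PX; apply: (@map_f _ _ X [:: i0; i1; i2; i3; i4]).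
by case: i => [[|[|[|[|[|//]]]]] li].
Qed.

Lemma twisted5_rational : rational_over C (@twisted_fixed_field K 5 a).
Proof.
have [|g [fixedP [M [eM MX]]]] := @deg5_rational K F C a (X i0) (X i1) (X i2) (X i3) (X i4) a0.
  by move=> y yX; apply: algebraically_independent_of_algebraic; exact: mem5.
apply: (rational_criterion a0 _ eM); last exact: mem5.
move=> k; apply: (twisted_fixed_morph a0) => phi i j ij pC pi pj pk.
apply: fixedP; first exact: pC.
case: i j ij pi pj pk => [[|[|[|[|[|//]]]]] li] [[|[|[|[|[|//]]]]] lj] // _;
  rewrite (bool_irrelevance li isT) (bool_irrelevance lj isT) => p0 p1 pk.
- by constructor 1; split; [exact: p0|exact: p1|exact: (pk i2 isT isT)|exact: (pk i3 isT isT)|exact: (pk i4 isT isT)].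
- by constructor 2; split; [exact: (pk i0 isT isT)|exact: p0|exact: p1|exact: (pk i3 isT isT)|exact: (pk i4 isT isT)].
- by constructor 3; split; [exact: (pk i0 isT isT)|exact: (pk i1 isT isT)|exact: p0|exact: p1|exact: (pk i4 isT isT)].
- by constructor 4; split; [exact: (pk i0 isT isT)|exact: (pk i1 isT isT)|exact: (pk i2 isT isT)|exact: p0|exact: p1].
Qed.

End Rational5.

Theorem theorem1p2 (K : fieldType) (a : K) (n : nat) :
  a != 0 -> n \in [:: 3; 4; 5]%N ->
  rational_over (ratfunC K n) (@twisted_fixed_field K n a).
Proof.
move=> a0; rewrite !inE => /or3P [] /eqP ->.
- exact: twisted3_rational.
- exact: twisted4_rational.
- exact: twisted5_rational.
Qed.
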